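(* Let $\Omega$ be an area quadrature domain. Every function in $\mathcal B T+\overline{\mathcal B T}$ is represented as $$\kappa_1T+\overline{\kappa_2T}\quad\text{on } b\Omega$$ by uniquely determined elements $\kappa_1$ and $\kappa_2$ of the Bergman span $\mathcal B$.
   Context: An area quadrature domain is a bounded domain $\Omega\subset\mathbb C$ without cusps in its boundary $b\Omega$ that is a quadrature domain with respect to area: there are finitely many points $w_j\in\Omega$ and constants $c_{jm}$ such that $\iint_\Omega g\,dA=\sum_{j,m}c_{jm}g^{(m)}(w_j)$ (finite sum) for all square-integrable holomorphic $g$ on $\Omega$. The boundary consists of finitely many non-intersecting $C^\infty$ smooth real analytic closed curves. $T(z)$ is the complex unit tangent vector function on $b\Omega$ pointing in the direction of the standard orientation. $B(z,w)$ is the Bergman kernel of $\Omega$. The Bergman span $\mathcal B$ is the complex linear span of the functions $z\mapsto\frac{\partial^m}{\partial\bar w^m}B(z,w)|_{w=a}$, $a\in\Omega$, $m\ge0$; these extend smoothly to $b\Omega$. $\mathcal BT+\overline{\mathcal BT}$ denotes the set of functions on $b\Omega$ of the form $\kappa_1T+\overline{\kappa_2T}$ with $\kappa_1,\kappa_2\in\mathcal B$. *)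

(* Defs.v *)
From HB Require Import structures.
From mathcomp Require Import all_boot all_order all_algebra.
From mathcomp Require Import all_classical all_reals all_analysis.
From mathcomp Require Export complex.

Set Implicit Arguments.
Unset Strict Implicit.
Unset Printing Implicit Defensive.

Import Order.TTheory GRing.Theory Num.Theory.
Import numFieldNormedType.Exports.

Local Open Scope classical_set_scope.
Local Open Scope ring_scope.
Local Open Scope complex_scope.

Section AreaQuadratureDomains.
Variable R : realType.

(* [R[i]^o] is [R[i]] with its structure of normed module over itself, so that
   [derivable f z 1] and [derive1n n f] are complex differentiability and complex
   derivatives. *)
Local Notation C := (R[i]^o).

Local Notation area := (@lebesgue_measure R \x @lebesgue_measure R)%E.

Definition plane_region (Omega : set C) : set (R * R) :=
  [set p | Omega (p.1 +i* p.2)].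

Definition area_integral (Omega : set C) (g : C -> C) : C :=
  (\int[area]_(p in plane_region Omega) complex.Re (g (p.1 +i* p.2))) +i*
  (\int[area]_(p in plane_region Omega) complex.Im (g (p.1 +i* p.2))).

Definition holomorphic_on (Omega : set C) (g : C -> C) : Prop :=
  forall z, Omega z -> derivable g z 1.

Definition bergman_space (Omega : set C) : set (C -> C) :=
  [set g | holomorphic_on Omega g /\
    area.-integrable (plane_region Omega)
      (fun p => ((complex.Re `|g (p.1 +i* p.2)|) ^+ 2)%:E)].

Definition boundary (Omega : set C) : set C := closure Omega `\` interior Omega.

Definition real_analytic (f : R -> R) : Prop :=
  forall t0, exists a : R ^nat,
    \forall t \near t0, pseries a (t - t0) @ \oo --> f t.

Definition curve_deriv (gamma : R -> C) (t : R) : C :=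
  derive1 (fun s => complex.Re (gamma s)) t +i*
  derive1 (fun s => complex.Im (gamma s)) t.

(* The curves are parametrized with period 1; the injectivity clause says both
   that each curve is simple and that distinct curves do not meet. *)
Definition analytic_boundary_curves (Omega : set C) (n : nat)
    (gamma : 'I_n -> R -> C) : Prop :=
  [/\ forall j, real_analytic (fun t => complex.Re (gamma j t)) /\
                real_analytic (fun t => complex.Im (gamma j t)),
      forall j t, curve_deriv (gamma j) t != 0,
      forall j t, gamma j (t + 1) = gamma j t,
      forall i j s t, gamma i s = gamma j t ->
        i = j /\ exists k : int, s - t = k%:~R &
      boundary Omega = \bigcup_(j in [set: 'I_n]) range (gamma j)].

(* Standard orientation: [Omega] lies to the left of the boundary curves. *)
Definition standard_orientation (Omega : set C) (n : nat)
    (gamma : 'I_n -> R -> C) : Prop :=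
  forall j t, \forall s \near (0 : R)^'+,
    Omega (gamma j t + s%:C * ((0 +i* 1) * curve_deriv (gamma j) t)).

Definition is_unit_tangent (Omega : set C) (T : C -> C) : Prop :=
  exists n (gamma : 'I_n -> R -> C),
    [/\ analytic_boundary_curves Omega gamma,
        standard_orientation Omega gamma &
        forall j t,
          T (gamma j t) = curve_deriv (gamma j) t / `|curve_deriv (gamma j) t|].

Definition bounded_domain (Omega : set C) : Prop :=
  [/\ Omega !=set0, open Omega, connected Omega & bounded_set Omega].

Definition area_quadrature_identity (Omega : set C) : Prop :=
  exists (N M : nat) (w : 'I_N -> C) (c : 'I_N -> 'I_M -> C),
    (forall j, Omega (w j)) /\
    forall g, bergman_space Omega g ->
      area_integral Omega g = \sum_(j < N) \sum_(m < M) c j m * derive1n m g (w j).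

Definition area_quadrature_domain (Omega : set C) : Prop :=
  [/\ bounded_domain Omega,
      exists n (gamma : 'I_n -> R -> C), analytic_boundary_curves Omega gamma &
      area_quadrature_identity Omega].

(* The values of [B] off [Omega] x [Omega] are irrelevant. *)
Definition is_bergman_kernel (Omega : set C) (B : C -> C -> C) : Prop :=
  forall w, Omega w ->
    bergman_space Omega (fun z => B z w) /\
    forall g, bergman_space Omega g ->
      g w = area_integral Omega (fun z => g z * (B z w)^*).

(* Wirtinger operator (d/dx + i d/dy) / 2. *)
Definition dbar (F : C -> C) (w : C) : C :=
  (curve_deriv (fun t => F (w + t%:C)) 0 +
   (0 +i* 1) * curve_deriv (fun t => F (w + (0 +i* t))) 0) / 2%:R.

Definition bergman_span (Omega : set C) (B : C -> C -> C) : set (C -> C) :=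
  [set kappa | exists n (c : 'I_n -> C) (a : 'I_n -> C) (m : 'I_n -> nat),
    (forall j, Omega (a j)) /\
    forall z, Omega z ->
      kappa z = \sum_(j < n) c j * iter (m j) dbar (B z) (a j)].

(* A holomorphic function on [Omega] extends smoothly to the boundary when all
   its derivatives extend continuously; [k] gives its boundary values. *)
Definition smooth_boundary_values (Omega : set C) (kappa k : C -> C) : Prop :=
  forall z, boundary Omega z ->
    kappa x @[x --> within Omega (nbhs z)] --> k z /\
    forall n, cvg (derive1n n kappa x @[x --> within Omega (nbhs z)]).

Definition represents (Omega : set C) (T kappa1 kappa2 f : C -> C) : Prop :=
  exists k1 k2 : C -> C,
    [/\ smooth_boundary_values Omega kappa1 k1,
        smooth_boundary_values Omega kappa2 k2 &
        forall z, boundary Omega z -> f z = k1 z * T z + (k2 z * T z)^*].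

(* Elements are functions on the boundary; values elsewhere are irrelevant. *)
Definition bergman_boundary_sum (Omega : set C) (B : C -> C -> C)
    (T : C -> C) : set (C -> C) :=
  [set f | exists kappa1 kappa2 : C -> C,
    [/\ bergman_span Omega B kappa1, bergman_span Omega B kappa2 &
        represents Omega T kappa1 kappa2 f]].

End AreaQuadratureDomains.

(* Main.v *)
(* The componentwise difference (kappa1, kappa2) of two representations satisfies
   kappa1 T + conj (kappa2 T) = 0 on the boundary.  For a polynomial p, Stokes' theorem
   turns the area integral of p' conj(kappa1) into a boundary integral of p conj(kappa1)
   against d(conj z), which by this relation is one of p kappa2 against dz, hence 0 by
   Cauchy.  So kappa1 is orthogonal to every polynomial.  On the other hand, pairing with
   kappa1 is a finite combination of evaluations of derivatives at points of the domain, so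
   Hermite interpolation lets polynomials stand in for the kernel functions B(., z), and
   kappa1 (z) = conj <B(., z), kappa1> = 0; symmetrically for kappa2.

   Stokes' theorem is replaced by the pairing with a Lipschitz cutoff chi vanishing near the
   boundary: the integral of f dbar(Phi) is 0 for f holomorphic and Phi Lipschitz with
   compact support.  With chi the minimum of radial cutoffs centred on a fine net of the
   boundary, dbar(chi) at z points along z - b for the nearest net point b, which is nearly
   normal to the curve at b; the boundary relation then makes the remaining integrand small
   compared with 1/r in the layer of width r, whose area is O(r). *)
Require Import Defs.
From mathcomp Require Import all_boot all_order all_algebra.
From mathcomp Require Import all_classical all_reals all_analysis.
From mathcomp Require Import measurable_realfun.
From mathcomp Require Import ring lra.

Set Implicit Arguments.
Unset Strict Implicit.
Unset Printing Implicit Defensive.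

Import Order.TTheory GRing.Theory Num.Theory.
Import numFieldNormedType.Exports.
Import ComplexField.Normc.

Local Open Scope classical_set_scope.
Local Open Scope ring_scope.
Local Open Scope complex_scope.

(** * Complex norm and topology in epsilon-delta form *)

Section ComplexNorm.
Variable R : realType.
Implicit Types z w : R[i].

(** The kernel functions [B(., z)] come without boundary values, so the boundary argument cannot be
    applied to them; polynomials are entire and have polynomial antiderivatives, which is why the
    test functions are derivatives [p']. Complex differentiability comes without continuity of the
    derivative, so Cauchy's theorem is proved in Goursat's way, directly for area integrals against
    difference quotients; Cauchy's formula, and with it every derivative estimate, is then an
    average over annuli. The boundary layer needs two nets on the curves. The fine one has spacing
    so small compared with [r] that a point whose nearest net point is [b] lies along the normal at
    [b] up to a small multiple of [r]. The coarse one has O(1/r) points, and boxes of side O(r)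
    around them cover the layer, whence its area O(r). The fine net may be as large as it likes: at
    almost every point only the nearest net point contributes to dbar(chi). *)

Definition nrm z : R := ComplexField.Normc.normc z.

(** The numeric norm takes values in [R[i]], whose order is partial; estimates are made with the
    real number [nrm z], and this converts between the two. *)
Lemma norm_nrm z : `|z| = (nrm z)%:C. Proof. by []. Qed.

Lemma nrm_sqr z : nrm z ^+ 2 = complex.Re z ^+ 2 + complex.Im z ^+ 2.
Proof. by case: z => a b; rewrite /nrm /= sqr_sqrtr// addr_ge0// sqr_ge0. Qed.

Lemma nrm_ge0 z : 0 <= nrm z.
Proof. by case: z => a b; exact: sqrtr_ge0. Qed.

Lemma nrmM z w : nrm (z * w) = nrm z * nrm w. Proof. exact: normcM. Qed.

Lemma nrmN z : nrm (- z) = nrm z. Proof. exact: normcN. Qed.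

Lemma nrmD z w : nrm (z + w) <= nrm z + nrm w. Proof. exact: le_normcD. Qed.

Lemma nrmV z : nrm z^-1 = (nrm z)^-1. Proof. exact: normcV. Qed.

Lemma nrm0 : nrm 0 = 0. Proof. exact: normc0. Qed.

Lemma nrm1 : nrm 1 = 1. Proof. exact: normc1. Qed.

Lemma nrm_eq0 z : (nrm z == 0) = (z == 0).
Proof. by apply/eqP/eqP => [/eq0_normc//|->]; exact: nrm0. Qed.

Lemma nrm_gt0 z : (0 < nrm z) = (z != 0).
Proof. by rewrite lt_def nrm_ge0 andbT nrm_eq0. Qed.

Lemma nrmB z w : nrm (z - w) <= nrm z + nrm w.
Proof. by rewrite -(nrmN w) nrmD. Qed.

Lemma nrm_distC z w : nrm (z - w) = nrm (w - z).
Proof. by rewrite -nrmN opprB. Qed.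

Lemma nrm_real (x : R) : nrm x%:C = `|x|.
Proof. by rewrite /nrm /= expr0n addr0 sqrtr_sqr. Qed.

Lemma nrm_imag (x : R) : nrm (0 +i* x) = `|x|.
Proof. by rewrite /nrm /= expr0n add0r sqrtr_sqr. Qed.

Lemma nrm_i : nrm (0 +i* 1) = 1.
Proof. by rewrite nrm_imag normr1. Qed.

Lemma nrm_conj z : nrm z^* = nrm z.
Proof. by case: z => a b; rewrite /nrm /= sqrrN. Qed.

Lemma nrmX z n : nrm (z ^+ n) = nrm z ^+ n.
Proof. by elim: n => [|n IH]; rewrite ?expr0 ?nrm1// !exprS nrmM IH. Qed.

Lemma abs_Re_le z : `|complex.Re z| <= nrm z.
Proof.
rewrite -[leLHS]ger0_norm// -ler_sqr ?nnegrE ?nrm_ge0 ?normr_ge0//.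
by rewrite nrm_sqr normr_id real_normK ?num_real// lerDl sqr_ge0.
Qed.

Lemma abs_Im_le z : `|complex.Im z| <= nrm z.
Proof.
rewrite -ler_sqr ?nnegrE ?nrm_ge0 ?normr_ge0//.
by rewrite nrm_sqr real_normK ?num_real// lerDr sqr_ge0.
Qed.

Lemma nrm_le_ReIm z : nrm z <= `|complex.Re z| + `|complex.Im z|.
Proof.
rewrite [z in leLHS](_ : z = (complex.Re z)%:C + (0 +i* complex.Im z)).
  by rewrite (le_trans (nrmD _ _))// nrm_real nrm_imag.
by case: z => a b; apply/eqP; rewrite eq_complex /= addr0 add0r !eqxx.
Qed.

Lemma nrm_sub_ge z w : nrm z - nrm w <= nrm (z - w).
Proof. by rewrite lerBlDr (le_trans _ (nrmD _ _))// subrK. Qed.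

Lemma nrm_triangle z w u : nrm (z - u) <= nrm (z - w) + nrm (w - u).
Proof. by rewrite (le_trans _ (nrmD _ _))// addrA subrK. Qed.

Lemma nrm_sum (I : Type) (s : seq I) (P : pred I) (F : I -> R[i]) :
  nrm (\sum_(j <- s | P j) F j) <= \sum_(j <- s | P j) nrm (F j).
Proof.
elim/big_rec2 : _ => [|j y x _ h]; first by rewrite nrm0.
by rewrite (le_trans (nrmD _ _))// lerD2l.
Qed.

Lemma conj_conj z : z^*^* = z. Proof. exact: conjcK. Qed.

Lemma mul_conj z : z * z^* = (nrm z ^+ 2)%:C.
Proof.
rewrite nrm_sqr; case: z => a b; apply/eqP.
by rewrite eq_complex /=; apply/andP; split; apply/eqP; ring.
Qed.

Lemma nrm_le_eps z : (forall e, 0 < e -> nrm z <= e) -> z = 0.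
Proof.
move=> h; apply/eqP; rewrite -nrm_eq0 eq_le nrm_ge0 andbT.
by apply/ler_addgt0Pr => e e0; rewrite add0r h.
Qed.

End ComplexNorm.

Section ComplexTopology.
Variable R : realType.
Local Notation C := (R[i]^o).
Implicit Types (z w : C) (A : set C) (g : C -> C).

Lemma lt_norm_realC (x : R[i]) (e : R) : (`|x| < e%:C) = (nrm x < e).
Proof. by rewrite norm_nrm ltcR. Qed.

(** A positive element of [R[i]] is a positive real, so the balls of [R[i]^o], whose radii are
    complex, are ordinary discs. *)
Lemma gt0C (e : R[i]) : 0 < e -> exists2 r : R, 0 < r & e = r%:C.
Proof.
case: e => a b; rewrite ltcE /= => /andP[/eqP -> a0]; by exists a.
Qed.

Lemma nbhsC z A : nbhs z A <->
  exists2 e : R, 0 < e & forall y, nrm (y - z) < e -> A y.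
Proof.
split.
  move=> /nbhs_ballP[e /= /gt0C[r r0 ->] h]; exists r => // y yz.
  by apply: h; rewrite -ball_normE /= distrC lt_norm_realC.
move=> [e e0 h]; apply/nbhs_ballP; exists e%:C; rewrite /= ?ltcR//.
by move=> y; rewrite -ball_normE /= distrC lt_norm_realC => /h.
Qed.

Lemma closureC (A : set C) z : closure A z -> forall e : R, 0 < e -> exists2 w, A w & nrm (w - z) < e.
Proof.
move=> cz e e0.
have [w [Aw wz]] := cz [set y | nrm (y - z) < e] ((nbhsC _ _).2 (ex_intro2 _ _ e e0 (fun y h => h))).
by exists w.
Qed.

Lemma openC A : open A <->
  forall z, A z -> exists2 e : R, 0 < e & forall y, nrm (y - z) < e -> A y.
Proof.
rewrite openE; split=> h z /h; first by move/nbhsC.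
by move=> ?; exact/nbhsC.
Qed.

Lemma cvg_withinC (F : C -> C) A z l :
  (F x @[x --> within A (nbhs z)] --> l) <->
  forall e, 0 < e -> exists2 d : R, 0 < d &
    forall y, A y -> nrm (y - z) < d -> nrm (F y - l) < e.
Proof.
split=> h.
  move=> e e0.
  have /h : nbhs l [set y | nrm (y - l) < e] by apply/nbhsC; exists e.
  by move/nbhsC => [d d0 hd]; exists d => // y Ay /hd; exact.
move=> B /nbhsC[e e0 hB]; have [d d0 hd] := h e e0.
by apply/nbhsC; exists d => // y yd Ay; apply: hB; exact: hd.
Qed.

(** Written without a quotient, so that [h = 0] is allowed and quadratic remainder bounds apply
    directly; [cdiffP] ties it to the difference quotients behind [derivable]. *)
Definition cdiff g z (l : C) : Prop := forall e : R, 0 < e ->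
  exists2 d : R, 0 < d & forall h : C, nrm h < d ->
    nrm (g (z + h) - g z - l * h) <= e * nrm h.

Lemma cdiffP g z l : cdiff g z l <->
  ((fun h : C => h^-1 *: (g (h *: (1 : C) + z) - g z)) @ (0 : C)^' --> l).
Proof.
split=> [gl|gl].
  move=> B /nbhsC[e e0 hB].
  have [d d0 hd] := gl (e / 2) (divr_gt0 e0 (ltr0Sn _ 1)).
  apply/nbhsC; exists d => // h; rewrite subr0 => hd' h0; apply: hB.
  rewrite [_ - l](_ : _ = h^-1 * (g (z + h) - g z - l * h)).
    rewrite nrmM nrmV -ltr_pdivlMl ?invr_gt0 ?nrm_gt0// invrK.
    apply: le_lt_trans (hd _ hd') _; rewrite mulrC ltr_pM2l ?nrm_gt0//.
    by rewrite ltr_pdivrMr// ltr_pMr// ltr1n.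
  rewrite /GRing.scale /= mulr1 [h + z]addrC [RHS]mulrBr; congr (_ - _).
  by rewrite mulrCA mulVf ?mulr1.
move=> e e0.
have /gl : nbhs l [set y | nrm (y - l) < e] by apply/nbhsC; exists e.
move/nbhsC => [d d0 hd]; exists d => // h hd'.
have [->|h0] := eqVneq h 0; first by rewrite addr0 mulr0 subrr subr0 nrm0 mulr0.
have := hd h; rewrite subr0 => /(_ hd' h0) /=.
rewrite /GRing.scale /= mulr1 [h + z]addrC => /ltW.
rewrite [_ - l](_ : _ = h^-1 * (g (z + h) - g z - l * h)).
  by rewrite nrmM nrmV mulrC ler_pdivrMr ?nrm_gt0.
by rewrite [RHS]mulrBr [in RHS]mulrCA mulVf ?mulr1.
Qed.

Lemma cdiff_derivable g z l : cdiff g z l -> derivable g z 1 /\ derive1 g z = l.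
Proof.
move=> /cdiffP gl; split; first by apply/cvg_ex; exists l.
rewrite derive1E; apply/cvg_lim => //.
Qed.

Lemma derivable_cdiff g z : derivable g z 1 -> cdiff g z (derive1 g z).
Proof.
by move=> dg; apply/cdiffP; rewrite derive1E.
Qed.

End ComplexTopology.

(** * Integration over the plane *)

Section PlaneMeasure.
Variable R : realType.
Local Notation C := (R[i]^o).
Local Notation mu := (@lebesgue_measure R).
Local Notation plane := (measurableTypeR R * measurableTypeR R)%type.
Local Notation area := (@lebesgue_measure R \x @lebesgue_measure R)%E.

(** The pushforward under a translation agrees with Lebesgue measure on half-open intervals, hence
    everywhere by uniqueness. *)
Lemma lebesgue_measure_translate (a : R) (A : set (measurableTypeR R)) :
  measurable A -> mu ((fun x => x + a) @^-1` A) = mu A.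
Proof.
move=> mA.
have mf : measurable_fun [set: measurableTypeR R] ((fun x => x + a) : measurableTypeR R -> measurableTypeR R).
  exact: measurable_funD.
apply/esym.
apply: (@lebesgue_measure_unique R (measure_function_pushforward__canonical__measure_function_Measure mu mf)) => // X.
move=> [] [x y] _ <-; rewrite [RHS](_ : _ = mu `]x - a, y - a]%classic); last first.
  by congr (mu _); apply/seteqP; split => z /=; rewrite !in_itv /= ltrBlDr lerBrDr.
rewrite !lebesgue_measure_itv /= !lte_fin ltrD2r; case: ifP => // _.
by rewrite !EFinN !EFinD; congr (_%:E); ring.
Qed.

Lemma area_translate (a b : R) (A : set (measurableTypeR R * measurableTypeR R)) :
  measurable A -> area ((fun p => (p.1 + a, p.2 + b)) @^-1` A) = area A.
Proof.
move=> mA.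
have mf : measurable_fun [set: measurableTypeR R * measurableTypeR R]
    ((fun p => (p.1 + a, p.2 + b)) : _ -> measurableTypeR R * measurableTypeR R).
  apply/measurable_fun_pair => /=; apply: measurable_funD => //.
apply/esym.
apply: (@product_measure_unique _ _ _ _ _ mu mu (measure_function_pushforward__canonical__measure_function_Measure area mf)) => // X Y mX mY.
rewrite /= /pushforward (_ : _ @^-1` _ = ((fun x => x + a) @^-1` X) `*` ((fun x => x + b) @^-1` Y)) //.
rewrite product_measure1E.
  by rewrite -(lebesgue_measure_translate a mX) -(lebesgue_measure_translate b mY).
rewrite -[X in measurable X]setTI. by apply: measurable_funD.
by rewrite -[X in measurable X]setTI; apply: measurable_funD.
Qed.

Definition mset (A : set C) : Prop := measurable (plane_region A : set plane).

Lemma msetI A B : mset A -> mset B -> mset (A `&` B).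
Proof. exact: measurableI. Qed.

Lemma msetU A B : mset A -> mset B -> mset (A `|` B).
Proof. exact: measurableU. Qed.

Lemma msetC A : mset A -> mset (~` A).
Proof. exact: measurableC. Qed.

(** The boxes with rational centres and half-sides [1 / n.+1] that lie inside an open set are
    countably many and cover it. *)
Lemma open_mset (A : set C) : open A -> mset A.
Proof.
move=> /openC oA.
pose bx (a b : rat) (n : nat) : set plane :=
  `]ratr a - n.+1%:R^-1, ratr a + n.+1%:R^-1[%classic `*`
  `]ratr b - n.+1%:R^-1, ratr b + n.+1%:R^-1[%classic.
rewrite /mset (_ : plane_region A = \bigcup_(a : rat) \bigcup_(b : rat)
  \bigcup_(n in [set n | bx a b n `<=` plane_region A]) bx a b n).
  apply: bigcupT_measurable_rat => a; apply: bigcupT_measurable_rat => b.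
  by apply: bigcup_measurable => n _; apply: measurableX; exact: measurable_itv.
apply/seteqP; split => [[x y] Axy|p [a _ [b _ [n /= sub]]]]; last exact: sub.
have [e e0 he] := oA _ Axy.
have [n ne] : exists n : nat, n.+1%:R^-1 < e / 4.
  have e4 : 0 < e / 4 by rewrite divr_gt0.
  exists (Num.truncn (e / 4)^-1); rewrite -[ltRHS]invrK ltf_pV2 ?posrE ?invr_gt0//.
  exact: truncnS_gt.
have n0 : 0 < n.+1%:R^-1 :> R by rewrite invr_gt0.
have [a ha] : exists a : rat, ratr a \in `]x - n.+1%:R^-1, x + n.+1%:R^-1[.
  by apply: rat_in_itvoo; rewrite ltrD2l gtrN.
have [b hb] : exists b : rat, ratr b \in `]y - n.+1%:R^-1, y + n.+1%:R^-1[.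
  by apply: rat_in_itvoo; rewrite ltrD2l gtrN.
exists a => //; exists b => //; exists n; rewrite /bx /=;
  move: (n.+1%:R^-1) n0 ne ha hb => r r0 re;
  rewrite !in_itv /= => /andP[a1 a2] /andP[b1 b2].
  move=> [u v] [] /=; rewrite !in_itv /= => /andP[u1 u2] /andP[v1 v2].
  apply: he; apply: le_lt_trans (nrm_le_ReIm _) _ => /=.
  by rewrite (@lt_le_trans _ _ (e / 2 + e / 2))//; [apply: ltrD; rewrite /= ltr_norml; apply/andP; split; lra|lra].
by split; apply/andP; split; lra.
Qed.

Definition rmeas (f : C -> R) : Prop :=
  measurable_fun [set: plane] ((fun p => f (p.1 +i* p.2)) : plane -> measurableTypeR R).

Lemma rmeas_gt (f : C -> R) : (forall a, mset [set z | a < f z]) -> rmeas f.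
Proof.
move=> h; apply: (measurability _ (RGenOInfty.measurableE R)) => //.
move=> _ [_ [a ->] <-]; rewrite setTI; have := h a; rewrite /mset.
by congr measurable; apply/seteqP; split => p /=; rewrite in_itv /= andbT.
Qed.

Definition rcont (A : set C) (f : C -> R) : Prop := forall z, A z ->
  forall e, 0 < e -> exists2 d : R, 0 < d &
    forall y, nrm (y - z) < d -> `|f y - f z| < e.

Definition ccont (A : set C) (g : C -> C) : Prop := forall z, A z ->
  forall e, 0 < e -> exists2 d : R, 0 < d &
    forall y, nrm (y - z) < d -> nrm (g y - g z) < e.

(** Extension by zero: all integrals are then over the whole plane, where translating an integrand
    needs no change of domain. *)
Definition cut (V : nmodType) (A : set C) (f : C -> V) : C -> V :=
  fun z => if `[< A z >] then f z else 0.

Lemma cutT (V : nmodType) (A : set C) (f : C -> V) z : A z -> cut A f z = f z.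
Proof. by move=> Az; rewrite /cut asboolT. Qed.

Lemma cutF (V : nmodType) (A : set C) (f : C -> V) z : ~ A z -> cut A f z = 0.
Proof. by move=> Az; rewrite /cut asboolF. Qed.

Lemma rmeas_cut_cont A f : open A -> rcont A f -> rmeas (cut A f).
Proof.
move=> oA cf; have mA := open_mset oA; apply: rmeas_gt => a.
have mA' : mset (A `&` [set z | a < f z]).
  apply: open_mset; apply/openC => z [Az az].
  have [e e0 he] := (openC A).1 oA _ Az.
  have [d d0 hd] : exists2 d : R, 0 < d & forall y, nrm (y - z) < d -> `|f y - f z| < f z - a.
    by apply: cf => //; rewrite subr_gt0.
  exists (Num.min e d); first by rewrite lt_min e0.
  move=> y; rewrite lt_min => /andP[/he Ay /hd]; rewrite ltr_norml => /andP[h _].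
  by split => //=; lra.
(* Off [A] the cut function is 0, so for negative [a] the superlevel set contains the complement of
   [A] as well. *)
have [a0|a0] := ltP a 0.
  rewrite (_ : [set z | _] = (A `&` [set z | a < f z]) `|` ~` A).
    by apply: msetU => //; exact: msetC.
  apply/seteqP; split => z /=.
    by have [Az|nAz] := pselect (A z); [rewrite cutT//; left|right].
  by move=> [[Az]|nAz]; [rewrite cutT|rewrite cutF].
rewrite (_ : [set z | _] = (A `&` [set z | a < f z]))//.
apply/seteqP; split => z /=; last by move=> [Az]; rewrite cutT.
have [Az|nAz] := pselect (A z); first by rewrite cutT.
by rewrite cutF// ltNge a0.
Qed.

Lemma rmeas_cut A f : mset A -> rmeas f -> rmeas (cut A f).
Proof.
move=> mA mf.
rewrite /rmeas (_ : (fun p : plane => _) = (fun p : plane => f (p.1 +i* p.2)) \_ (plane_region A)).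
  by move/measurable_restrictT : mA => <-; apply: measurable_funTS.
apply/funext => p; rewrite patchE; have [h|h] := pselect (A (p.1 +i* p.2)).
  by rewrite cutT// mem_set.
by rewrite cutF// memNset.
Qed.

Lemma rmeas_cst a : rmeas (fun=> a). Proof. exact: measurable_cst. Qed.

Lemma rmeasD f g : rmeas f -> rmeas g -> rmeas (fun z => f z + g z).
Proof. by move=> mf mg; apply: measurable_funD. Qed.

Lemma rmeasB f g : rmeas f -> rmeas g -> rmeas (fun z => f z - g z).
Proof. by move=> mf mg; apply: measurable_funB. Qed.

Lemma rmeasM f g : rmeas f -> rmeas g -> rmeas (fun z => f z * g z).
Proof. by move=> mf mg; apply: measurable_funM. Qed.

Lemma rmeas_translate (a : C) f : rmeas f -> rmeas (fun z => f (z + a)).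
Proof.
case: a => a b mf.
have mt : measurable_fun [set: plane] ((fun p => (p.1 + a, p.2 + b)) : plane -> plane).
  by apply/measurable_fun_pair => /=; apply: measurable_funD.
exact: (measurableT_comp mf mt).
Qed.

Definition cmeas (g : C -> C) : Prop :=
  rmeas (fun z => complex.Re (g z)) /\ rmeas (fun z => complex.Im (g z)).

Lemma cmeas_cut_cont A g : open A -> ccont A g -> cmeas (cut A g).
Proof.
move=> oA cg; split.
- rewrite (_ : (fun z => _) = cut A (fun z => complex.Re (g z))).
    apply: rmeas_cut_cont => // z Az e e0; have [d d0 hd] := cg z Az e e0.
    exists d => // y /hd h; apply: (le_lt_trans _ h).
    by have := abs_Re_le (g y - g z); clear h; case: (g y) (g z) => ? ? [? ?].
  apply/funext => z; have [h|h] := pselect (A z); first by rewrite !cutT.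
  by rewrite !cutF.
- rewrite (_ : (fun z => _) = cut A (fun z => complex.Im (g z))).
    apply: rmeas_cut_cont => // z Az e e0; have [d d0 hd] := cg z Az e e0.
    exists d => // y /hd h; apply: (le_lt_trans _ h).
    by have := abs_Im_le (g y - g z); clear h; case: (g y) (g z) => ? ? [? ?].
  apply/funext => z; have [h|h] := pselect (A z); first by rewrite !cutT.
  by rewrite !cutF.
Qed.

Lemma cmeas_cont g : ccont setT g -> cmeas g.
Proof.
move=> cg; rewrite (_ : g = cut setT g); last by apply/funext => z; rewrite cutT.
by apply: cmeas_cut_cont => //; exact: openT.
Qed.

Lemma cmeas_cut A g : mset A -> cmeas g -> cmeas (cut A g).
Proof.
move=> mA [m1 m2]; split.
- rewrite (_ : (fun z => _) = cut A (fun z => complex.Re (g z))); first exact: rmeas_cut.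
  by apply/funext => z; rewrite /cut; case: asboolP.
- rewrite (_ : (fun z => _) = cut A (fun z => complex.Im (g z))); first exact: rmeas_cut.
  by apply/funext => z; rewrite /cut; case: asboolP.
Qed.

Lemma cmeas_translate (a : C) g : cmeas g -> cmeas (fun z => g (z + a)).
Proof. by move=> [m1 m2]; split; [exact: (rmeas_translate a m1)|exact: (rmeas_translate a m2)]. Qed.

Lemma cmeasD f g : cmeas f -> cmeas g -> cmeas (fun z => f z + g z).
Proof.
move=> [f1 f2] [g1 g2]; split.
- rewrite (_ : (fun z => _) = fun z => complex.Re (f z) + complex.Re (g z)); first exact: rmeasD.
  by apply/funext => z; case: (f z) (g z) => ? ? [? ?].
- rewrite (_ : (fun z => _) = fun z => complex.Im (f z) + complex.Im (g z)); first exact: rmeasD.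
  by apply/funext => z; case: (f z) (g z) => ? ? [? ?].
Qed.

Lemma cmeasM f g : cmeas f -> cmeas g -> cmeas (fun z => f z * g z).
Proof.
move=> [f1 f2] [g1 g2]; split.
- rewrite (_ : (fun z => _) = fun z => complex.Re (f z) * complex.Re (g z) - complex.Im (f z) * complex.Im (g z)).
    by apply: rmeasB; exact: rmeasM.
  by apply/funext => z; case: (f z) (g z) => ? ? [? ?].
- rewrite (_ : (fun z => _) = fun z => complex.Re (f z) * complex.Im (g z) + complex.Im (f z) * complex.Re (g z)).
    by apply: rmeasD; exact: rmeasM.
  by apply/funext => z; case: (f z) (g z) => ? ? [? ?].
Qed.

Lemma cmeas_cst a : cmeas (fun=> a). Proof. by split; exact: rmeas_cst. Qed.

Lemma cmeasN g : cmeas g -> cmeas (fun z => - g z).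
Proof.
move=> mg; rewrite (_ : (fun z => _) = (fun z => -1 * g z)).
  by apply: cmeasM => //; exact: cmeas_cst.
by apply/funext => z; rewrite mulN1r.
Qed.

Lemma cmeasB f g : cmeas f -> cmeas g -> cmeas (fun z => f z - g z).
Proof. by move=> mf mg; apply: cmeasD => //; exact: cmeasN. Qed.

Lemma cmeas_conj g : cmeas g -> cmeas (fun z => (g z)^*).
Proof.
move=> [g1 g2]; split.
  by rewrite (_ : (fun z => _) = fun z => complex.Re (g z))//; apply/funext => z; case: (g z).
rewrite (_ : (fun z => _) = fun z => 0 - complex.Im (g z)).
  by apply: rmeasB => //; exact: rmeas_cst.
by apply/funext => z; case: (g z) => ? ?; rewrite sub0r.
Qed.

Lemma cmeas_nrm2 g : cmeas g -> rmeas (fun z => nrm (g z) ^+ 2).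
Proof.
move=> [g1 g2].
rewrite (_ : (fun z => _) = fun z => complex.Re (g z) * complex.Re (g z) + complex.Im (g z) * complex.Im (g z)).
  by apply: rmeasD; exact: rmeasM.
by apply/funext => z; rewrite nrm_sqr !expr2.
Qed.

Lemma cmeas_nrm g : cmeas g -> rmeas (fun z => nrm (g z)).
Proof.
move=> mg; apply: rmeas_gt => a.
have [a0|a0] := ltP a 0.
  rewrite (_ : [set z | _] = setT); first by apply: open_mset; exact: openT.
  by apply/seteqP; split => z //= _; rewrite (lt_le_trans a0)// nrm_ge0.
have := cmeas_nrm2 mg; rewrite /rmeas => h.
have := h measurableT _ (measurable_itv `]a ^+ 2, +oo[%R); rewrite setTI /mset.
congr measurable; apply/seteqP; split => p /=; rewrite in_itv /= andbT.
  by rewrite ltr_sqr ?nnegrE ?nrm_ge0.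
by rewrite ltr_sqr ?nnegrE ?nrm_ge0.
Qed.

End PlaneMeasure.

Section PlaneIntegral.
Variable R : realType.
Local Notation C := (R[i]^o).
Local Notation plane := (measurableTypeR R * measurableTypeR R)%type.
Local Notation area := (@lebesgue_measure R \x @lebesgue_measure R)%E.
Implicit Types (f : C -> R) (g : C -> C) (A : set C).

Definition rint f : Prop :=
  area.-integrable [set: plane] (fun p => (f (p.1 +i* p.2))%:E).

Definition J f : R := \int[area]_p f (p.1 +i* p.2).

Lemma rint_meas f : rint f -> rmeas f.
Proof. by move=> /integrableP[/measurable_EFinP]. Qed.

Lemma rint_le f1 f2 : rmeas f1 -> rint f2 ->
  (forall z, `|f1 z| <= `|f2 z|) -> rint f1.
Proof.
move=> m1 i2 le12; apply: le_integrable i2 => //; first exact/measurable_EFinP.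
by move=> p _ /=; rewrite lee_fin.
Qed.

Lemma rintD f1 f2 : rint f1 -> rint f2 -> rint (fun z => f1 z + f2 z).
Proof. by move=> i1 i2; exact: (integrableD measurableT i1 i2). Qed.

Lemma rintB f1 f2 : rint f1 -> rint f2 -> rint (fun z => f1 z - f2 z).
Proof. by move=> i1 i2; exact: (integrableB measurableT i1 i2). Qed.

Lemma rintZ a f : rint f -> rint (fun z => a * f z).
Proof. by move=> i1; exact: (integrableZl measurableT a i1). Qed.

Lemma rint_norm f : rint f -> rint (fun z => `|f z|).
Proof. by move=> i1; apply: (integrable_abse i1). Qed.

Lemma JD f1 f2 : rint f1 -> rint f2 -> J (fun z => f1 z + f2 z) = J f1 + J f2.
Proof. by move=> i1 i2; rewrite /J RintegralD. Qed.

Lemma JB f1 f2 : rint f1 -> rint f2 -> J (fun z => f1 z - f2 z) = J f1 - J f2.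
Proof. by move=> i1 i2; rewrite /J RintegralB. Qed.

Lemma JZ a f : rint f -> J (fun z => a * f z) = a * J f.
Proof. by move=> i1; rewrite /J RintegralZl. Qed.

Lemma J_ge0 f : (forall z, 0 <= f z) -> 0 <= J f.
Proof. by move=> f0; apply: Rintegral_ge0. Qed.

Lemma J_le f1 f2 : rint f1 -> rint f2 -> (forall z, f1 z <= f2 z) -> J f1 <= J f2.
Proof. by move=> i1 i2 h; apply: le_Rintegral. Qed.

Lemma J_abs f : rint f -> `|J f| <= J (fun z => `|f z|).
Proof. by move=> i1; apply: le_normr_Rintegral. Qed.

Lemma J_cst0 : J (fun=> 0) = 0.
Proof. by rewrite /J /Rintegral integral0. Qed.

Lemma rint0 : rint (fun=> 0). Proof. exact: integrable0. Qed.

Lemma rint_translate a f : rint f -> rint (fun z => f (z + a)).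
Proof.
move=> i1; have mf := rint_meas i1; case: a => a b.
have mt : measurable_fun [set: plane] ((fun p => (p.1 + a, p.2 + b)) : plane -> plane).
  by apply/measurable_fun_pair => /=; apply: measurable_funD.
apply/integrableP; split; first by apply/measurable_EFinP; exact: (rmeas_translate (a +i* b)).
have /integrableP[_] := i1; apply: le_lt_trans.
have m' : measurable_fun [set: plane] (fun p : plane => `|(f (p.1 +i* p.2))%:E|%E).
  by apply: measurableT_comp => //; exact/measurable_EFinP.
have := @ge0_integral_pushforward _ _ _ _ _ _ mt area setT (fun p : plane => `|(f (p.1 +i* p.2))%:E|%E) measurableT m' (fun _ _ => abse_ge0 _).
rewrite preimage_setT /= => <-.
rewrite le_eqVlt; apply/orP; left; apply/eqP; apply: eq_measure_integral => A mA _.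
exact: area_translate.
Qed.

Lemma J_translate a f : rint f -> J (fun z => f (z + a)) = J f.
Proof.
move=> i1; have mf := rint_meas i1.
have := rint_translate a i1; case: a => a b i2.
have mt : measurable_fun [set: plane] ((fun p => (p.1 + a, p.2 + b)) : plane -> plane).
  by apply/measurable_fun_pair => /=; apply: measurable_funD.
rewrite /J /Rintegral; congr fine.
have m' : measurable_fun [set: plane] (fun p : plane => (f (p.1 +i* p.2))%:E).
  exact/measurable_EFinP.
have := @integral_pushforward _ _ _ _ _ _ mt area setT (fun p : plane => (f (p.1 +i* p.2))%:E) m'.
rewrite preimage_setT => /(_ i2 measurableT) /= <-.
by apply: eq_measure_integral => A mA _; exact: area_translate.
Qed.

Definition box (c : C) (s : R) : set C :=
  [set z | `|complex.Re z - complex.Re c| <= s /\ `|complex.Im z - complex.Im c| <= s].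

Lemma plane_box c s : plane_region (box c s) =
  `[complex.Re c - s, complex.Re c + s]%classic `*`
  `[complex.Im c - s, complex.Im c + s]%classic.
Proof.
apply/seteqP; split => -[x y] /=; rewrite /plane_region /box /= !in_itv /= !ler_norml.
  by move=> [/andP[? ?] /andP[? ?]]; split; apply/andP; split; lra.
by move=> [/andP[? ?] /andP[? ?]]; split; apply/andP; split; lra.
Qed.

Lemma mset_box c s : mset (box c s).
Proof. by rewrite /mset plane_box; apply: measurableX; exact: measurable_itv. Qed.

Lemma area_box c s : 0 <= s -> area (plane_region (box c s)) = ((2 * s) ^+ 2)%:E.
Proof.
move=> s0; rewrite plane_box product_measure1E; try exact: measurable_itv.
rewrite [X in (X * _)%E](_ : _ = (2 * s)%:E) ?[X in (_ * X)%E](_ : _ = (2 * s)%:E).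
- by rewrite -EFinM expr2.
- rewrite [LHS]lebesgue_measure_itv /= lte_fin -EFinB; case: ltP => h; congr (_%:E); lra.
- rewrite [LHS]lebesgue_measure_itv /= lte_fin -EFinB; case: ltP => h; congr (_%:E); lra.
Qed.

Definition ind A (z : C) : R := if `[< A z >] then 1 else 0.

Lemma indT A z : A z -> ind A z = 1. Proof. by move=> h; rewrite /ind asboolT. Qed.
Lemma indF A z : ~ A z -> ind A z = 0. Proof. by move=> h; rewrite /ind asboolF. Qed.

Lemma ind_ge0 A z : 0 <= ind A z. Proof. by rewrite /ind; case: ifP. Qed.

Lemma rint_ind A : mset A -> (area (plane_region A) < +oo)%E -> rint (ind A).
Proof.
move=> mA fA; rewrite /rint (_ : (fun p => _) = fun p => (\1_(plane_region A) p)%:E).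
  apply/integrableP; split; first by apply/measurable_EFinP; exact: measurable_indic.
  under eq_integral do rewrite gee0_abs ?lee_fin//.
  by rewrite integral_indic// setIT.
apply/funext => p; congr (_%:E); rewrite indicE.
have [h|h] := pselect (A (p.1 +i* p.2)); first by rewrite indT// mem_set.
by rewrite indF// memNset.
Qed.

Lemma J_ind A : mset A -> J (ind A) = fine (area (plane_region A)).
Proof.
move=> mA; rewrite /J /Rintegral.
rewrite (_ : (fun p => _) = fun p => (\1_(plane_region A) p)%:E).
  by rewrite integral_indic// setIT.
apply/funext => p; congr (_%:E); rewrite indicE.
have [h|h] := pselect (A (p.1 +i* p.2)); first by rewrite indT// mem_set.
by rewrite indF// memNset.
Qed.

Lemma rint_ind_box c s : 0 <= s -> rint (ind (box c s)).
Proof. by move=> s0; apply: rint_ind; [exact: mset_box|rewrite area_box// ltry]. Qed.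

Lemma J_ind_box c s : 0 <= s -> J (ind (box c s)) = (2 * s) ^+ 2.
Proof. by move=> s0; rewrite J_ind; [rewrite area_box|exact: mset_box]. Qed.

Lemma rint_box c s M f : 0 <= s -> rmeas f -> (forall z, box c s z -> `|f z| <= M) ->
  (forall z, ~ box c s z -> f z = 0) -> rint f.
Proof.
move=> s0 mf fM f0; apply: (@rint_le _ (fun z => M * ind (box c s) z)) => //.
  by apply: rintZ; exact: rint_ind_box.
move=> z; have [h|h] := pselect (box c s z).
  by rewrite indT// mulr1 (le_trans (fM _ h))// ler_norm.
by rewrite indF// f0// mulr0.
Qed.

Lemma J_box c s M f : 0 <= s -> rmeas f -> (forall z, box c s z -> `|f z| <= M) ->
  (forall z, ~ box c s z -> f z = 0) -> `|J f| <= M * (2 * s) ^+ 2.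
Proof.
move=> s0 mf fM f0; have i1 := rint_box s0 mf fM f0.
rewrite (le_trans (J_abs i1))// -(J_ind_box c s0) -JZ; last exact: rint_ind_box.
apply: J_le; [exact: rint_norm|by apply: rintZ; exact: rint_ind_box|move=> z].
have [h|h] := pselect (box c s z); first by rewrite indT// mulr1 fM.
by rewrite indF// f0// mulr0 normr0.
Qed.

Lemma J_dct (fn : nat -> C -> R) f h (N : set C) :
  mset N -> area (plane_region N) = 0%E ->
  (forall n, rmeas (fn n)) -> rmeas f -> rint h ->
  (forall n z, `|fn n z| <= h z) ->
  (forall z, ~ N z -> fn n z @[n --> \oo] --> f z) ->
  J (fn n) @[n --> \oo] --> J f.
Proof.
move=> mN N0 mfn mf ih le cv.
have [|||||i1 _ c] := @dominated_convergence _ _ _ area [set: plane] measurableT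
  (fun n p => (fn n (p.1 +i* p.2))%:E) (fun p => (f (p.1 +i* p.2))%:E)
  (fun p => (h (p.1 +i* p.2))%:E).
- by move=> n; apply/measurable_EFinP; exact: mfn.
- exact/measurable_EFinP.
- exists (plane_region N); split => // p /= np; apply: contrapT => nN; apply: np => _.
  by apply: cvg_EFin; [exact: nearW|exact: cv].
- exact: ih.
- by apply: aeW => p n _; rewrite lee_fin.
rewrite /J /Rintegral; apply: fine_cvg.
by rewrite fineK//; exact: integrable_fin_num.
Qed.

(** Fatou's lemma, for sequences with no common majorant: the uniform bound on the integrals also
    gives integrability of the limit. *)
Lemma J_fatou (fn : nat -> C -> R) f (M : R) :
  (forall n, rint (fn n)) -> rmeas f -> (forall n z, 0 <= fn n z) ->
  (forall n, J (fn n) <= M) ->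
  (forall z, fn n z @[n --> \oo] --> f z) ->
  rint f /\ J f <= M.
Proof.
move=> ifn mf fn0 leM cv.
have f0 z : 0 <= f z.
  by apply: (ler_cvg_to (cvg_cst 0) (cv z)); exact: nearW.
have intJ n : (\int[area]_p (fn n (p.1 +i* p.2))%:E = (J (fn n))%:E)%E.
  by apply/esym/fineK; exact: (integrable_fin_num measurableT (ifn n)).
have le : (\int[area]_p (f (p.1 +i* p.2))%:E <= M%:E)%E.
  have := @fatou _ _ _ area [set: plane] measurableT (fun n p => (fn n (p.1 +i* p.2))%:E).
  move=> /(_ (fun n => (measurable_EFinP _ _).2 (rint_meas (ifn n)))).
  move=> /(_ (fun n p _ => fn0 n _)).
  have E z : limn_einf (fun n => (fn n z)%:E) = (f z)%:E.
    by apply: (cvg_limn_einf_sup _).1; apply: cvg_EFin; [exact: nearW|exact: cv].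
  under eq_integral => p _ do rewrite E.
  move=> /le_trans; apply; rewrite limn_einf_lim; apply: lime_le; first exact: is_cvg_einfs.
  apply: nearW => n; apply: (@le_trans _ _ (J (fn n))%:E); last by rewrite lee_fin.
  by apply: ereal_inf_lbound; exists n => //=.
have i1 : rint f.
  apply/integrableP; split; first exact/measurable_EFinP.
  under eq_integral => p _ do rewrite gee0_abs ?lee_fin//.
  by rewrite (le_lt_trans le)// ltry.
split=> //; rewrite -lee_fin /J /Rintegral fineK//.
exact: (integrable_fin_num measurableT i1).
Qed.

End PlaneIntegral.

Section ComplexIntegral.
Variable R : realType.
Local Notation C := (R[i]^o).
Local Notation plane := (measurableTypeR R * measurableTypeR R)%type.
Local Notation area := (@lebesgue_measure R \x @lebesgue_measure R)%E.
Implicit Types (f : C -> R) (g : C -> C) (A : set C).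

Lemma ReD (z w : C) : complex.Re (z + w) = complex.Re z + complex.Re w.
Proof. by case: z w => ? ? [? ?]. Qed.
Lemma ImD (z w : C) : complex.Im (z + w) = complex.Im z + complex.Im w.
Proof. by case: z w => ? ? [? ?]. Qed.
Lemma ReN (z : C) : complex.Re (- z) = - complex.Re z.
Proof. by case: z. Qed.
Lemma ImN (z : C) : complex.Im (- z) = - complex.Im z.
Proof. by case: z. Qed.
Lemma ReM (z w : C) : complex.Re (z * w) =
  complex.Re z * complex.Re w - complex.Im z * complex.Im w.
Proof. by case: z w => ? ? [? ?]. Qed.
Lemma ImM (z w : C) : complex.Im (z * w) =
  complex.Re z * complex.Im w + complex.Im z * complex.Re w.
Proof. by case: z w => ? ? [? ?]. Qed.
Lemma Re_conj (z : C) : complex.Re (z^*) = complex.Re z. Proof. by case: z. Qed.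
Lemma Im_conj (z : C) : complex.Im (z^*) = - complex.Im z. Proof. by case: z. Qed.

Lemma complex_ext (z w : C) :
  complex.Re z = complex.Re w -> complex.Im z = complex.Im w -> z = w.
Proof. by case: z w => a b [c d] /= -> ->. Qed.

Definition cint g : Prop :=
  rint (fun z => complex.Re (g z)) /\ rint (fun z => complex.Im (g z)).

Definition I g : C := J (fun z => complex.Re (g z)) +i* J (fun z => complex.Im (g z)).

Lemma cint_meas g : cint g -> cmeas g.
Proof. by move=> [i1 i2]; split; exact: rint_meas. Qed.

Lemma cint_le g f : cmeas g -> rint f -> (forall z, nrm (g z) <= `|f z|) -> cint g.
Proof.
move=> [m1 m2] fi le; split; apply: (rint_le _ fi) => // z.
  by rewrite (le_trans (abs_Re_le _)).
by rewrite (le_trans (abs_Im_le _)).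
Qed.

Lemma cint_nrm g : cint g -> rint (fun z => nrm (g z)).
Proof.
move=> ig; have [i1 i2] := ig.
apply: (rint_le (cmeas_nrm (cint_meas ig)) (rintD (rint_norm i1) (rint_norm i2))) => z.
by rewrite ger0_norm ?nrm_ge0// ger0_norm ?addr_ge0// nrm_le_ReIm.
Qed.

Lemma cintD g1 g2 : cint g1 -> cint g2 -> cint (fun z => g1 z + g2 z).
Proof.
move=> [i1 j1] [i2 j2]; split.
  by under eq_fun do rewrite ReD; exact: rintD.
by under eq_fun do rewrite ImD; exact: rintD.
Qed.

Lemma ID g1 g2 : cint g1 -> cint g2 -> I (fun z => g1 z + g2 z) = I g1 + I g2.
Proof.
move=> [i1 j1] [i2 j2]; apply: complex_ext; rewrite ?ReD ?ImD /=.
  by under eq_fun do rewrite ReD; exact: JD.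
by under eq_fun do rewrite ImD; exact: JD.
Qed.

Lemma cintZ (a : C) g : cint g -> cint (fun z => a * g z).
Proof.
move=> [i1 j1]; split.
  by under eq_fun do rewrite ReM; apply: rintB; exact: rintZ.
by under eq_fun do rewrite ImM; apply: rintD; exact: rintZ.
Qed.

Lemma IZ (a : C) g : cint g -> I (fun z => a * g z) = a * I g.
Proof.
move=> [i1 j1]; apply: complex_ext; rewrite ?ReM ?ImM /=.
  by under eq_fun do rewrite ReM; rewrite JB ?JZ//; exact: rintZ.
by under eq_fun do rewrite ImM; rewrite JD ?JZ//; exact: rintZ.
Qed.

Lemma cintN g : cint g -> cint (fun z => - g z).
Proof.
move=> ig; rewrite (_ : (fun z => _) = (fun z => -1 * g z)); first exact: cintZ.
by apply/funext => z; rewrite mulN1r.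
Qed.

Lemma IN g : cint g -> I (fun z => - g z) = - I g.
Proof.
move=> ig; rewrite (_ : (fun z => _) = (fun z => -1 * g z)).
  by rewrite IZ// mulN1r.
by apply/funext => z; rewrite mulN1r.
Qed.

Lemma cintB g1 g2 : cint g1 -> cint g2 -> cint (fun z => g1 z - g2 z).
Proof. by move=> i1 i2; apply: cintD => //; exact: cintN. Qed.

Lemma IB g1 g2 : cint g1 -> cint g2 -> I (fun z => g1 z - g2 z) = I g1 - I g2.
Proof. by move=> i1 i2; rewrite (ID i1 (cintN i2)) IN. Qed.

Lemma cint_conj g : cint g -> cint (fun z => (g z)^*).
Proof.
move=> [i1 j1]; split.
  by under eq_fun do rewrite Re_conj.
under eq_fun do rewrite Im_conj -mulN1r; exact: rintZ.
Qed.

Lemma I_conj g : cint g -> I (fun z => (g z)^*) = (I g)^*.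
Proof.
move=> [i1 j1]; apply: complex_ext => /=.
  by under eq_fun do rewrite Re_conj.
by under eq_fun do rewrite Im_conj -mulN1r; rewrite JZ// mulN1r.
Qed.

Lemma cint_translate (a : C) g : cint g -> cint (fun z => g (z + a)).
Proof. by move=> [i1 i2]; split; [exact: (rint_translate a i1)|exact: (rint_translate a i2)]. Qed.

Lemma I_translate (a : C) g : cint g -> I (fun z => g (z + a)) = I g.
Proof.
by move=> [i1 i2]; congr (_ +i* _); [exact: (J_translate a i1)|exact: (J_translate a i2)].
Qed.

Lemma cint0 : cint (fun=> 0). Proof. by split; exact: rint0. Qed.

Lemma I0 : I (fun=> 0) = 0. Proof. by rewrite /I J_cst0. Qed.

Lemma cint_sum (T : Type) (s : seq T) (F : T -> C -> C) :
  (forall k, cint (F k)) -> cint (fun z => \sum_(k <- s) F k z).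
Proof.
move=> h; elim: s => [|k s IH].
  by under eq_fun do rewrite big_nil; exact: cint0.
by under eq_fun do rewrite big_cons; exact: cintD.
Qed.

Lemma I_sum (T : Type) (s : seq T) (F : T -> C -> C) :
  (forall k, cint (F k)) -> I (fun z => \sum_(k <- s) F k z) = \sum_(k <- s) I (F k).
Proof.
move=> h; elim: s => [|k s IH].
  by under eq_fun do rewrite big_nil; rewrite I0 big_nil.
under eq_fun do rewrite big_cons; rewrite ID ?IH ?big_cons//.
exact: cint_sum.
Qed.

(** Estimating real and imaginary parts separately costs a factor 2, which is carried through the
    later constants. *)
Lemma nrm_I g : cint g -> nrm (I g) <= 2 * J (fun z => nrm (g z)).
Proof.
move=> ig; have [i1 i2] := ig; have i3 := cint_nrm ig.
rewrite (le_trans (nrm_le_ReIm _))//= mulrDl mul1r lerD//.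
  rewrite (le_trans (J_abs i1))// J_le//; first exact: rint_norm.
  by move=> z; exact: abs_Re_le.
rewrite (le_trans (J_abs i2))// J_le//; first exact: rint_norm.
by move=> z; exact: abs_Im_le.
Qed.

Lemma cint_box c s M g : 0 <= s -> cmeas g -> (forall z, box c s z -> nrm (g z) <= M) ->
  (forall z, ~ box c s z -> g z = 0) -> cint g.
Proof.
move=> s0 mg gM g0; apply: (@cint_le _ (fun z => nrm (g z))) => //.
  apply: (rint_box s0 (cmeas_nrm mg) (c := c) (M := M)).
    by move=> z /gM; rewrite ger0_norm// nrm_ge0.
  by move=> z /g0 ->; rewrite nrm0.
by move=> z; rewrite ger0_norm// nrm_ge0.
Qed.

(** The 8 is the 2 of [nrm_I] times the 4 in the area [(2 * s) ^+ 2] of the box. *)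
Lemma nrm_I_box c s M g : 0 <= s -> cmeas g -> (forall z, box c s z -> nrm (g z) <= M) ->
  (forall z, ~ box c s z -> g z = 0) -> nrm (I g) <= 8 * M * s ^+ 2.
Proof.
move=> s0 mg gM g0; rewrite (le_trans (nrm_I (cint_box s0 mg gM g0)))//.
have : `|J (fun z => nrm (g z))| <= M * (2 * s) ^+ 2.
  apply: (J_box s0 (cmeas_nrm mg) (c := c)).
    by move=> z /gM; rewrite ger0_norm// nrm_ge0.
  by move=> z /g0 ->; rewrite nrm0.
rewrite ger0_norm; last by apply: J_ge0 => z; exact: nrm_ge0.
by rewrite exprMn => h; lra.
Qed.

Definition ccvg (u : nat -> C) (l : C) : Prop := forall e : R, 0 < e ->
  exists n0, forall n, (n0 <= n)%N -> nrm (u n - l) < e.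

Lemma ccvgP u l : ccvg u l <->
  (complex.Re (u n) @[n --> \oo] --> complex.Re l) /\
  (complex.Im (u n) @[n --> \oo] --> complex.Im l).
Proof.
split=> [h|[h1 h2] e e0].
  split; apply/cvgrPdist_lt => e e0; have [n0 hn] := h e e0; exists n0 => // n /= /hn.
    by rewrite nrm_distC; apply: le_lt_trans; rewrite -ReN -ReD abs_Re_le.
  by rewrite nrm_distC; apply: le_lt_trans; rewrite -ImN -ImD abs_Im_le.
have e2 : 0 < e / 2 by rewrite divr_gt0.
move/cvgrPdist_lt : h1 => /(_ _ e2) [n1 _ h1].
move/cvgrPdist_lt : h2 => /(_ _ e2) [n2 _ h2].
exists (maxn n1 n2) => n; rewrite geq_max => /andP[/h1 /= k1 /h2 /= k2].
rewrite nrm_distC (le_lt_trans (nrm_le_ReIm _))// ReD ReN ImD ImN.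
by rewrite (splitr e) ltrD.
Qed.

Lemma ccvg_unique u l l' : ccvg u l -> ccvg u l' -> l = l'.
Proof.
move=> /ccvgP[a1 a2] /ccvgP[b1 b2]; apply: complex_ext.
  exact: (cvg_unique _ a1 b1).
exact: (cvg_unique _ a2 b2).
Qed.

Lemma I_dct (gn : nat -> C -> C) g f (N : set C) :
  mset N -> area (plane_region N) = 0%E ->
  (forall n, cmeas (gn n)) -> cmeas g -> rint f ->
  (forall n z, nrm (gn n z) <= f z) ->
  (forall z, ~ N z -> ccvg (gn ^~ z) (g z)) ->
  ccvg (fun n => I (gn n)) (I g).
Proof.
move=> mN N0 mgn mg fi le cv; apply/ccvgP; split => /=.
  apply: (J_dct mN N0 _ _ fi) => [n||n z|z Nz]; first exact: (mgn n).1.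
  - exact: mg.1.
  - by rewrite (le_trans (abs_Re_le _)).
  - by have /ccvgP[] := cv z Nz.
apply: (J_dct mN N0 _ _ fi) => [n||n z|z Nz]; first exact: (mgn n).2.
- exact: mg.2.
- by rewrite (le_trans (abs_Im_le _)).
- by have /ccvgP[] := cv z Nz.
Qed.

Lemma area_integralE A g : area_integral A g = I (cut A g).
Proof.
rewrite /area_integral /I /J; congr (_ +i* _); rewrite [LHS]Rintegral_mkcond.
  apply: eq_Rintegral => p _; rewrite patchE.
  have [h|h] := pselect (A (p.1 +i* p.2)); first by rewrite cutT// mem_set.
  by rewrite cutF// memNset.
apply: eq_Rintegral => p _; rewrite patchE.
have [h|h] := pselect (A (p.1 +i* p.2)); first by rewrite cutT// mem_set.
by rewrite cutF// memNset.
Qed.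

Lemma rint_cutP A f : mset A ->
  rint (cut A f) <-> area.-integrable (plane_region A) (fun p => (f (p.1 +i* p.2))%:E).
Proof.
move=> mA; rewrite (integrable_mkcond _ mA) /rint.
rewrite (_ : (fun p : plane => (cut A f _)%:E) =
  (fun p : plane => (f (p.1 +i* p.2))%:E) \_ (plane_region A))//.
apply/funext => p; rewrite patchE.
have [h|h] := pselect (A (p.1 +i* p.2)); first by rewrite cutT// mem_set.
by rewrite cutF// memNset.
Qed.

End ComplexIntegral.

(** * A weak form of the Cauchy-Goursat theorem *)

Section WeakCauchy.
Variable R : realType.
Local Notation C := (R[i]^o).
Local Notation im := (0 +i* 1 : C).
Implicit Types (f Phi Psi : C -> C) (U : set C) (c z w : C).

Definition lip (L : R) Psi : Prop := forall z w, nrm (Psi z - Psi w) <= L * nrm (z - w).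

(* Difference quotient approximating twice the Wirtinger derivative d-bar. *)
Definition dbq (t : R) Psi z : C :=
  (t^-1)%:C * ((Psi (z + t%:C) - Psi z) + im * (Psi (z + (0 +i* t)) - Psi z)).

Lemma lip_ccont L Psi A : lip L Psi -> ccont A Psi.
Proof.
move=> lP z _ e e0.
have L0 : 0 < `|L| + 1 by rewrite ltr_wpDl.
exists (e / (`|L| + 1)); first by rewrite divr_gt0.
move=> y; rewrite ltr_pdivlMr// => h; apply: le_lt_trans (lP _ _) _.
apply: le_lt_trans h; rewrite mulrC ler_wpM2l ?nrm_ge0//.
by rewrite (le_trans (ler_norm _))// lerDl.
Qed.

Lemma lip_cmeas L Psi : lip L Psi -> cmeas Psi.
Proof. by move=> /lip_ccont h; apply: cmeas_cont. Qed.

Lemma cmeas_dbq L t Psi : lip L Psi -> cmeas (dbq t Psi).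
Proof.
move=> /lip_cmeas mP; rewrite /dbq.
have m1 := cmeasB (cmeas_translate t%:C mP) mP.
have m2 := cmeasB (cmeas_translate (0 +i* t) mP) mP.
exact: (cmeasM (cmeas_cst _) (cmeasD m1 (cmeasM (cmeas_cst _) m2))).
Qed.

Lemma nrm_dbq L t Psi z : 0 < t -> lip L Psi -> nrm (dbq t Psi z) <= 2 * L.
Proof.
move=> t0 lP; rewrite /dbq nrmM nrm_real ger0_norm ?invr_ge0 ?(ltW t0)//.
rewrite ler_pdivrMl// (le_trans (nrmD _ _))// nrmM nrm_i mul1r.
have h1 := lP (z + t%:C) z; have h2 := lP (z + (0 +i* t)) z.
rewrite addrAC subrr add0r nrm_real gtr0_norm// in h1.
rewrite addrAC subrr add0r nrm_imag gtr0_norm// in h2.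
by rewrite (le_trans (lerD h1 h2))//; lra.
Qed.

Lemma dbq_eq0 t Psi z : Psi z = 0 -> Psi (z + t%:C) = 0 ->
  Psi (z + (0 +i* t)) = 0 -> dbq t Psi z = 0.
Proof. by move=> h1 h2 h3; rewrite /dbq h1 h2 h3 !subr0 mulr0 addr0 mulr0. Qed.

Lemma box_sub c s t z : 0 <= t ->
  (box c s z \/ box c s (z + t%:C) \/ box c s (z + (0 +i* t))) -> box c (s + t) z.
Proof.
case: c z => a b [x y] t0; rewrite /box /= !addr0 !ler_norml.
by move=> [[/andP[? ?] /andP[? ?]]|[[/andP[? ?] /andP[? ?]]|[/andP[? ?] /andP[? ?]]]];
  split; apply/andP; split; lra.
Qed.

Lemma dbq_box c s t Psi z : 0 <= t -> (forall z, Psi z != 0 -> box c s z) ->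
  ~ box c (s + t) z -> dbq t Psi z = 0.
Proof.
move=> t0 sP nb; apply: dbq_eq0; apply/eqP; apply: contrapT => /negP/sP h; apply: nb;
  by apply: box_sub => //; tauto.
Qed.

Lemma box_nrm c s z : box c s z -> nrm (z - c) <= 2 * s.
Proof.
move=> [h1 h2]; rewrite (le_trans (nrm_le_ReIm _))// ReD ReN ImD ImN.
by rewrite (le_trans (lerD h1 h2))//; lra.
Qed.

(** Translation invariance moves the difference quotient onto the affine factor, where it leaves a
    multiple of [1 + im * im = 0]. The identity is exact for every step [t], not only in the
    limit. *)
Lemma cint_dbq_affine c s L t Psi (a b : C) : 0 <= s -> 0 < t -> lip L Psi ->
  (forall z, Psi z != 0 -> box c s z) -> (exists A, forall z, nrm (Psi z) <= A) ->
  cint (fun z => dbq t Psi z * (a + b * z)) /\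
  I (fun z => dbq t Psi z * (a + b * z)) = 0.
Proof.
move=> s0 t0 lP sP [A0 PA].
have mP := lip_cmeas lP.
have i1 : cint Psi.
  apply: (cint_box s0 mP (c := c) (M := A0)) => // z nb.
  by apply/eqP; apply: contrapT => /negP/sP.
have mid : cmeas (fun z => z).
  by apply: cmeas_cont => z _ e e0; exists e.
have i2 : cint (fun z => Psi z * (a + b * z)).
  apply: (@cint_box _ c s (A0 * (nrm a + nrm b * (2 * s + nrm c)))) => //.
  - apply: cmeasM => //; apply: cmeasD; first exact: cmeas_cst.
    by apply: cmeasM => //; exact: cmeas_cst.
  - move=> z bz; rewrite nrmM ler_pM ?nrm_ge0//.
    rewrite (le_trans (nrmD _ _))// lerD2l nrmM ler_wpM2l ?nrm_ge0//.
    rewrite -[z in leLHS](subrK c) (le_trans (nrmD _ _))// lerD2r.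
    exact: box_nrm.
  - move=> z nb; rewrite (_ : Psi z = 0) ?mul0r//.
    by apply/eqP; apply: contrapT => /negP/sP.
have sh (h : C) : cint (fun z => Psi (z + h) * (a + b * z)) /\
    I (fun z => Psi (z + h) * (a + b * z)) =
    I (fun z => Psi z * (a + b * z)) - b * h * I Psi.
  have -> : (fun z => Psi (z + h) * (a + b * z)) =
      (fun z => (fun w => Psi w * (a + b * w)) (z + h) - (b * h) * (fun w => Psi w) (z + h)).
    by apply/funext => z /=; ring.
  have j1 := cint_translate h i2; have j2 := cint_translate h i1.
  split; first by apply: cintB => //; exact: cintZ.
  rewrite IB//; last exact: cintZ.
  by rewrite IZ// (I_translate h i2) (I_translate h i1).
have [j1 e1] := sh t%:C; have [j2 e2] := sh (0 +i* t).
have -> : (fun z => dbq t Psi z * (a + b * z)) = (fun z => (t^-1)%:C *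
   ((Psi (z + t%:C) * (a + b * z) - Psi z * (a + b * z)) +
    im * (Psi (z + (0 +i* t)) * (a + b * z) - Psi z * (a + b * z)))).
  by apply/funext => z; rewrite /dbq; ring.
have k1 := cintB j1 i2; have k2 := cintB j2 i2.
have k3 := cintZ im k2.
split; first by apply: cintZ; apply: cintD.
rewrite IZ; last exact: cintD.
rewrite ID// IB// IZ// IB// e1 e2.
have -> : (0 +i* t : C) = im * t%:C.
  by apply: complex_ext => /=; rewrite !(mul0r, mul1r, mulr0, subr0, addr0, add0r, sub0r, oppr0).
have ii : im * im = -1 :> C.
  by apply: complex_ext => /=; rewrite !(mul0r, mul1r, mulr0, subr0, addr0, add0r, sub0r, oppr0).
rewrite [X in _ * X](_ : _ = - (b * t%:C * I Psi) * (1 + im * im)); last by ring.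
by rewrite ii subrr !mulr0.
Qed.

Definition tent (u : R) : R := Num.max 0 (1 - `|u|).

Lemma tent_ge0 u : 0 <= tent u. Proof. by rewrite /tent le_max lexx. Qed.

Lemma tent_le1 u : tent u <= 1.
Proof. by rewrite /tent ge_max ler01 lerBlDr lerDl normr_ge0. Qed.

Lemma tent_eq0 u : 1 <= `|u| -> tent u = 0.
Proof. by move=> h; rewrite /tent max_l// subr_le0. Qed.

Lemma tent_lip u v : `|tent u - tent v| <= `|u - v|.
Proof.
rewrite /tent; have := ler_dist_dist u v.
case: (leP 0 (1 - `|u|)); case: (leP 0 (1 - `|v|)) => h1 h2;
  rewrite !ler_norml => /andP[h3 h4]; apply/andP; split;
  have := ler_norm (u - v); have := lerNnormlW (lexx `|u - v|); lra.
Qed.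

(** The two-scale relation of the linear B-spline. It takes the place of cutting a square into four
    in Goursat's argument, while keeping the pieces Lipschitz. *)
Lemma tent_refine u :
  tent u = 2^-1 * tent (2 * u + 1) + tent (2 * u) + 2^-1 * tent (2 * u - 1).
Proof.
wlog u0 : u / 0 <= u => [h|].
  have [/h//|u0] := leP 0 u; have even v : tent (- v) = tent v by rewrite /tent normrN.
  have nu0 : 0 <= - u by rewrite oppr_ge0 ltW.
  rewrite -even h// (_ : 2 * - u + 1 = - (2 * u - 1)); last by ring.
  rewrite (_ : 2 * - u - 1 = - (2 * u + 1)); last by ring.
  rewrite mulrN !even; move: (tent _) (tent _) (tent _) => a b c; ring.
rewrite /tent (ger0_norm u0) (@ger0_norm _ (2 * u)) ?mulr_ge0// (@ger0_norm _ (2 * u + 1)) ?addr_ge0 ?mulr_ge0//.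
by case: (ger0P (2 * u - 1)) => ?; case: (leP 0 (1 - u)) => ?;
  case: (leP 0 (1 - (2 * u + 1))) => ?; case: (leP 0 (1 - 2 * u)) => ?;
  case: leP => ?; lra.
Qed.

Lemma tent_unit u : `|u| <= 1 -> tent (u + 1) + tent u + tent (u - 1) = 1.
Proof.
rewrite /tent ler_norml => /andP[ul uu]; have [u0|u0] := leP 0 u.
  rewrite (ger0_norm u0) (@ger0_norm _ (u + 1)) ?addr_ge0// (@ler0_norm _ (u - 1)) ?subr_le0//.
  by case: (leP 0 (1 - u)) => ?; case: (leP 0 (1 - (u + 1))) => ?; case: leP => ?; lra.
rewrite (ltr0_norm u0) (@ger0_norm _ (u + 1)) ?(@ler0_norm _ (u - 1)); [|lra|lra].
by case: (leP 0 (1 - - u)) => ?; case: (leP 0 (1 - (u + 1))) => ?; case: leP => ?; lra.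
Qed.

Definition tent2 c s z : R :=
  tent ((complex.Re z - complex.Re c) / s) * tent ((complex.Im z - complex.Im c) / s).

Lemma tent2_ge0 c s z : 0 <= tent2 c s z.
Proof. by rewrite mulr_ge0 ?tent_ge0. Qed.

Lemma tent2_le1 c s z : tent2 c s z <= 1.
Proof. by rewrite -[leRHS]mulr1 ler_pM ?tent_ge0 ?tent_le1. Qed.

Lemma tent2_box c s z : 0 < s -> tent2 c s z != 0 -> box c s z.
Proof.
move=> s0; rewrite mulf_eq0 negb_or => /andP[h1 h2]; split.
  rewrite leNgt; apply: contra h1 => h; rewrite tent_eq0// normrM normfV (gtr0_norm s0).
  by rewrite ler_pdivlMr// mul1r ltW.
rewrite leNgt; apply: contra h2 => h; rewrite tent_eq0// normrM normfV (gtr0_norm s0).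
by rewrite ler_pdivlMr// mul1r ltW.
Qed.

Lemma tent2_lip c s z w : 0 < s -> `|tent2 c s z - tent2 c s w| <= 2 / s * nrm (z - w).
Proof.
move=> s0; rewrite /tent2.
set a := tent _; set b := tent _; set a' := tent _; set b' := tent _.
have -> : a * b - a' * b' = (a - a') * b + a' * (b - b') by ring.
have ha : `|a - a'| <= nrm (z - w) / s.
  rewrite (le_trans (tent_lip _ _))// -mulrBl normrM normfV (gtr0_norm s0).
  rewrite ler_pM2r ?invr_gt0// (_ : _ - _ = complex.Re (z - w)) ?abs_Re_le//.
  by rewrite ReD ReN; ring.
have hb : `|b - b'| <= nrm (z - w) / s.
  rewrite (le_trans (tent_lip _ _))// -mulrBl normrM normfV (gtr0_norm s0).
  rewrite ler_pM2r ?invr_gt0// (_ : _ - _ = complex.Im (z - w)) ?abs_Im_le//.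
  by rewrite ImD ImN; ring.
rewrite (le_trans (ler_normD _ _))// !normrM.
have hb1 : `|b| <= 1 by rewrite ger0_norm ?tent_ge0// tent_le1.
have ha1 : `|a'| <= 1 by rewrite ger0_norm ?tent_ge0// tent_le1.
have n0 : 0 <= nrm (z - w) / s by rewrite divr_ge0 ?nrm_ge0 ?ltW.
rewrite (_ : 2 / s * _ = nrm (z - w) / s * 1 + 1 * (nrm (z - w) / s)); last by ring.
by rewrite lerD// ler_pM.
Qed.

(** The intervals of radius [s0 / 2 ^+ j] around [u j] are nested, and the supremum of their left
    ends lies in all of them. *)
Lemma nested_limit (u : nat -> R) (s0 : R) : 0 <= s0 ->
  (forall j, `|u j.+1 - u j| <= s0 / 2 ^+ j.+1) ->
  exists x, forall j, `|x - u j| <= s0 / 2 ^+ j.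
Proof.
move=> s00 hu.
have p2 j : 0 < 2 ^+ j :> R by rewrite exprn_gt0.
have step j : s0 / 2 ^+ j = s0 / 2 ^+ j.+1 + s0 / 2 ^+ j.+1.
  by rewrite exprS invfM; field; rewrite lt0r_neq0.
have incr i k : u i - s0 / 2 ^+ i <= u (i + k)%N - s0 / 2 ^+ (i + k).
  elim: k => [|k IH]; first by rewrite addn0.
  rewrite addnS (le_trans IH)//; have := hu (i + k)%N; rewrite ler_norml (step (i + k)%N).
  by move=> /andP[]; lra.
have decr i k : u (i + k)%N + s0 / 2 ^+ (i + k) <= u i + s0 / 2 ^+ i.
  elim: k => [|k IH]; first by rewrite addn0.
  rewrite addnS (le_trans _ IH)//; have := hu (i + k)%N; rewrite ler_norml (step (i + k)%N).
  by move=> /andP[]; lra.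
have pos j : 0 <= s0 / 2 ^+ j by rewrite divr_ge0// ltW.
have cross i j : u i - s0 / 2 ^+ i <= u j + s0 / 2 ^+ j.
  have := incr i j; have := decr j i; rewrite addnC.
  by have := pos (i + j)%N; lra.
pose A := [set u j - s0 / 2 ^+ j | j in [set: nat]].
have A0 : A !=set0 by exists (u 0%N - s0 / 2 ^+ 0); exists 0%N.
have ubA j : ubound A (u j + s0 / 2 ^+ j) by move=> _ [i _ <-].
exists (sup A) => j; rewrite ler_norml; apply/andP; split.
  have : u j - s0 / 2 ^+ j <= sup A.
    by apply: ub_le_sup; [exists (u 0%N + s0 / 2 ^+ 0); exact: ubA|exists j].
  by lra.
have : sup A <= u j + s0 / 2 ^+ j by apply: ge_sup.
by lra.
Qed.

(** The offsets -1, 0, 1 of [tent_refine]; [triw] holds its weights 1/2, 1, 1/2. *)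
Definition tri (k : 'I_3) : R := k%:R - 1.
Definition triw (k : 'I_3) : R := if k == 1 :> nat then 1 else 2^-1.

Definition shift_center c (s : R) (k : 'I_3 * 'I_3) : C :=
  (complex.Re c + tri k.1 * s) +i* (complex.Im c + tri k.2 * s).

(** The indices 1 and 2 in the form in which [big_ord_recl] leaves them. *)
Let b1 : (bump 0 0)%:R - 1 = 0 :> R. Proof. exact: subrr. Qed.
Let b2 : (bump 0 (bump 0 0))%:R - 1 = 1 :> R. Proof. exact: addrK. Qed.

Lemma tent2_refine c s z : 0 < s -> tent2 c s z =
  \sum_(k : 'I_3 * 'I_3) triw k.1 * triw k.2 * tent2 (shift_center c (s / 2) k) (s / 2) z.
Proof.
move=> s0; rewrite /tent2 /=.
transitivity ((\sum_(k : 'I_3) triw k * tent (2 * ((complex.Re z - complex.Re c) / s) - tri k)) *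
  (\sum_(k : 'I_3) triw k * tent (2 * ((complex.Im z - complex.Im c) / s) - tri k))).
  have E u : tent u = \sum_(k : 'I_3) triw k * tent (2 * u - tri k).
    rewrite !big_ord_recl big_ord0 /triw /tri /= tent_refine.
    by rewrite mul1r addr0 addrA sub0r opprK b1 b2 subr0.
  by rewrite -!E.
rewrite big_distrlr /= pair_bigA; apply: eq_bigr => -[k l] _ /=.
rewrite mulrACA; congr (_ * (tent _ * tent _)); field; rewrite lt0r_neq0//.
Qed.

(** Starts the subdivision: [tent2_refine] splits tents only, so a function supported in [box 0 s]
    is first cut up by this partition of unity. *)
Lemma tent2_unit s z : 0 < s -> box 0 s z ->
  \sum_(k : 'I_3 * 'I_3) tent2 (shift_center 0 s k) s z = 1.
Proof.
move=> s0 [/= h1 h2]; rewrite /tent2 /=.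
transitivity ((\sum_(k : 'I_3) tent ((complex.Re z) / s - tri k)) *
  (\sum_(k : 'I_3) tent ((complex.Im z) / s - tri k))).
  rewrite big_distrlr /= pair_bigA; apply: eq_bigr => -[k l] _ /=.
  by congr (tent _ * tent _); field; rewrite lt0r_neq0.
have E u : `|u| <= 1 -> \sum_(k : 'I_3) tent (u - tri k) = 1.
  move=> hu; rewrite !big_ord_recl big_ord0 /tri /=.
  by rewrite addr0 addrA sub0r opprK b1 b2 subr0 tent_unit.
rewrite subr0 in h1; rewrite subr0 in h2.
have sc x : `|x| <= s -> `|x / s| <= 1.
  by move=> hx; rewrite normrM normfV (gtr0_norm s0) ler_pdivrMr// mul1r.
by rewrite (E _ (sc _ h1)) (E _ (sc _ h2)) mul1r.
Qed.

Section Goursat.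
Variables (U : set C) (f : C -> C) (M : R).
Hypothesis oU : open U.
Hypothesis df : forall z, U z -> exists l, cdiff f z l.
Hypothesis fM : forall z, U z -> nrm (f z) <= M.

Let F := cut U f.
Let dn (n : nat) : R := n.+1%:R^-1.
Let dn_gt0 n : 0 < dn n. Proof. by rewrite invr_gt0. Qed.

Lemma cdiff_continuous g z l : cdiff g z l -> forall e : R, 0 < e ->
  exists2 d : R, 0 < d & forall y, nrm (y - z) < d -> nrm (g y - g z) < e.
Proof.
move=> dg e e0; have [d d0 hd] := dg 1 ltr01.
have k0 : 0 < nrm l + 1 by rewrite ltr_wpDl ?nrm_ge0.
exists (Num.min d (e / (nrm l + 1))); first by rewrite lt_min d0 divr_gt0.
move=> y; rewrite lt_min => /andP[/hd]; rewrite mul1r [z + _]addrC subrK => h1.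
rewrite ltr_pdivlMr// => h2; apply: le_lt_trans h2.
have := nrmD (g y - g z - l * (y - z)) (l * (y - z)); rewrite subrK nrmM.
by move: h1; lra.
Qed.

Let mF : cmeas F.
Proof.
by apply: cmeas_cut_cont => // z /df[l /cdiff_continuous].
Qed.

Let M0 z : nrm (F z) <= `|M|.
Proof.
have [h|h] := pselect (U z); last by rewrite /F cutF// nrm0.
by rewrite /F cutT// (le_trans (fM h))// ler_norm.
Qed.

(** For smooth compactly supported [Psi] this tends to twice the integral of [F] times dbar(Psi). *)
Definition weak_dbar n Psi : C := I (fun z => dbq (dn n) Psi z * F z).

Let cint_weak c s L n Psi : 0 <= s -> lip L Psi -> (forall z, Psi z != 0 -> box c s z) ->
  cint (fun z => dbq (dn n) Psi z * F z).
Proof.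
move=> s0 lP sP; apply: (@cint_box _ c (s + dn n) (2 * L * `|M|)).
- by rewrite addr_ge0// ltW.
- by apply: cmeasM => //; exact: cmeas_dbq lP.
- by move=> z _; rewrite nrmM ler_pM ?nrm_ge0//; exact: nrm_dbq.
- by move=> z nb; rewrite (dbq_box (ltW (dn_gt0 n)) sP nb) mul0r.
Qed.

Definition bad Psi (e : R) : Prop :=
  forall N, exists2 n, (N <= n)%N & e < nrm (weak_dbar n Psi).

(** Pigeonhole: if every piece were eventually at most [e / m], then from a common rank on the
    weighted sum, of total weight at most [m], would be at most [e]. *)
Lemma bad_sum (T : eqType) (r : seq T) (w : T -> R) (P : T -> C -> C) Psi c s (m e : R) :
  0 <= s -> (forall k, 0 <= w k) -> \sum_(k <- r) w k <= m -> 0 < m ->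
  (forall k, exists L, lip L (P k)) -> (forall k z, P k z != 0 -> box c s z) ->
  (forall z, Psi z = \sum_(k <- r) (w k)%:C * P k z) ->
  0 <= e -> bad Psi e -> exists k, bad (P k) (e / m).
Proof.
move=> s0 w0 wm m0 lP sP PsiE e0 badPsi; apply: contrapT => nb.
have good k : exists N, forall n, (N <= n)%N -> nrm (weak_dbar n (P k)) <= e / m.
  apply: contrapT => h; apply: nb; exists k => N; apply: contrapT => h'.
  apply: h; exists N => n Nn; rewrite leNgt; apply/negP => h2; apply: h'; by exists n.
have [N hN] : exists N, forall n, (N <= n)%N -> forall k, k \in r -> nrm (weak_dbar n (P k)) <= e / m.
  elim: (r) => [|k r' [N1 h1]]; first by exists 0%N.
  have [N2 h2] := good k; exists (maxn N1 N2) => n; rewrite geq_max => /andP[n1 n2] k'.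
  by rewrite inE => /orP[/eqP->|]; [exact: h2|exact: h1].
have [n Nn] := badPsi N; rewrite ltNge => /negP; apply.
have -> : weak_dbar n Psi = \sum_(k <- r) (w k)%:C * weak_dbar n (P k).
  rewrite /weak_dbar.
  have -> : (fun z => dbq (dn n) Psi z * F z) =
     fun z => \sum_(k <- r) (w k)%:C * (dbq (dn n) (P k) z * F z).
    apply/funext => z; rewrite /dbq !PsiE -!sumrB mulr_sumr -big_split /= mulr_sumr mulr_suml.
    by apply: eq_bigr => k _; ring.
  rewrite I_sum => [|k]; last by have [L lk] := lP k; apply: cintZ; exact: cint_weak lk (sP k).
  apply: eq_bigr => k _; rewrite IZ//; have [L lk] := lP k; exact: cint_weak lk (sP k).
rewrite (le_trans (nrm_sum _ _ _))//.
apply: (@le_trans _ _ (\sum_(k <- r) w k * (e / m))).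
  rewrite big_seq [leRHS]big_seq; apply: ler_sum => k kr.
  by rewrite nrmM nrm_real ger0_norm// ler_wpM2l// hN.
by rewrite -mulr_suml mulrA ler_pdivrMr// mulrC ler_wpM2l.
Qed.

Lemma lip_ge0 L Psi : lip L Psi -> 0 <= L.
Proof.
by move=> /(_ 1 0); rewrite subr0 nrm1 mulr1; apply: le_trans; exact: nrm_ge0.
Qed.

Lemma lip_mul_tent2 L A0 Phi c s : 0 < s -> lip L Phi -> (forall z, nrm (Phi z) <= A0) ->
  lip (L + A0 * (2 / s)) (fun z => Phi z * (tent2 c s z)%:C).
Proof.
move=> s0 lP PA z w.
rewrite (_ : _ - _ = (Phi z - Phi w) * (tent2 c s z)%:C +
  Phi w * (tent2 c s z - tent2 c s w)%:C); last by rewrite rmorphB /=; ring.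
rewrite (le_trans (nrmD _ _))// !nrmM !nrm_real (ger0_norm (tent2_ge0 _ _ _)) mulrDl lerD//.
  rewrite -[leRHS]mulr1 ler_pM ?nrm_ge0 ?tent2_ge0 ?tent2_le1//.
by rewrite -mulrA ler_pM ?nrm_ge0 ?normr_ge0//; exact: tent2_lip.
Qed.

(* Goursat: if the limit were not 0, this failure would be inherited, with a fixed share
   of the defect, by tent-weighted pieces of [Phi] on ever smaller squares; there [f] is
   affine up to o(side), and for affine [f] the integral vanishes exactly by translation
   invariance. *)
Theorem weak_cauchy Phi L A0 S rho : lip L Phi -> (forall z, nrm (Phi z) <= A0) ->
  0 < S -> (forall z, Phi z != 0 -> box 0 S z) ->
  0 < rho -> (forall z y, Phi z != 0 -> nrm (y - z) < rho -> U y) ->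
  ccvg (fun n => weak_dbar n Phi) 0.
Proof.
move=> lP PA S0 sP rho0 marg; apply: contrapT => ncv.
have [e [e0 be]] : exists e, 0 < e /\ bad Phi e.
  apply: contrapT => h; apply: ncv => e e0; apply: contrapT => h'; apply: h.
  have e2 : e / 2 < e by rewrite ltr_pdivrMr// ltr_pMr// ltr1n.
  exists (e / 2); split; first by rewrite divr_gt0.
  move=> N; apply: contrapT => h; apply: h'; exists N => n Nn; rewrite subr0 ltNge.
  by apply/negP => h2; apply: h; exists n => //; apply: lt_le_trans e2 h2.
pose sS j : R := S / 2 ^+ j.
have sS0 j : 0 < sS j by rewrite divr_gt0// exprn_gt0.
have sSS j : sS j.+1 = sS j / 2 by rewrite /sS exprS; field; rewrite expf_neq0.
pose P c j := fun z => Phi z * (tent2 c (sS j) z)%:C.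
have lPP c j : lip (L + A0 * (2 / sS j)) (P c j) by exact: lip_mul_tent2.
have sPP c j z : P c j z != 0 -> box 0 S z.
  by rewrite mulf_eq0 negb_or => /andP[/sP].
have sPc c j z : P c j z != 0 -> box c (sS j) z.
  rewrite mulf_eq0 negb_or => /andP[_]; rewrite -nrm_eq0 nrm_real normr_eq0.
  exact: tent2_box.
have card3 : \sum_(k : 'I_3 * 'I_3) (1 : R) = 9.
  by rewrite sumr_const card_prod !card_ord.
have [c0 b0] : exists c0, bad (P c0 0%N) (e / 9).
  have [||||||k hk] := @bad_sum _ (index_enum ('I_3 * 'I_3)%type) (fun=> 1)
    (fun k => P (shift_center 0 S k) 0%N) Phi 0 S 9 e (ltW S0) _ _ _ _ _ _ (ltW e0) be.
  - by [].
  - by rewrite card3.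
  - by [].
  - by move=> k; exists (L + A0 * (2 / sS 0%N)).
  - by move=> k z; exact: sPP.
  - move=> z; have [z0|z0] := eqVneq (Phi z) 0.
      by rewrite big1 => [//|k _]; rewrite /P z0 mul0r mulr0.
    under eq_bigr => k _ do rewrite mul1r /P /sS expr0 divr1.
    by rewrite -mulr_sumr -rmorph_sum /= tent2_unit ?mulr1//; exact: sP.
  - by exists (shift_center 0 S k).
(* The share of the defect at level [j]: nine unit weights in the first splitting, then total weight
   4 in each refinement. It decays at the same rate as the area of the squares. *)
pose p j : R := e / 9 / 4 ^+ j.
have p0 j : 0 < p j by rewrite !divr_gt0// exprn_gt0.
have step (jc : nat * C) : exists c', bad (P jc.2 jc.1) (p jc.1) ->
    bad (P c' jc.1.+1) (p jc.1.+1) /\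
    `|complex.Re c' - complex.Re jc.2| <= sS jc.1.+1 /\
    `|complex.Im c' - complex.Im jc.2| <= sS jc.1.+1.
  case: jc => j c /=; have [bj|nb] := pselect (bad (P c j) (p j)); last by exists 0.
  have triw_ge0 k : 0 <= triw k by rewrite /triw; case: ifP.
  have tri1 k : `|tri k| <= 1.
    case: k => -[|[|[|//]]] hk; rewrite /tri /= ?sub0r ?normrN ?normr1// ?subrr ?normr0//.
    by rewrite addrK normr1.
  have sumw : \sum_(k : 'I_3 * 'I_3) triw k.1 * triw k.2 = 4.
    rewrite -(pair_bigA _ (fun k l => triw k * triw l)) /= -big_distrlr /=.
    by rewrite !big_ord_recl big_ord0 /triw /=; field.
  have [||||||k hk] := @bad_sum _ (index_enum ('I_3 * 'I_3)%type) (fun k => triw k.1 * triw k.2)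
    (fun k => P (shift_center c (sS j.+1) k) j.+1) (P c j) 0 S 4 (p j) (ltW S0) _ _ _ _ _ _ (ltW (p0 j)) bj.
  - by move=> k; rewrite mulr_ge0.
  - by rewrite sumw.
  - by [].
  - by move=> k; exists (L + A0 * (2 / sS j.+1)).
  - by move=> k z; exact: sPP.
  - move=> z; rewrite {1}/P tent2_refine// rmorph_sum mulr_sumr /=; apply: eq_bigr => k _.
    by rewrite rmorphM /= sSS /P sSS; ring.
  exists (shift_center c (sS j.+1) k) => _; split.
    rewrite (_ : p j.+1 = p j / 4)// /p exprS; field; by rewrite expf_neq0.
  have cl u t : `|t| <= 1 -> `|u + t * sS j.+1 - u| <= sS j.+1.
    move=> t1; rewrite addrAC subrr add0r normrM (gtr0_norm (sS0 _)).
    apply: ler_piMl => //; exact: ltW.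
  by split; exact: cl.
have [nxt hnxt] := choice step.
pose cs := fix cs j := if j is j'.+1 then nxt (j', cs j') else c0.
have hcs j : bad (P (cs j) j) (p j).
  elim: j => [|j IH]; first by rewrite /p expr0 divr1.
  by have [] := hnxt (j, cs j) IH.
have [x hx] : exists x, forall j, `|x - complex.Re (cs j)| <= sS j.
  by apply: nested_limit (ltW S0) _ => j; have [_ []] := hnxt (j, cs j) (hcs j).
have [y hy] : exists y, forall j, `|y - complex.Im (cs j)| <= sS j.
  by apply: nested_limit (ltW S0) _ => j; have [_ []] := hnxt (j, cs j) (hcs j).
pose zs : C := x +i* y.
have zbox j : box (cs j) (sS j) zs by [].
have small (d : R) : 0 < d -> exists j, sS j < d.
  move=> d0; exists (Num.truncn (S / d)).+1.
  rewrite /sS ltr_pdivrMr ?exprn_gt0// mulrC -ltr_pdivrMr//.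
  apply: (lt_le_trans (truncnS_gt _)).
  by rewrite -natrX ler_nat ltnW// ltn_expl.
(* A bad piece is not identically zero, so [Phi] is nonzero somewhere within [4 * sS j] of [zs], and
   the margin [rho] puts [zs] in [U]. *)
have Uz : U zs.
  have [j hj] := small (rho / 4) (divr_gt0 rho0 (ltr0Sn _ 3)).
  have [q Pp] : exists q, P (cs j) j q != 0.
    apply: contrapT => h; have [n _] := hcs j 0%N.
    rewrite (_ : weak_dbar n _ = 0) ?nrm0 ?ltNge ?ltW//.
    rewrite /weak_dbar (_ : (fun z => _) = fun=> 0) ?I0//.
    have Pz z : P (cs j) j z = 0 by apply/eqP; apply: contrapT => /negP hz; apply: h; exists z.
    by apply/funext => z; rewrite dbq_eq0 ?mul0r.
  have Phip : Phi q != 0 by move: Pp; rewrite mulf_eq0 negb_or => /andP[].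
  apply: (marg q) => //; rewrite (le_lt_trans (nrm_triangle zs (cs j) q))//.
  have := box_nrm (zbox j); have := box_nrm (sPc _ _ _ Pp); rewrite (nrm_distC (cs j) q).
  by move: hj; lra.
have [r r0 Ur] := (openC U).1 oU _ Uz.
have [l dl] := df Uz.
(* [Q] bounds the Lipschitz constant of a piece times its side, uniformly in the level. In [eta],
   384 is the product 8 * 2 * 6 * 4 met when the integral over the doubled box is estimated. *)
pose Q := L * S + 2 * A0.
have A00 : 0 <= A0 by apply: le_trans (PA 0); exact: nrm_ge0.
have L0 := lip_ge0 lP.
have Q0 : 0 <= Q by rewrite addr_ge0// mulr_ge0// ltW.
pose eta := e / 9 / (384 * (Q + 1) * S ^+ 2).
have Q1 : 0 < Q + 1 by rewrite ltr_wpDl.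
have S2 : 0 < S ^+ 2 by rewrite exprn_gt0.
have eta0 : 0 < eta.
  exact: divr_gt0 (divr_gt0 e0 (ltr0Sn _ 8)) (mulr_gt0 (mulr_gt0 (ltr0Sn _ 383) Q1) S2).
have [d d0 hd] := dl eta eta0.
have dr0 : 0 < Num.min d r by rewrite lt_min d0 r0.
have [j hj] := small (Num.min d r / 6) (divr_gt0 dr0 (ltr0Sn _ 5)).
(* Steps no longer than the side keep the support of the quotient in the doubled box. *)
have [N hN] : exists N, forall n, (N <= n)%N -> dn n <= sS j.
  exists (Num.truncn (sS j)^-1) => n hn.
  rewrite /dn -[leRHS]invrK lef_pV2 ?posrE ?invr_gt0//.
  apply: ltW; apply: (lt_le_trans (truncnS_gt _)).
  by rewrite ler_nat ltnS.
have [n Nn] := hcs j N; rewrite ltNge => /negP; apply.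
move: (hN n Nn) => dns.
set s := sS j in hj dns *; have s0 : 0 < s by exact: sS0.
set c := cs j; set Psi := P c j; set Lj := L + A0 * (2 / s).
have lPsi : lip Lj Psi by exact: lPP.
have sPsi z : Psi z != 0 -> box c s z by exact: sPc.
have PsiA z : nrm (Psi z) <= A0.
  rewrite /Psi /P nrmM nrm_real (ger0_norm (tent2_ge0 _ _ _)) -[leRHS]mulr1.
  by rewrite ler_pM ?nrm_ge0 ?tent2_ge0 ?tent2_le1.
have [ia Ia] := cint_dbq_affine (f zs - l * zs) l (ltW s0) (dn_gt0 n) lPsi sPsi (ex_intro _ A0 PsiA).
have iF := cint_weak n (ltW s0) lPsi sPsi.
(* Subtracting the tangent affine function at [zs] does not change the integral, by [Ia]. *)
have -> : weak_dbar n Psi = I (fun z => dbq (dn n) Psi z * (F z - (f zs - l * zs + l * z))).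
  rewrite [RHS](_ : _ = I (fun z => dbq (dn n) Psi z * F z -
     dbq (dn n) Psi z * (f zs - l * zs + l * z))).
    by rewrite IB// Ia subr0.
  by congr I; apply/funext => z; rewrite mulrBr.
have mD : cmeas (fun z => dbq (dn n) Psi z * (F z - (f zs - l * zs + l * z))).
  have -> : (fun z => dbq (dn n) Psi z * (F z - (f zs - l * zs + l * z))) =
     (fun z => dbq (dn n) Psi z * F z - dbq (dn n) Psi z * (f zs - l * zs + l * z)).
    by apply/funext => z; rewrite mulrBr.
  by apply: cmeasB; exact: cint_meas.
have Lj0 := lip_ge0 lPsi.
apply: (@le_trans _ _ (8 * (2 * Lj * (eta * (6 * s))) * (2 * s) ^+ 2)).
  apply: (@nrm_I_box _ c (2 * s)) => //; first by rewrite mulr_ge0// ltW.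
    move=> z bz; rewrite nrmM ler_pM ?nrm_ge0//; first exact: nrm_dbq.
    have zz : nrm (z - zs) <= 6 * s.
      rewrite (le_trans (nrm_triangle z c zs))//.
      have := box_nrm bz; have := box_nrm (zbox j); rewrite (nrm_distC c zs) -/c -/s; lra.
    have zz' : nrm (z - zs) < Num.min d r by move: hj; rewrite ltr_pdivlMr// mulrC; exact: le_lt_trans.
    move: zz'; rewrite lt_min => /andP[zd zr].
    rewrite /F cutT; last exact: Ur.
    rewrite (_ : f z - _ = f z - f zs - l * (z - zs)); last by ring.
    by have := hd _ zd; rewrite [zs + _]addrC subrK => /le_trans; apply; rewrite ler_wpM2l// ltW.
  move=> z nb; rewrite (dbq_box (ltW (dn_gt0 n)) sPsi) ?mul0r// => h; apply: nb.
  case: h => h1 h2; split; [apply: le_trans h1 _|apply: le_trans h2 _]; lra.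
have LjQ : Lj * s <= Q.
  rewrite /Lj mulrDl /Q lerD//; last by rewrite -mulrA divfK ?lt0r_neq0// mulrC.
  rewrite ler_wpM2l// /s /sS ler_pdivrMr ?exprn_gt0// ler_peMr ?(ltW S0)//.
  by rewrite exprn_ege1// ler1n.
have s2 : s ^+ 2 = S ^+ 2 / 4 ^+ j.
  rewrite /s /sS expr_div_n -exprM mulnC exprM; congr (_ / _ ^+ _).
  by rewrite -natrX.
rewrite (_ : _ * _ ^+ 2 = 384 * eta * (Lj * s) * s ^+ 2); last by ring.
rewrite s2 /eta.
rewrite (_ : _ * (S ^+ 2 / 4 ^+ j) = p j * (Lj * s / (Q + 1))).
  rewrite ler_piMr ?(ltW (p0 j))// ler_pdivrMr// mul1r (le_trans LjQ)//.
  by rewrite lerDl.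
by rewrite /p; field; rewrite !lt0r_neq0 ?exprn_gt0.
Qed.

End Goursat.
End WeakCauchy.

(** * Null sets: circles and perpendicular bisectors *)

Section NullSets.
Variable R : realType.
Local Notation C := (R[i]^o).
Local Notation plane := (measurableTypeR R * measurableTypeR R)%type.
Local Notation area := (@lebesgue_measure R \x @lebesgue_measure R)%E.

Definition null (A : set C) : Prop := mset A /\ area (plane_region A) = 0%E.

Lemma nullU A B : null A -> null B -> null (A `|` B).
Proof.
move=> [mA a0] [mB b0]; split; first exact: msetU.
by apply: null_set_setU.
Qed.

Lemma null0 : null set0.
Proof.
split; last by rewrite /plane_region [X in area X](_ : _ = set0) ?measure0.
by apply: open_mset; exact: open0.
Qed.

Lemma null_bigU (T : Type) (r : seq T) (F : T -> set C) :
  (forall k, null (F k)) -> null (\big[setU/set0]_(k <- r) F k).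
Proof. by move=> h; elim/big_ind : _ => //; [exact: null0|exact: nullU]. Qed.

Lemma rmeas_Re : rmeas (fun z : C => complex.Re z). Proof. exact: measurable_fst. Qed.
Lemma rmeas_Im : rmeas (fun z : C => complex.Im z). Proof. exact: measurable_snd. Qed.

Lemma mset_eq (f : C -> R) (t : R) : rmeas f -> mset [set z | f z = t].
Proof.
move=> mf; have := mf measurableT _ (measurable_set1 t); rewrite setTI /mset.
by congr measurable; apply/seteqP; split.
Qed.

Lemma mset_gt (f : C -> R) (t : R) : rmeas f -> mset [set z | t < f z].
Proof.
move=> mf; have := mf measurableT _ (measurable_itv `]t, +oo[%R); rewrite setTI /mset.
by congr measurable; apply/seteqP; split => p /=; rewrite in_itv /= andbT.
Qed.

(** Circles and lines at once. If [y] occurs, every vertical section has at most two points; if it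
    does not, the set is a vertical line. *)
Lemma null_quadric (a b c d : R) : (a != 0) || (b != 0) || (c != 0) ->
  null [set z : C | a * (complex.Re z ^+ 2 + complex.Im z ^+ 2) +
                b * complex.Re z + c * complex.Im z = d].
Proof.
move=> abc; set A := [set z | _].
have mA : mset A.
  have mRe := @rmeas_Re; have mIm := @rmeas_Im.
  exact: (mset_eq d (rmeasD (rmeasD (rmeasM (rmeas_cst a)
    (rmeasD (rmeasM mRe mRe) (rmeasM mIm mIm))) (rmeasM (rmeas_cst b) mRe))
    (rmeasM (rmeas_cst c) mIm))).
split => //.
have [ac|/norP[]] := boolP ((a != 0) || (c != 0)).
  rewrite /product_measure1 (eq_integral (fun=> 0%E)) ?integral0// => x _ /=.
  have [[y1 /= Ay1]|A0] := pselect (exists y, xsection (plane_region A) x y); last first.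
    rewrite (_ : xsection _ _ = set0) ?measure0//.
    by apply/seteqP; split => // y hy; apply: A0; exists y.
  (* By Vieta the other root is [- (c / a) - y1]; for [a = 0] the division by zero turns it into
     [- y1], a harmless extra point. *)
  have sub : xsection (plane_region A) x `<=` [set y1; - (c / a) - y1].
    move=> y /set_mem h; have := set_mem Ay1; move: h; rewrite /plane_region /A /= => h h1.
    have : (y - y1) * (a * (y + y1) + c) = 0.
      rewrite (_ : _ * _ = (a * (x ^+ 2 + y ^+ 2) + b * x + c * y) -
        (a * (x ^+ 2 + y1 ^+ 2) + b * x + c * y1)); last by ring.
      by rewrite h h1 subrr.
    move=> /eqP; rewrite mulf_eq0 subr_eq0 => /orP[/eqP->|/eqP h2]; first by left.
    have a0 : a != 0.
      apply: contraL ac => /eqP a0; move: h2; rewrite a0 mul0r add0r => ->.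
      by rewrite eqxx.
    right; apply: (mulfI a0); apply/eqP; rewrite -subr_eq0 -h2; apply/eqP; by field.
  apply: countable_lebesgue_measure0.
  exact: (sub_countable (subset_card_le sub) (finite_set_countable (finite_set2 _ _))).
rewrite !negbK => /eqP a0 /eqP c0; move: abc; rewrite a0 c0 eqxx orbF /= => b0.
rewrite (_ : plane_region A = [set d / b] `*` setT); last first.
  apply/seteqP; split => -[x y]; rewrite /plane_region /A /= a0 c0 !mul0r add0r addr0.
    by move=> <-; split => //; rewrite mulrC mulKf.
  by move=> [-> _]; rewrite mulrC divfK.
by rewrite product_measure1E//= lebesgue_measure_set1 mul0e.
Qed.

Lemma null_circle (c : C) (r : R) : null [set z : C | nrm (z - c) ^+ 2 = r].
Proof.
have := @null_quadric 1 (- 2 * complex.Re c) (- 2 * complex.Im c) (r - nrm c ^+ 2).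
rewrite oner_neq0 => /(_ isT); congr null; apply/seteqP; split => z /=.
  by rewrite !nrm_sqr ReD ReN ImD ImN => h; apply/eqP; rewrite -subr_eq0; apply/eqP; lra.
by rewrite !nrm_sqr ReD ReN ImD ImN => h; apply/eqP; rewrite -subr_eq0; apply/eqP; lra.
Qed.

Lemma null_bisector (b c : C) : b != c -> null [set z : C | nrm (z - b) = nrm (z - c)].
Proof.
move=> bc; have := @null_quadric 0 (2 * (complex.Re c - complex.Re b))
  (2 * (complex.Im c - complex.Im b)) (nrm c ^+ 2 - nrm b ^+ 2).
have -> : (0 != 0 :> R) || (2 * (complex.Re c - complex.Re b) != 0) || (2 * (complex.Im c - complex.Im b) != 0).
  rewrite eqxx !mulf_eq0 !pnatr_eq0 /= !subr_eq0 -negb_and.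
  by apply: contra bc => /andP[/eqP h1 /eqP h2]; apply/eqP; exact: complex_ext.
move=> /(_ isT); congr null; apply/seteqP; split => z /=.
  move=> h; apply/eqP; rewrite -(@eqrXn2 _ 2) ?nrm_ge0//; move: h.
  by rewrite !nrm_sqr !(ReD, ReN, ImD, ImN) => h; rewrite -subr_eq0; apply/eqP; lra.
move=> /(congr1 (fun x => x ^+ 2)).
by rewrite !nrm_sqr !(ReD, ReN, ImD, ImN) => h; apply/eqP; rewrite -subr_eq0; apply/eqP; lra.
Qed.
End NullSets.

(** * Induction over compact sets of the plane *)

Section CompactInduction.
Variable R : realType.
Local Notation C := (R[i]^o).

Lemma mem_bigU (T : eqType) (r : seq T) (F : T -> set C) k z :
  k \in r -> F k z -> (\big[setU/set0]_(i <- r) F i) z.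
Proof.
elim: r => // i r IH; rewrite inE big_cons => /orP[/eqP <-|kr] Fz; first by left.
by right; exact: IH.
Qed.

(** Heine-Borel by bisection: a property that fails on [K] fails on boxes shrinking to a point of
    [K], against the local hypothesis. Bounds are made uniform through this instead of finite
    subcovers. *)
Lemma compact_ind (K : set C) (S : R) (Q : set C -> Prop) :
  closed K -> 0 < S -> K `<=` box 0 S ->
  Q set0 -> (forall A B, A `<=` B -> Q B -> Q A) -> (forall A B, Q A -> Q B -> Q (A `|` B)) ->
  (forall z, K z -> exists2 e : R, 0 < e & Q [set y | K y /\ nrm (y - z) < e]) -> Q K.
Proof.
move=> cK S0 KS Q0 Qm QU Qloc; apply: contrapT => nQ.
pose sS j : R := S / 2 ^+ j.
have sS0 j : 0 < sS j by rewrite divr_gt0// exprn_gt0.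
have sSS j : sS j.+1 = sS j / 2 by rewrite /sS exprS; field; rewrite expf_neq0.
have tri1 k : `|tri R k| <= 1.
  case: k => -[|[|[|//]]] hk; rewrite /tri /= ?sub0r ?normrN ?normr1// ?subrr ?normr0//.
  by rewrite addrK normr1.
have step (jc : nat * C) : exists c', ~ Q (K `&` box jc.2 (sS jc.1)) ->
    ~ Q (K `&` box c' (sS jc.1.+1)) /\
    `|complex.Re c' - complex.Re jc.2| <= sS jc.1.+1 /\
    `|complex.Im c' - complex.Im jc.2| <= sS jc.1.+1.
  case: jc => j c /=; have [q|nq] := pselect (Q (K `&` box c (sS j))); first by exists 0.
  have [k hk] : exists k, ~ Q (K `&` box (shift_center c (sS j.+1) k) (sS j.+1)).
    apply: contrapT => h; apply: nq.
    apply: (@Qm _ (\big[setU/set0]_(k : 'I_3 * 'I_3) (K `&` box (shift_center c (sS j.+1) k) (sS j.+1)))).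
      move=> z [Kz [h1 h2]].
      have pick u : `|u| <= sS j -> exists i, `|u - tri R i * sS j.+1| <= sS j.+1.
        rewrite ler_norml sSS => /andP[u1 u2]; have [u0|u0] := leP u 0.
          exists (Ordinal (isT : 0 < 3)%N); rewrite /tri /= sub0r mulN1r opprK ler_norml.
          by apply/andP; split; lra.
        exists (Ordinal (isT : 2 < 3)%N); rewrite /tri /= addrK mul1r ler_norml.
        by apply/andP; split; lra.
      have [k1 hk1] := pick _ h1; have [k2 hk2] := pick _ h2.
      apply: (@mem_bigU _ _ _ (k1, k2)); first exact: mem_index_enum.
      by split => //; split; rewrite /shift_center /= opprD addrA.
    elim/big_ind : _ => // k _; apply: contrapT => h'; apply: h; by exists k.
  exists (shift_center c (sS j.+1) k) => _; split => //.
  have cl u t : `|t| <= 1 -> `|u + t * sS j.+1 - u| <= sS j.+1.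
    move=> t1; rewrite addrAC subrr add0r normrM (gtr0_norm (sS0 _)).
    by apply: ler_piMl => //; exact: ltW.
  by split; exact: cl.
have [nxt hnxt] := choice step.
pose cs := fix cs j := if j is j'.+1 then nxt (j', cs j') else (0 : C).
have hcs j : ~ Q (K `&` box (cs j) (sS j)).
  elim: j => [|j IH]; last by have [] := hnxt (j, cs j) IH.
  by rewrite /sS expr0 divr1 => q; apply: nQ; apply: Qm q => z Kz; split => //; exact: KS.
have [x hx] : exists x, forall j, `|x - complex.Re (cs j)| <= sS j.
  by apply: nested_limit (ltW S0) _ => j; have [_ []] := hnxt (j, cs j) (hcs j).
have [y hy] : exists y, forall j, `|y - complex.Im (cs j)| <= sS j.
  by apply: nested_limit (ltW S0) _ => j; have [_ []] := hnxt (j, cs j) (hcs j).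
pose zs : C := x +i* y.
have zbox j : box (cs j) (sS j) zs by [].
have small (d : R) : 0 < d -> exists j, sS j < d.
  move=> d0; exists (Num.truncn (S / d)).+1.
  rewrite /sS ltr_pdivrMr ?exprn_gt0// mulrC -ltr_pdivrMr//.
  apply: (lt_le_trans (truncnS_gt _)).
  by rewrite -natrX ler_nat ltnW// ltn_expl.
have near (d : R) : 0 < d -> exists j, forall z, box (cs j) (sS j) z -> nrm (z - zs) < d.
  move=> d0; have [j hj] := small (d / 4) (divr_gt0 d0 (ltr0Sn _ 3)); exists j => z bz.
  rewrite (le_lt_trans (nrm_triangle z (cs j) zs))//.
  have := box_nrm (zbox j); have := box_nrm bz; rewrite (nrm_distC (cs j) zs).
  by move: hj; lra.
have Kzs : K zs.
  apply: cK => B /nbhsC[e e0 hB]; have [j hj] := near e e0.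
  apply: contrapT => h; apply: (hcs j); rewrite (_ : _ `&` _ = set0)//.
  apply/seteqP; split => // z [Kz bz]; apply: h; exists z; split => //.
  by apply: hB; exact: hj.
have [e e0 he] := Qloc _ Kzs; have [j hj] := near e e0.
by apply: (hcs j); apply: Qm he => z [Kz /hj].
Qed.

End CompactInduction.

(** * Pointwise complex differentiability and boundedness on compact sets *)

Section Holomorphy.
Variable R : realType.
Local Notation C := (R[i]^o).
Implicit Types (f g : C -> C) (U A : set C) (c z w : C).

Definition hol_at g z : Prop := exists l, cdiff g z l.

Lemma hol_atP g z : hol_at g z <-> derivable g z 1.
Proof.
by split=> [[l /cdiff_derivable[]]//|/derivable_cdiff ?]; exists (derive1 g z).
Qed.

Lemma hol_atD f g z : hol_at f z -> hol_at g z -> hol_at (fun x => f x + g x) z.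
Proof. by rewrite !hol_atP; exact: derivableD. Qed.

Lemma hol_atB f g z : hol_at f z -> hol_at g z -> hol_at (fun x => f x - g x) z.
Proof. by rewrite !hol_atP; exact: derivableB. Qed.

Lemma hol_atM f g z : hol_at f z -> hol_at g z -> hol_at (fun x => f x * g x) z.
Proof. by rewrite !hol_atP; exact: derivableM. Qed.

Lemma hol_at_cst a z : hol_at (fun=> a) z.
Proof. by rewrite hol_atP; exact: derivable_cst. Qed.

Lemma hol_at_id z : hol_at (fun x => x) z.
Proof. by rewrite hol_atP; exact: derivable_id. Qed.

Lemma hol_at_inv w z : z != w -> hol_at (fun x => (x - w)^-1) z.
Proof.
move=> zw; rewrite hol_atP; apply: derivableV; first by rewrite subr_eq0.
by apply: derivableB; [exact: derivable_id|exact: derivable_cst].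
Qed.

Lemma hol_ccont U g : (forall z, U z -> hol_at g z) -> ccont U g.
Proof. by move=> h z /h[l /cdiff_continuous]. Qed.

Lemma hol_cmeas U g : open U -> (forall z, U z -> hol_at g z) -> cmeas (cut U g).
Proof. by move=> oU /hol_ccont; exact: cmeas_cut_cont. Qed.

Lemma open_disc c (r : R) : open [set z : C | nrm (z - c) < r].
Proof.
apply/openC => z /= zr; exists (r - nrm (z - c)); first by rewrite subr_gt0.
move=> y; rewrite ltrBrDr; apply: le_lt_trans; exact: nrm_triangle.
Qed.

Lemma open_exterior c (r : R) : open [set z : C | r < nrm (z - c)].
Proof.
apply/openC => z /= zr; exists (nrm (z - c) - r); first by rewrite subr_gt0.
move=> y hy; have := nrm_triangle z y c; rewrite (nrm_distC z y); move: hy; lra.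
Qed.

Lemma closed_disc c (r : R) : closed [set z : C | nrm (z - c) <= r].
Proof.
rewrite [X in closed X](_ : _ = ~` [set z | r < nrm (z - c)]).
  by apply: open_closedC; exact: open_exterior.
by apply/seteqP; split => z /=; rewrite leNgt => /negP.
Qed.

Lemma disc_box c (r : R) : [set z : C | nrm (z - c) <= r] `<=` box c r.
Proof.
move=> z /= h; split; rewrite -?ReN -?ImN -?ReD -?ImD; apply: le_trans h.
  exact: abs_Re_le.
exact: abs_Im_le.
Qed.

Lemma bounded_compact (K : set C) (S : R) g : closed K -> 0 < S -> K `<=` box 0 S ->
  ccont K g -> exists M, forall z, K z -> nrm (g z) <= M.
Proof.
move=> cK S0 KS cg; apply: (@compact_ind _ K S (fun A => exists M, forall z, A z -> nrm (g z) <= M)) => //.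
- by exists 0.
- by move=> A B AB [M hM]; exists M => z /AB /hM.
- move=> A B [M hM] [M' hM']; exists (Num.max M M') => z [/hM|/hM']; rewrite le_max => -> //.
  by rewrite orbT.
- move=> z Kz; have [d d0 hd] := cg z Kz 1 ltr01; exists d => //; exists (1 + nrm (g z)).
  move=> y [_ /hd h]; rewrite -[g y](subrK (g z)) (le_trans (nrmD _ _))// lerD2r.
  exact: ltW.
Qed.

Lemma bounded_disc c (r : R) g : (forall z, nrm (z - c) <= r -> hol_at g z) ->
  exists M, forall z, nrm (z - c) <= r -> nrm (g z) <= M.
Proof.
move=> hg; have S0 : 0 < nrm c + `|r| + 1 by rewrite ltr_wpDl// addr_ge0 ?nrm_ge0.
have := @bounded_compact [set z | nrm (z - c) <= r] (nrm c + `|r| + 1) g.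
apply => //; first exact: closed_disc.
  move=> z /= h; apply: disc_box => /=; rewrite subr0 -[z](subrK c) (le_trans (nrmD _ _))//.
  by rewrite addrC -addrA lerD2l (le_trans h)// (le_trans (ler_norm _))// lerDl.
by apply: hol_ccont.
Qed.

Lemma cut_cut A U (V : nmodType) (f : C -> V) : A `<=` U -> cut A (cut U f) = cut A f.
Proof.
move=> AU; apply/funext => z; have [h|h] := pselect (A z); last by rewrite !cutF.
by rewrite !cutT//; exact: AU.
Qed.

Lemma cint_cut A U c (s M : R) f : mset A -> A `<=` U -> A `<=` box c s -> 0 <= s -> 0 <= M ->
  open U -> ccont U f -> (forall z, A z -> nrm (f z) <= M) ->
  cint (cut A f) /\ nrm (I (cut A f)) <= 8 * M * s ^+ 2.
Proof.
move=> mA AU Ab s0 M0 oU cf fM.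
have m1 : cmeas (cut A f) by rewrite -(cut_cut _ AU); apply: cmeas_cut => //; exact: cmeas_cut_cont.
have bd y : box c s y -> nrm (cut A f y) <= M.
  move=> _; have [h|h] := pselect (A y); first by rewrite cutT// fM.
  by rewrite cutF// nrm0.
have z0 y : ~ box c s y -> cut A f y = 0 by move=> h; rewrite cutF// => /Ab.
split; first exact: (cint_box s0 m1 bd z0).
exact: (nrm_I_box s0 m1 bd z0).
Qed.
End Holomorphy.

(** * Radial cutoffs and their d-bar derivatives *)

Section AnnulusFormula.
Variable R : realType.
Local Notation C := (R[i]^o).
Local Notation im := (0 +i* 1 : C).
Local Notation plane := (measurableTypeR R * measurableTypeR R)%type.
Local Notation area := (@lebesgue_measure R \x @lebesgue_measure R)%E.
Implicit Types (f g Phi Psi : C -> C) (U A : set C) (c z w : C).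

Let dn (n : nat) : R := n.+1%:R^-1.
Let dn_gt0 n : 0 < dn n. Proof. by rewrite invr_gt0. Qed.

Lemma small_dn (d : R) : 0 < d -> exists N, forall n, (N <= n)%N -> n.+1%:R^-1 < d.
Proof.
move=> d0; exists (Num.truncn d^-1) => n hn; rewrite -[ltRHS]invrK ltf_pV2 ?posrE ?invr_gt0//.
by apply: (lt_le_trans (truncnS_gt _)); rewrite ler_nat ltnS.
Qed.

Lemma ccvgMr (u : nat -> C) l a : ccvg u l -> ccvg (fun n => u n * a) (l * a).
Proof.
move=> ul e e0; have a0 : 0 < nrm a + 1 by rewrite ltr_wpDl ?nrm_ge0.
have [N hN] := ul (e / (nrm a + 1)) (divr_gt0 e0 a0); exists N => n /hN.
rewrite -mulrBl nrmM ltr_pdivlMr// mulrDr mulr1; apply: le_lt_trans.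
by rewrite lerDl nrm_ge0.
Qed.

Lemma ccvg_cst (a : C) : ccvg (fun=> a) a.
Proof. by move=> e e0; exists 0%N => n _; rewrite subrr nrm0. Qed.

(** Dominated convergence turns [weak_cauchy] into an identity for the almost everywhere limit [D]
    of the quotients, which is twice the d-bar derivative of [Phi]. *)
Lemma weak_cauchy_dbar U f (M : R) Phi (L A0 S rho : R) (N : set C) D :
  open U -> (forall z, U z -> hol_at f z) -> (forall z, U z -> nrm (f z) <= M) ->
  lip L Phi -> (forall z, nrm (Phi z) <= A0) ->
  0 < S -> (forall z, Phi z != 0 -> box 0 S z) ->
  0 < rho -> (forall z y, Phi z != 0 -> nrm (y - z) < rho -> U y) ->
  null N -> cmeas D -> (forall z, ~ N z -> ccvg (fun n => dbq n.+1%:R^-1 Phi z) (D z)) ->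
  I (fun z => D z * cut U f z) = 0.
Proof.
move=> oU hf fM lP PA S0 sP rho0 marg [mN N0] mD cD.
have w := weak_cauchy oU hf fM lP PA S0 sP rho0 marg.
have mF := hol_cmeas oU hf.
apply: ccvg_unique w.
(* All steps are at most 1, so every quotient lives in the box of half-side [S + 1]. *)
apply: (@I_dct _ _ _ (fun z => (2 * L * `|M|) * ind (box 0 (S + 1)) z) N) => //.
- by move=> n; apply: cmeasM => //; exact: cmeas_dbq lP.
- exact: cmeasM.
- by apply: rintZ; apply: rint_ind_box; rewrite addr_ge0// ltW.
- move=> n z; have [h|h] := pselect (box 0 (S + 1) z).
    rewrite indT// mulr1 nrmM ler_pM ?nrm_ge0//; first exact: nrm_dbq.
    have [hU|hU] := pselect (U z); last by rewrite cutF// nrm0.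
    by rewrite cutT// (le_trans (fM _ hU))// ler_norm.
  rewrite indF// mulr0 (dbq_box (ltW (dn_gt0 n)) sP) ?mul0r ?nrm0// => -[h1 h2]; apply: h.
  have d1 : dn n <= 1 by rewrite invf_le1// ler1n.
  by split; [apply: le_trans h1 _|apply: le_trans h2 _]; rewrite lerD2l.
- by move=> z Nz; apply: ccvgMr; exact: cD.
Qed.

Definition clamp (x : R) : R := Num.max 0 (Num.min 1 x).

Lemma clamp_ge0 x : 0 <= clamp x. Proof. by rewrite /clamp le_max lexx. Qed.

Lemma clamp_le1 x : clamp x <= 1. Proof. by rewrite /clamp ge_max ler01 ge_min lexx. Qed.

Lemma clamp0 x : x <= 0 -> clamp x = 0.
Proof. by move=> h; rewrite /clamp max_l// ge_min h orbT. Qed.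

Lemma clamp1 x : 1 <= x -> clamp x = 1.
Proof. by move=> h; rewrite /clamp min_l// max_r. Qed.

Lemma clampE x : 0 <= x -> x <= 1 -> clamp x = x.
Proof. by move=> h k; rewrite /clamp min_r// max_r. Qed.

Lemma clamp_lip x y : `|clamp x - clamp y| <= `|x - y|.
Proof.
rewrite ler_norml; have := ler_norm (x - y); have := ler_norm (- (x - y)); rewrite normrN => hx hy.
have [x0|x0] := leP x 0; first rewrite (clamp0 x0).
  have [y0|y0] := leP y 0; first by rewrite (clamp0 y0); apply/andP; split; lra.
  have [y1|y1] := leP y 1; first by rewrite (clampE (ltW y0) y1); apply/andP; split; lra.
  by rewrite (clamp1 (ltW y1)); apply/andP; split; lra.
have [x1|x1] := leP x 1; [rewrite (clampE (ltW x0) x1)|rewrite (clamp1 (ltW x1))].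
  have [y0|y0] := leP y 0; first by rewrite (clamp0 y0); apply/andP; split; lra.
  have [y1|y1] := leP y 1; first by rewrite (clampE (ltW y0) y1); apply/andP; split; lra.
  by rewrite (clamp1 (ltW y1)); apply/andP; split; lra.
have [y0|y0] := leP y 0; first by rewrite (clamp0 y0); apply/andP; split; lra.
have [y1|y1] := leP y 1; first by rewrite (clampE (ltW y0) y1); apply/andP; split; lra.
by rewrite (clamp1 (ltW y1)); apply/andP; split; lra.
Qed.

(** Radial cutoff: 1 up to distance [r], 0 from distance [sqrt 2 * r] on. Being affine in the
    squared distance in between, it has a d-bar derivative proportional to [z - c] there; [dtheta]
    records it with the factor 2 of [dbq]. *)
Definition theta c (r : R) z : R := clamp (2 - nrm (z - c) ^+ 2 / r ^+ 2).

Lemma theta_lip c r z w : 0 < r -> `|theta c r z - theta c r w| <= 4 / r * nrm (z - w).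
Proof.
move=> r0; rewrite /theta -!expr_div_n.
have : `|nrm (z - c) / r - nrm (w - c) / r| <= nrm (z - w) / r.
  rewrite -mulrBl normrM normfV (gtr0_norm r0) ler_pM2r ?invr_gt0// ler_norml.
  have := nrm_triangle z w c; have := nrm_triangle w z c; rewrite (nrm_distC w z).
  by move=> h1 h2; apply/andP; split; lra.
have : 0 <= nrm (z - c) / r by rewrite divr_ge0 ?nrm_ge0 ?ltW.
have : 0 <= nrm (w - c) / r by rewrite divr_ge0 ?nrm_ge0 ?ltW.
rewrite (_ : 4 / r * _ = 4 * (nrm (z - w) / r)); last by ring.
move: (nrm (z - c) / r) (nrm (w - c) / r) (nrm (z - w) / r) => a b d b0 a0 abd.
(* The slope of [x ^+ 2] is at most 4 up to 2, and beyond 2 the clamped value stays 0. *)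
suff key x y : 0 <= x -> x <= y -> `|clamp (2 - x ^+ 2) - clamp (2 - y ^+ 2)| <= 4 * (y - x).
  move: abd; rewrite ler_norml => /andP[h1 h2]; case: (leP a b) => ab.
    by apply: (le_trans (key a b a0 ab)); lra.
  by rewrite distrC; apply: (le_trans (key b a b0 (ltW ab))); lra.
move=> x0 xy; have y0 := le_trans x0 xy.
case: (leP y 2) => y2.
  rewrite (le_trans (clamp_lip _ _))// (_ : _ - _ = (y - x) * (x + y)); last by ring.
  rewrite ger0_norm ?mulr_ge0 ?subr_ge0 ?addr_ge0// mulrC ler_wpM2r ?subr_ge0//; lra.
rewrite [X in _ - X]clamp0; last by rewrite subr_le0; nra.
case: (leP x 2) => x2; last first.
  rewrite clamp0 ?subrr ?normr0 ?mulr_ge0 ?subr_ge0//; first by rewrite subr_le0; nra.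
rewrite -(@clamp0 (2 - 2 ^+ 2)) ?subr_le0; last by rewrite expr2; lra.
rewrite (le_trans (clamp_lip _ _))// (_ : _ - _ = (2 - x) * (2 + x)); last by ring.
by rewrite ger0_norm ?mulr_ge0 ?subr_ge0 ?addr_ge0//; nra.
Qed.

Definition ann c (r : R) : set C :=
  [set z | r ^+ 2 < nrm (z - c) ^+ 2 /\ nrm (z - c) ^+ 2 < 2 * r ^+ 2].

Definition dtheta c (r : R) : C -> C :=
  cut (ann c r) (fun z => - (2 / r ^+ 2)%:C * (z - c)).

Lemma ccvg_dbq_local Phi Psi z l :
  (exists2 d : R, 0 < d & forall h, nrm h < d -> Phi (z + h) = Psi (z + h)) ->
  ccvg (fun n => dbq n.+1%:R^-1 Psi z) l -> ccvg (fun n => dbq n.+1%:R^-1 Phi z) l.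
Proof.
move=> [d d0 hd] cl e e0; have [N1 h1] := cl e e0; have [N2 h2] := small_dn d0.
exists (maxn N1 N2) => n; rewrite geq_max => /andP[/h1 k1 /h2 k2].
have dnn := dn_gt0 n; rewrite /dn in dnn.
have E0 : Phi z = Psi z by have := hd 0; rewrite nrm0 addr0 => ->.
rewrite /dbq E0 (hd (n.+1%:R^-1)%:C) ?nrm_real ?gtr0_norm//.
by rewrite (hd (0 +i* n.+1%:R^-1)) ?nrm_imag ?gtr0_norm.
Qed.

Lemma ccvg_dbq_const a z : ccvg (fun n => dbq n.+1%:R^-1 (fun=> a) z) 0.
Proof.
rewrite (_ : (fun n => _) = fun=> 0); first exact: ccvg_cst.
by apply/funext => n; rewrite /dbq subrr mulr0 addr0 mulr0.
Qed.

Lemma ccvg_dbq_sq c (k b : R) z :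
  ccvg (fun n => dbq n.+1%:R^-1 (fun y => (b - k * nrm (y - c) ^+ 2)%:C) z) (- (2 * k)%:C * (z - c)).
Proof.
move=> e e0; have k0 : 0 < 2 * `|k| + 1 by rewrite ltr_wpDl ?mulr_ge0.
have [N hN] := small_dn (divr_gt0 e0 k0); exists N => n /hN.
have := dn_gt0 n; rewrite /dn; move: (n.+1%:R^-1) => t t0.
rewrite ltr_pdivlMr// => te.
(* For a quadratic function the error of the quotient is exactly linear in the step. *)
have -> : dbq t (fun y => (b - k * nrm (y - c) ^+ 2)%:C) z - - (2 * k)%:C * (z - c) =
    - (k * t)%:C * (1 + im).
  rewrite /dbq !nrm_sqr; case: z c => x y [p q]; apply: complex_ext => /=; field; exact: lt0r_neq0.
rewrite nrmM nrmN nrm_real normrM (gtr0_norm t0).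
have : nrm (1 + im) <= 2 by rewrite (le_trans (nrmD _ _))// nrm1 nrm_i.
move: te; have := normr_ge0 k; move: (`|k|) (nrm _) (nrm_ge0 (1 + im)) => K m m0 K0 te m2.
have : K * t * m <= K * t * 2 by rewrite ler_wpM2l// mulr_ge0// ltW.
by move: te; lra.
Qed.

Lemma nrm2_near c z (e : R) : 0 < e -> exists2 d : R, 0 < d & forall h, nrm h < d ->
  `|nrm (z + h - c) ^+ 2 - nrm (z - c) ^+ 2| < e.
Proof.
move=> e0; have a0 := nrm_ge0 (z - c); set a := nrm (z - c) in a0 *.
have a1 : 0 < 2 * a + 1 by rewrite ltr_wpDl ?mulr_ge0.
exists (Num.min 1 (e / (2 * a + 1))); first by rewrite lt_min ltr01 divr_gt0.
move=> h; rewrite lt_min => /andP[h1]; rewrite ltr_pdivlMr// => h2.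
have u1 : nrm (z + h - c) <= a + nrm h by rewrite addrAC nrmD.
have u2 : a <= nrm (z + h - c) + nrm h.
  by rewrite /a -{1}(addrK h z) addrAC (le_trans (nrmB _ _))// addrAC.
have u0 := nrm_ge0 (z + h - c); have n0 := nrm_ge0 h.
move: (nrm (z + h - c)) (nrm h) u1 u2 u0 n0 h1 h2 => u v u1 u2 u0 v0 v1 ve.
by rewrite ltr_norml; apply/andP; split; nra.
Qed.

Lemma ccvg_dtheta c (r : R) z : 0 < r -> nrm (z - c) ^+ 2 != r ^+ 2 ->
  nrm (z - c) ^+ 2 != 2 * r ^+ 2 ->
  ccvg (fun n => dbq n.+1%:R^-1 (fun y => (theta c r y)%:C) z) (dtheta c r z).
Proof.
move=> r0 n1 n2; have r2 : 0 < r ^+ 2 by rewrite exprn_gt0.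
have [h1|h1] := ltP (nrm (z - c) ^+ 2) (r ^+ 2).
  rewrite /dtheta cutF; last by move=> [/(lt_trans h1)]; rewrite ltxx.
  apply: (@ccvg_dbq_local _ (fun=> 1)); last exact: ccvg_dbq_const.
  have p1 : 0 < r ^+ 2 - nrm (z - c) ^+ 2 by rewrite subr_gt0.
  have [d d0 hd] := nrm2_near c z p1.
  exists d => // h /hd; rewrite ltr_norml => /andP[_ h2]; rewrite /theta clamp1//.
  have : nrm (z + h - c) ^+ 2 / r ^+ 2 <= 1 by rewrite ler_pdivrMr// mul1r; lra.
  lra.
have {}h1 : r ^+ 2 < nrm (z - c) ^+ 2 by rewrite lt_def n1.
have [h2|h2] := ltP (nrm (z - c) ^+ 2) (2 * r ^+ 2).
  rewrite /dtheta cutT//.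
  apply: (@ccvg_dbq_local _ (fun y => (2 - (r ^+ 2)^-1 * nrm (y - c) ^+ 2)%:C)); last exact: ccvg_dbq_sq.
  have p1 : 0 < nrm (z - c) ^+ 2 - r ^+ 2 by rewrite subr_gt0.
  have p2 : 0 < 2 * r ^+ 2 - nrm (z - c) ^+ 2 by rewrite subr_gt0.
  have [d1 d10 hd1] := nrm2_near c z p1.
  have [d2 d20 hd2] := nrm2_near c z p2.
  exists (Num.min d1 d2); first by rewrite lt_min d10.
  move=> h; rewrite lt_min => /andP[/hd1 + /hd2]; rewrite !ltr_norml => /andP[k1 k2] /andP[k3 k4].
  rewrite /theta [_ / _]mulrC clampE//.
    by rewrite mulrC subr_ge0 ler_pdivrMr//; lra.
  have : 1 <= (r ^+ 2)^-1 * nrm (z + h - c) ^+ 2 by rewrite mulrC ler_pdivlMr// mul1r; lra.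
  lra.
have {}h2 : 2 * r ^+ 2 < nrm (z - c) ^+ 2 by rewrite lt_def n2.
rewrite /dtheta cutF; last by move=> [_ /(lt_trans h2)]; rewrite ltxx.
apply: (@ccvg_dbq_local _ (fun=> 0)); last exact: ccvg_dbq_const.
have p1 : 0 < nrm (z - c) ^+ 2 - 2 * r ^+ 2 by rewrite subr_gt0.
have [d d0 hd] := nrm2_near c z p1.
exists d => // h /hd; rewrite ltr_norml => /andP[h3 _]; rewrite /theta clamp0//.
by rewrite subr_le0 ler_pdivlMr//; lra.
Qed.
End AnnulusFormula.

(** * Cauchy's formula and estimates *)

Section CauchyFormula.
Variable R : realType.
Local Notation C := (R[i]^o).
Local Notation im := (0 +i* 1 : C).
Implicit Types (f g : C -> C) (U A : set C) (c z w : C).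

Lemma mset_ann c (r : R) : mset (ann c r).
Proof.
have m : rmeas (fun z : C => nrm (z - c) ^+ 2).
  apply: (@cmeas_nrm2 _ (fun z => z - c)); apply: cmeas_cont => z _ e e0; exists e => // y.
  by rewrite opprB addrA subrK.
have -> : ann c r = [set z | r ^+ 2 < nrm (z - c) ^+ 2] `&`
    [set z | - (2 * r ^+ 2) < - 1 * nrm (z - c) ^+ 2].
  by apply/seteqP; split => z [h1 h2]; split => //=; move: h2 => /=; lra.
apply: msetI; first exact: mset_gt.
by apply: mset_gt; apply: rmeasM => //; exact: rmeas_cst.
Qed.

Lemma ann_lt c (r : R) z : 0 < r -> ann c r z -> r < nrm (z - c) /\ nrm (z - c) < 2 * r.
Proof.
move=> r0 [h1 h2]; split.
  by rewrite -ltr_sqr ?nnegrE ?nrm_ge0// ltW.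
rewrite -ltr_sqr ?nnegrE ?nrm_ge0 ?mulr_ge0 ?(ltW r0)//; apply: lt_le_trans h2 _.
by rewrite exprMn ler_pM2r ?exprn_gt0// expr2; lra.
Qed.

Lemma ann_box c (r : R) : 0 < r -> ann c r `<=` box c (2 * r).
Proof. by move=> r0 z /(ann_lt r0)[_ /ltW h]; exact: disc_box. Qed.

Lemma theta_eq1 c (r : R) z : 0 < r -> nrm (z - c) <= r -> theta c r z = 1.
Proof.
move=> r0 h; rewrite /theta clamp1// -expr_div_n.
have : nrm (z - c) / r <= 1 by rewrite ler_pdivrMr// mul1r.
have : 0 <= nrm (z - c) / r by rewrite divr_ge0 ?nrm_ge0 ?ltW.
by move: (_ / _) => a; nra.
Qed.

Lemma theta_eq0 c (r : R) z : 0 < r -> 2 * r ^+ 2 <= nrm (z - c) ^+ 2 -> theta c r z = 0.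
Proof.
by move=> r0 h; rewrite /theta clamp0// subr_le0 ler_pdivlMr// exprn_gt0.
Qed.

Lemma theta_eq0_far c (r : R) z : 0 < r -> 3 / 2 * r <= nrm (z - c) -> theta c r z = 0.
Proof. by move=> r0 h; apply: theta_eq0 => //; nra. Qed.

(* The d-bar pairing of [g z / (z - w)] with the difference of two radial cutoffs compares
   an annulus around [w0] with a small one around [w]. *)
Lemma annulus_transfer U g w0 (r : R) w (eps : R) : open U ->
  (forall z, U z -> hol_at g z) -> 0 < r -> (forall z, nrm (z - w0) <= 2 * r -> U z) ->
  0 < eps -> 2 * eps <= r - nrm (w - w0) ->
  [/\ cint (cut (ann w0 r) (fun z => (z - w0) / (z - w) * g z)),
      cint (cut (ann w eps) g) &
      (r ^- 2)%:C * I (cut (ann w0 r) (fun z => (z - w0) / (z - w) * g z)) =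
      (eps ^- 2)%:C * I (cut (ann w eps) g)].
Proof.
move=> oU hg r0 dU e0 er.
have ew := nrm_ge0 (w - w0).
have [Mg hMg] := bounded_disc (fun z h => hg z (dU z h)).
have Mg0 : 0 <= Mg.
  by apply: le_trans (hMg w0 _); [exact: nrm_ge0|rewrite subrr nrm0 mulr_ge0// ltW].
(* Both cutoffs are 1 near [w], so their difference is supported where [(z - w)^-1] is
   holomorphic. *)
pose U' := [set z : C | nrm (z - w0) < 2 * r] `&` [set z : C | eps / 2 < nrm (z - w)].
have oU' : open U' by apply: openI; [exact: open_disc|exact: open_exterior].
have zw z : U' z -> z != w.
  move=> [_ /= h]; apply/eqP => zw; move: h; rewrite zw subrr nrm0; lra.
have hinv z : U' z -> hol_at (fun z => (z - w)^-1) z by move=> /zw; exact: hol_at_inv.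
have hg' z : U' z -> hol_at g z by move=> [/ltW h _]; apply: hg; exact: dU.
have hf z : U' z -> hol_at (fun z => g z * (z - w)^-1) z.
  by move=> h; apply: hol_atM; [exact: hg'|exact: hinv].
have invM z : U' z -> nrm (z - w)^-1 <= 2 / eps.
  move=> [_ /= h]; rewrite nrmV -[leRHS]invrK lef_pV2 ?posrE ?invr_gt0 ?divr_gt0//.
    by rewrite invf_div ltW.
  by apply: lt_trans h; rewrite divr_gt0.
have gM z : U' z -> nrm (g z) <= Mg by move=> [/ltW h _]; exact: hMg.
have fM z : U' z -> nrm (g z * (z - w)^-1) <= Mg * (2 / eps).
  by move=> h; rewrite nrmM ler_pM ?nrm_ge0//; [exact: gM|exact: invM].
have A1 : ann w0 r `<=` U'.
  move=> z /(ann_lt r0)[h1 h2]; split => //=.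
  by have := nrm_triangle z w w0; lra.
have A2 : ann w eps `<=` U'.
  move=> z /(ann_lt e0)[h1 h2]; split => /=; last by lra.
  by have := nrm_triangle z w w0; lra.
have cF : ccont U' (fun z => (z - w0) / (z - w) * g z).
  apply: hol_ccont => z h; apply: hol_atM; last exact: hg'.
  apply: hol_atM; last exact: hinv.
  by apply: hol_atB; [exact: hol_at_id|exact: hol_at_cst].
have i1 : cint (cut (ann w0 r) (fun z => (z - w0) / (z - w) * g z)).
  apply: (@cint_cut _ _ U' w0 (2 * r) (2 * r * (2 / eps) * Mg) _ _ A1 _ _ _ oU' cF _).1.
  - exact: mset_ann.
  - exact: ann_box.
  - by rewrite mulr_ge0// ltW.
  - by rewrite !mulr_ge0 ?invr_ge0 ?(ltW r0) ?(ltW e0).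
  - move=> z az; have u := A1 z az; have [_ /ltW] := ann_lt r0 az => h2.
    by rewrite !nrmM !ler_pM ?mulr_ge0 ?nrm_ge0//; [exact: invM|exact: gM].
have i2 : cint (cut (ann w eps) g).
  apply: (@cint_cut _ _ U' w (2 * eps) Mg _ _ A2 _ _ _ oU' _ _).1 => //.
  - exact: mset_ann.
  - exact: ann_box.
  - by rewrite mulr_ge0// ltW.
  - exact: hol_ccont.
  - by move=> z /A2; exact: gM.
split; [exact: i1|exact: i2|].
have nz z : (theta w0 r z - theta w eps z)%:C != 0 ->
    nrm (z - w0) <= 3 / 2 * r /\ eps <= nrm (z - w).
  move=> h; split; rewrite leNgt; apply: contra h => h.
    rewrite !theta_eq0_far ?subrr//; last exact: ltW.
    have := nrm_triangle z w w0; lra.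
  rewrite !theta_eq1 ?subrr// ?(ltW h)//.
  by have := nrm_triangle z w w0; lra.
pose N := ([set z : C | nrm (z - w0) ^+ 2 = r ^+ 2] `|` [set z : C | nrm (z - w0) ^+ 2 = 2 * r ^+ 2]) `|`
  ([set z : C | nrm (z - w) ^+ 2 = eps ^+ 2] `|` [set z : C | nrm (z - w) ^+ 2 = 2 * eps ^+ 2]).
have nN : null N by apply: nullU; apply: nullU; exact: null_circle.
have m1 c (s : R) : cmeas (dtheta c s).
  apply: cmeas_cut; first exact: mset_ann.
  apply: cmeasM; first exact: cmeas_cst.
  by apply: cmeas_cont => z _ e e0'; exists e => // y; rewrite opprB addrA subrK.
have E := @weak_cauchy_dbar _ U' (fun z => g z * (z - w)^-1) (Mg * (2 / eps))
  (fun z => (theta w0 r z - theta w eps z)%:C) (4 / r + 4 / eps) 1 (nrm w0 + 2 * r)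
  (Num.min (eps / 2) (r / 2)) N (fun z => dtheta w0 r z - dtheta w eps z)
  oU' hf fM.
have {}E : I (fun z => (dtheta w0 r z - dtheta w eps z) * cut U' (fun z => g z * (z - w)^-1) z) = 0.
  apply: E => //.
  - move=> z y; rewrite -rmorphB nrm_real mulrDl /=.
    rewrite (_ : _ - _ - _ = (theta w0 r z - theta w0 r y) - (theta w eps z - theta w eps y)); last by ring.
    by rewrite (le_trans (ler_normB _ _))// lerD// theta_lip.
  - move=> z; rewrite nrm_real ler_norml /theta.
    have := clamp_ge0 (2 - nrm (z - w0) ^+ 2 / r ^+ 2); have := clamp_le1 (2 - nrm (z - w0) ^+ 2 / r ^+ 2).
    have := clamp_ge0 (2 - nrm (z - w) ^+ 2 / eps ^+ 2); have := clamp_le1 (2 - nrm (z - w) ^+ 2 / eps ^+ 2).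
    by move=> *; apply/andP; split; lra.
  - by rewrite ltr_wpDl ?nrm_ge0// mulr_gt0.
  - move=> z /nz[h _]; apply: disc_box => /=; rewrite subr0 -[z](subrK w0) (le_trans (nrmD _ _))//.
    by rewrite addrC lerD2l; lra.
  - by rewrite lt_min !divr_gt0.
  - move=> z y /nz[h1 h2]; rewrite lt_min => /andP[h3 h4]; split => /=.
      by have := nrm_triangle y z w0; lra.
    by have := nrm_triangle z y w; rewrite (nrm_distC z y); lra.
  - exact: cmeasB.
  - move=> z /not_orP[/not_orP[/= /eqP n1 /eqP n2] /not_orP[/= /eqP n3 /eqP n4]].
    have c1 := ccvg_dtheta r0 n1 n2; have c2 := ccvg_dtheta e0 n3 n4.
    move=> e ep; have ep2 : 0 < e / 2 by rewrite divr_gt0.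
    have [N1 h1] := c1 _ ep2; have [N2 h2] := c2 _ ep2.
    exists (maxn N1 N2) => n; rewrite geq_max => /andP[/h1 k1 /h2 k2].
    rewrite [X in nrm X](_ : _ =
      (dbq n.+1%:R^-1 (fun y => (theta w0 r y)%:C) z - dtheta w0 r z) -
      (dbq n.+1%:R^-1 (fun y => (theta w eps y)%:C) z - dtheta w eps z)).
      by rewrite (le_lt_trans (nrmB _ _))// (splitr e) ltrD.
    by rewrite /dbq !rmorphB /=; ring.
(* On the annulus around [w] the factor [z - w] of [dtheta] cancels the pole and leaves [g]; around
   [w0] the quotient remains. *)
move: E; rewrite (_ : (fun z => _) = (fun z =>
   - (2 / r ^+ 2)%:C * cut (ann w0 r) (fun z => (z - w0) / (z - w) * g z) z +
   (2 / eps ^+ 2)%:C * cut (ann w eps) g z)); last first.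
  apply/funext => z; rewrite mulrBl; congr (_ + _).
    rewrite /dtheta; have [h|h] := pselect (ann w0 r z); last by rewrite ![cut (ann w0 r) _ z]cutF// mul0r mulr0.
    by rewrite !cutT//; [ring|exact: A1].
  rewrite /dtheta; have [h|h] := pselect (ann w eps z); last by rewrite ![cut (ann w eps) _ z]cutF// mul0r mulr0 oppr0.
  rewrite !cutT//; last exact: A2.
  have : z - w != 0 by rewrite subr_eq0; exact: zw (A2 z h).
  by move=> d0; move: (2 / eps ^+ 2)%:C => k; field.
rewrite (ID (cintZ _ i1) (cintZ _ i2)) (IZ _ i1) (IZ _ i2) => /eqP; rewrite addrC mulNr subr_eq0 => /eqP h.
have two : (2 : R)%:C != 0 by rewrite eq_complex /= pnatr_eq0.
apply: (mulfI two); rewrite !mulrA -!rmorphM /=.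
by rewrite h.
Qed.
End CauchyFormula.

(** * Cauchy's formula on annuli and expansion of its kernel *)

Section CauchyEstimates.
Variable R : realType.
Local Notation C := (R[i]^o).
Local Notation plane := (measurableTypeR R * measurableTypeR R)%type.
Local Notation area := (@lebesgue_measure R \x @lebesgue_measure R)%E.
Implicit Types (f g : C -> C) (U A : set C) (c z w h u : C).

(** This number is pi, but only its positivity and the scaling law [J_ann] are used. *)
Definition ann_area : R := J (ind (ann (0 : C) 1)).

Lemma rint_ind_ann c (r : R) : 0 < r -> rint (ind (ann c r)).
Proof.
move=> r0; apply: rint_ind; first exact: mset_ann.
have le : (area (plane_region (ann c r)) <= area (plane_region (box c (2 * r))))%E.
  apply: le_measure; rewrite ?inE; [exact: mset_ann|exact: mset_box|].
  by move=> p; exact: ann_box.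
by rewrite (le_lt_trans le)// area_box ?ltry// mulr_ge0// ltW.
Qed.

Lemma I_cut1 A : I (cut A (fun=> 1)) = (J (ind A))%:C.
Proof.
apply: complex_ext => /=; last first.
  rewrite (_ : (fun z => _) = fun=> 0) ?J_cst0//.
  by apply/funext => z; rewrite /cut; case: ifP.
by congr J; apply/funext => z; rewrite /cut /ind; case: ifP.
Qed.

Lemma cint_cut1 A : rint (ind A) -> cint (cut A (fun=> 1)).
Proof.
move=> iA; split; last first.
  rewrite (_ : (fun z => _) = fun=> 0); first exact: rint0.
  by apply/funext => z; rewrite /cut; case: ifP.
by rewrite (_ : (fun z => _) = ind A)//; apply/funext => z; rewrite /cut /ind; case: ifP.
Qed.

Lemma J_ann_translate c (r : R) : 0 < r -> J (ind (ann c r)) = J (ind (ann (0 : C) r)).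
Proof.
move=> r0; rewrite -[RHS](J_translate (- c)); last exact: rint_ind_ann.
by congr J; apply/funext => z; rewrite /ind /ann /= subr0.
Qed.

(** Scaling is read off from [annulus_transfer] with [g = 1] and both centres at 0, in place of a
    change of variables. The radii [r] and 1 are compared through a common smaller one, because the
    transfer asks for [2 * e <= s]. *)
Lemma J_ann c (r : R) : 0 < r -> J (ind (ann c r)) = r ^+ 2 * ann_area.
Proof.
move=> r0; rewrite J_ann_translate//.
have tr (s e : R) : 0 < s -> 0 < e -> 2 * e <= s ->
    s ^- 2 * J (ind (ann (0 : C) s)) = e ^- 2 * J (ind (ann (0 : C) e)).
  move=> s0 e0 es.
  have [|||_ _] := @annulus_transfer R setT (fun=> 1) 0 s 0 e openT _ s0 _ e0.
  - by move=> z _; exact: hol_at_cst.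
  - by [].
  - by rewrite subrr nrm0 subr0.
  rewrite (_ : cut _ _ = cut (ann 0 s) (fun=> 1)); last first.
    apply/funext => z; have [hz|hz] := pselect (ann 0 s z); last by rewrite !cutF.
    rewrite !cutT// subr0 mulr1 divff//; have [] := ann_lt s0 hz; rewrite subr0 => h1 _.
    by rewrite -nrm_gt0; apply: lt_trans h1.
  by rewrite !I_cut1 -!rmorphM => /complexI.
pose e := Num.min 1 r / 2.
have e0 : 0 < e by rewrite divr_gt0// lt_min ltr01.
have e1 : 2 * e <= 1 by rewrite mulrC divfK// ge_min lexx.
have e2 : 2 * e <= r by rewrite mulrC divfK// ge_min lexx orbT.
have := tr _ _ r0 e0 e2; rewrite -(tr _ _ ltr01 e0 e1) expr1n invr1 mul1r /ann_area => <-.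
by rewrite mulrA divff ?mul1r// lt0r_neq0// exprn_gt0.
Qed.

(** The annulus contains the box of half-side 1/20 around 6/5. *)
Lemma ann_area_gt0 : 0 < ann_area.
Proof.
have p : 0 < 20^-1 :> R by rewrite invr_gt0.
apply: (@lt_le_trans _ _ (J (ind (box ((6 / 5)%:C : C) 20^-1)))).
  by rewrite J_ind_box ?exprn_gt0 ?mulr_gt0// ltW.
apply: J_le; [by apply: rint_ind_box; exact: ltW|exact: rint_ind_ann|move=> z].
have [hz|hz] := pselect (box ((6 / 5)%:C : C) 20^-1 z); last by rewrite indF// ind_ge0.
rewrite !indT//; rewrite /ann /mkset subr0 nrm_sqr; case: z hz => x y [/=].
by rewrite subr0 !ler_norml => /andP[h1 h2] /andP[h3 h4]; split; nra.
Qed.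

(** In [annulus_transfer] let the small annulus shrink to [w]: the average of [g] over it tends to
    [ann_area * g w] by continuity. *)
Lemma cauchy_formula U g w0 (r : R) w : open U -> (forall z, U z -> hol_at g z) ->
  0 < r -> (forall z, nrm (z - w0) <= 2 * r -> U z) -> nrm (w - w0) < r ->
  cint (cut (ann w0 r) (fun z => (z - w0) / (z - w) * g z)) /\
  I (cut (ann w0 r) (fun z => (z - w0) / (z - w) * g z)) = (r ^+ 2 * ann_area)%:C * g w.
Proof.
move=> oU hg r0 dU wr.
have p0 : 0 < (r - nrm (w - w0)) / 2 by rewrite divr_gt0// subr_gt0.
have [|i1 _ _] := @annulus_transfer R U g w0 r w _ oU hg r0 dU p0.
  by rewrite mulrC divfK.
split=> //.
set X := I _.
have r2 : 0 < r ^+ 2 by rewrite exprn_gt0.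
suff : (r ^- 2)%:C * X - ann_area%:C * g w = 0.
  move=> /eqP; rewrite subr_eq0 => /eqP h; rewrite rmorphM /= -mulrA -h mulrA -rmorphM /=.
  by rewrite divff ?mul1r// lt0r_neq0.
apply: nrm_le_eps => eta eta0.
have Uw : U w by apply: dU; move: wr r0; lra.
(* The 32 is 8 * 4, from [nrm_I_box] on a box of half-side [2 * e]. *)
have [d d0 hd] := hol_ccont hg Uw (divr_gt0 eta0 (ltr0Sn _ 31)).
pose e := Num.min (d / 2) ((r - nrm (w - w0)) / 2).
have e0 : 0 < e by rewrite lt_min p0 divr_gt0.
have ed : e <= d / 2 by rewrite ge_min lexx.
have er : e <= (r - nrm (w - w0)) / 2 by rewrite ge_min lexx orbT.
have [|_ i2 ->] := @annulus_transfer R U g w0 r w e oU hg r0 dU e0; first by move: er; lra.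
have i3 := cint_cut1 (rint_ind_ann w e0).
have e20 : 0 < e ^+ 2 by rewrite exprn_gt0.
have -> : (e ^- 2)%:C * I (cut (ann w e) g) - ann_area%:C * g w =
    (e ^- 2)%:C * I (fun z => cut (ann w e) g z - g w * cut (ann w e) (fun=> 1) z).
  rewrite (IB i2 (cintZ (g w) i3)) (IZ _ i3) I_cut1 J_ann// mulrBr; congr (_ - _).
  have E : (e ^- 2)%:C * (e ^+ 2)%:C = 1 :> C by rewrite -rmorphM /= mulVf ?lt0r_neq0.
  rewrite [(e ^+ 2 * _)%:C]rmorphM /=.
  rewrite -[LHS]mul1r -E; move: (e ^- 2)%:C (e ^+ 2)%:C => p q; ring.
rewrite nrmM nrm_real ger0_norm ?invr_ge0 ?(ltW e20)// ler_pdivrMl//.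
apply: (@le_trans _ _ (8 * (eta / 32) * (2 * e) ^+ 2)); last first.
  by rewrite exprMn le_eqVlt; apply/orP; left; apply/eqP; field.
apply: (@nrm_I_box _ w).
- by rewrite mulr_ge0// ltW.
- by apply: cint_meas; apply: cintB => //; exact: cintZ.
- move=> z _; have [hz|hz] := pselect (ann w e z); last first.
    by rewrite !cutF// mulr0 subr0 nrm0 divr_ge0// ltW.
  rewrite !cutT// mulr1 ltW//; apply: hd.
  by have [_ h2] := ann_lt e0 hz; apply: lt_le_trans h2 _; move: ed; lra.
- move=> z nb; have hz : ~ ann w e z by move=> /(ann_box e0).
  by rewrite !cutF// mulr0 subr0.
Qed.

(** Second-order Taylor bounds for [u^-1] and, in [kernel2], for [u^-1 ^+ 2]. Integrated against
    [g], they give the derivatives of the Cauchy integral without differentiation under the integral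
    sign. *)
Lemma kernel1 u h : u != 0 -> nrm h <= nrm u / 2 ->
  nrm ((u - h)^-1 - u^-1 - h * u^-1 ^+ 2) <= 2 * nrm h ^+ 2 / nrm u ^+ 3.
Proof.
move=> u0 hu; have nu0 : 0 < nrm u by rewrite nrm_gt0.
have uh : nrm u / 2 <= nrm (u - h).
  by apply: le_trans (nrm_sub_ge _ _); move: hu; lra.
have uh0 : u - h != 0 by rewrite -nrm_gt0 (lt_le_trans _ uh)// divr_gt0.
have -> : (u - h)^-1 - u^-1 - h * u^-1 ^+ 2 = h ^+ 2 / (u ^+ 2 * (u - h)).
  by field; rewrite u0 uh0.
rewrite nrmM nrmX nrmV nrmM nrmX [leRHS]mulrAC [leRHS]mulrC ler_wpM2l ?exprn_ge0 ?nrm_ge0//.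
have uh1 : 0 < nrm (u - h) by rewrite nrm_gt0.
rewrite -[leLHS]mul1r ler_pdivrMr ?mulr_gt0 ?exprn_gt0//.
have -> : 2 / nrm u ^+ 3 * (nrm u ^+ 2 * nrm (u - h)) = 2 * nrm (u - h) / nrm u.
  by field; rewrite lt0r_neq0.
by rewrite ler_pdivlMr// mul1r; move: uh; lra.
Qed.

Lemma kernel2 u h : u != 0 -> nrm h <= nrm u / 2 ->
  nrm ((u - h)^-1 ^+ 2 - u^-1 ^+ 2 - h * (2 * u^-1 ^+ 3)) <= 16 * nrm h ^+ 2 / nrm u ^+ 4.
Proof.
move=> u0 hu; have nu0 : 0 < nrm u by rewrite nrm_gt0.
have uh : nrm u / 2 <= nrm (u - h).
  by apply: le_trans (nrm_sub_ge _ _); move: hu; lra.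
have uh0 : u - h != 0 by rewrite -nrm_gt0 (lt_le_trans _ uh)// divr_gt0.
have uh1 : 0 < nrm (u - h) by rewrite nrm_gt0.
have -> : (u - h)^-1 ^+ 2 - u^-1 ^+ 2 - h * (2 * u^-1 ^+ 3) =
    h ^+ 2 * ((3 * u - 2 * h) / (u ^+ 3 * (u - h) ^+ 2)).
  by field; rewrite u0 uh0.
rewrite nrmM nrmX [leRHS]mulrAC [leRHS]mulrC ler_wpM2l ?exprn_ge0 ?nrm_ge0//.
rewrite nrmM nrmV nrmM !nrmX ler_pdivrMr ?mulr_gt0 ?exprn_gt0//.
have n1 : nrm (3 * u - 2 * h) <= 4 * nrm u.
  have -> : 3 * u - 2 * h = u + (u - h) + (u - h) by ring.
  have k1 := nrmD (u + (u - h)) (u - h); have k2 := nrmD u (u - h); have k3 := nrmB u h.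
  by move: hu; lra.
apply: (le_trans n1).
have -> : 16 / nrm u ^+ 4 * (nrm u ^+ 3 * nrm (u - h) ^+ 2) = 16 * nrm (u - h) ^+ 2 / nrm u.
  by field; rewrite lt0r_neq0.
rewrite ler_pdivlMr//; move: uh uh1 nu0; move: (nrm u) (nrm (u - h)) => a b; nra.
Qed.
End CauchyEstimates.

(** * Derivatives of holomorphic functions and interior estimates *)

Section Derivatives.
Variable R : realType.
Local Notation C := (R[i]^o).
Implicit Types (f g : C -> C) (U A : set C) (c z w h u l : C).

Lemma cdiff_quadratic g w l (d K : R) : 0 < d ->
  (forall h, nrm h < d -> nrm (g (w + h) - g w - h * l) <= K * nrm h ^+ 2) -> cdiff g w l.
Proof.
move=> d0 hK e e0; have K0 : 0 < `|K| + 1 by rewrite ltr_wpDl.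
exists (Num.min d (e / (`|K| + 1))); first by rewrite lt_min d0 divr_gt0.
move=> h; rewrite lt_min => /andP[/hK h1]; rewrite ltr_pdivlMr// mulrC => h2.
rewrite mulrC (le_trans h1)// expr2 mulrA ler_wpM2r ?nrm_ge0// ltW//.
apply: le_lt_trans h2; rewrite ler_wpM2r ?nrm_ge0//.
by rewrite (le_trans (ler_norm _))// lerDl.
Qed.

Lemma cdiff_local f g z l (d : R) : 0 < d -> (forall y, nrm (y - z) < d -> f y = g y) ->
  cdiff g z l -> cdiff f z l.
Proof.
move=> d0 fg gl e e0; have [d1 d10 h1] := gl e e0.
exists (Num.min d d1); first by rewrite lt_min d0.
move=> h; rewrite lt_min => /andP[hd hd1]; rewrite !fg ?subrr ?nrm0//; first exact: h1.
by rewrite addrAC subrr add0r.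
Qed.

Lemma cdiffZ g z l a : cdiff g z l -> cdiff (fun y => a * g y) z (a * l).
Proof.
move=> gl e e0; have a0 : 0 < nrm a + 1 by rewrite ltr_wpDl ?nrm_ge0.
have [d d0 hd] := gl (e / (nrm a + 1)) (divr_gt0 e0 a0); exists d => // h /hd h1.
rewrite (_ : _ - _ = a * (g (z + h) - g z - l * h)); last by ring.
rewrite nrmM (le_trans (ler_wpM2l (nrm_ge0 a) h1))// mulrA ler_wpM2r ?nrm_ge0//.
rewrite mulrCA ler_piMr ?(ltW e0)// ler_pdivrMr// mul1r lerDl//.
Qed.

Lemma hol_at_invX w n z : z != w -> hol_at (fun x => (x - w)^-1 ^+ n) z.
Proof.
move=> zw; elim: n => [|n IH]; first by under eq_fun do rewrite expr0; exact: hol_at_cst.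
by under eq_fun do rewrite exprS; apply: hol_atM => //; exact: hol_at_inv.
Qed.

Section CauchyTransform.
Variables (U : set C) (g : C -> C) (w0 : C) (r : R).
Hypothesis oU : open U.
Hypothesis hg : forall z, U z -> hol_at g z.
Hypothesis r0 : 0 < r.
Hypothesis dU : forall z, nrm (z - w0) <= 2 * r -> U z.

Let A := ann w0 r.
Let k n w z := (z - w0) * g z * (z - w)^-1 ^+ n.
(** Cauchy integrals over the annulus: up to the factor [c0] below, [ctrans 1], [ctrans 2] and
    [2 * ctrans 3] are [g] and its first two derivatives. *)
Definition ctrans n w : C := I (cut A (k n w)).

Let cint_k n w : nrm (w - w0) < r -> cint (cut A (k n w)).
Proof.
move=> wr; pose rho := r - nrm (w - w0).
have rho0 : 0 < rho by rewrite subr_gt0.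
have [Mg hMg] := bounded_disc (fun z hz => hg (dU hz)).
have Mg0 : 0 <= Mg.
  by apply: le_trans (hMg w0 _); [exact: nrm_ge0|rewrite subrr nrm0 mulr_ge0// ltW].
pose U' := [set z : C | nrm (z - w0) < 2 * r] `&` [set z : C | rho / 2 < nrm (z - w)].
have oU' : open U' by apply: openI; [exact: open_disc|exact: open_exterior].
have zw z : U' z -> z != w.
  by move=> [_ /= h]; apply/eqP => zw; move: h; rewrite zw subrr nrm0; lra.
have AU : A `<=` U'.
  move=> z /(ann_lt r0)[h1 h2]; split => //=.
  by have := nrm_triangle z w w0; rewrite /rho; lra.
apply: (@cint_cut _ _ U' w0 (2 * r) (2 * r * Mg * (2 / rho) ^+ n) _ _ AU _ _ _ oU' _ _).1.
- exact: mset_ann.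
- exact: ann_box.
- by rewrite mulr_ge0// ltW.
- by rewrite !mulr_ge0 ?exprn_ge0 ?divr_ge0 ?(ltW r0) ?(ltW rho0).
- apply: hol_ccont => z hz; apply: hol_atM; last by apply: hol_at_invX; exact: zw.
  apply: hol_atM; last by apply/hg/dU; case: hz => /ltW.
  by apply: hol_atB; [exact: hol_at_id|exact: hol_at_cst].
- move=> z az; have [_ h2] := AU z az; have [_ /ltW h3] := ann_lt r0 az.
  rewrite /k !nrmM nrmX nrmV !ler_pM ?mulr_ge0 ?nrm_ge0 ?exprn_ge0 ?invr_ge0 ?nrm_ge0//.
    exact: hMg.
  rewrite lerXn2r ?nnegrE ?invr_ge0 ?divr_ge0 ?nrm_ge0 ?(ltW rho0)//.
  rewrite -[leRHS]invrK lef_pV2 ?posrE ?invr_gt0 ?divr_gt0 ?invf_div ?(ltW h2)//.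
  by apply: lt_trans h2; rewrite divr_gt0.
Qed.

(** A Taylor bound for the kernel passes to the transform. The factor [64 * r ^+ 3] is 8 from
    [nrm_I_box], [2 * r] for the factor [z - w0], and the squared half-side [(2 * r) ^+ 2]. *)
Let ctrans_est n m (a : C) w h (B D : R) : nrm (w - w0) < r ->
  nrm h <= (r - nrm (w - w0)) / 2 ->
  (forall z, A z -> nrm (g z) <= B) -> 0 <= B ->
  (forall u, r - nrm (w - w0) <= nrm u ->
     nrm ((u - h)^-1 ^+ n - u^-1 ^+ n - h * (a * u^-1 ^+ m)) <= D * nrm h ^+ 2) -> 0 <= D ->
  nrm (ctrans n (w + h) - ctrans n w - h * (a * ctrans m w)) <= 64 * r ^+ 3 * B * D * nrm h ^+ 2.
Proof.
move=> wr hh gB B0 ker D0.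
have whr : nrm (w + h - w0) < r.
  have := nrm_triangle (w + h) w w0; rewrite (_ : w + h - w = h); last by rewrite addrAC subrr add0r.
  by move: wr hh; lra.
have i1 := cint_k n whr; have i2 := cint_k n wr; have i3 := cint_k m wr.
have i12 := cintB i1 i2; have i3' := cintZ (h * a) i3; have i4 := cintB i12 i3'.
rewrite /ctrans (_ : _ - _ - _ = I (fun z => cut A (k n (w + h)) z - cut A (k n w) z - (h * a) * cut A (k m w) z)); last first.
  by rewrite (IB i12 i3') (IB i1 i2) (IZ _ i3) mulrA.
rewrite (_ : _ * nrm h ^+ 2 = 8 * (2 * r * B * (D * nrm h ^+ 2)) * (2 * r) ^+ 2); last by ring.
have D1 : 0 <= 2 * r * B * (D * nrm h ^+ 2).
  by rewrite !mulr_ge0 ?exprn_ge0 ?nrm_ge0 ?(ltW r0).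
apply: (@nrm_I_box _ w0).
- by rewrite mulr_ge0// ltW.
- exact: cint_meas.
- move=> z _; have [az|az] := pselect (A z); last by rewrite !cutF// mulr0 !subr0 nrm0.
  rewrite !cutT// /k.
  rewrite (_ : _ - _ = (z - w0) * g z * ((z - w - h)^-1 ^+ n - (z - w)^-1 ^+ n - h * (a * (z - w)^-1 ^+ m))); last first.
    by rewrite opprD addrA; move: (_ ^+ _) (_ ^+ _) (_ ^+ _) => x1 x2 x3; ring.
  have [h1 /ltW h2] := ann_lt r0 az.
  rewrite !nrmM !ler_pM ?mulr_ge0 ?nrm_ge0//; first exact: gB.
  by apply: ker; have := nrm_triangle z w w0; lra.
- by move=> z nb; have az : ~ A z by [move=> /(ann_box r0)]; rewrite !cutF// mulr0 !subr0.
Qed.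

Let c0 : R := r ^+ 2 * ann_area R.
Let c0_gt0 : 0 < c0. Proof. by rewrite mulr_gt0 ?exprn_gt0 ?ann_area_gt0. Qed.

Lemma ctrans1 w : nrm (w - w0) < r -> ctrans 1 w = c0%:C * g w.
Proof.
move=> wr; have [_ <-] := cauchy_formula oU hg r0 dU wr.
by congr I; congr cut; apply/funext => z; rewrite /k expr1; ring.
Qed.

Lemma nrm_ctrans n w (B : R) : nrm (w - w0) < r ->
  (forall z, A z -> nrm (g z) <= B) -> 0 <= B ->
  nrm (ctrans n w) <= 64 * r ^+ 3 * B * (r - nrm (w - w0))^-1 ^+ n.
Proof.
move=> wr gB B0; have rho0 : 0 < r - nrm (w - w0) by rewrite subr_gt0.
rewrite (_ : _ * _^-1 ^+ n = 8 * (2 * r * B * (r - nrm (w - w0))^-1 ^+ n) * (2 * r) ^+ 2); last first.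
  by move: (_ ^+ n) => x; ring.
have D1 : 0 <= 2 * r * B * (r - nrm (w - w0))^-1 ^+ n.
  by rewrite !mulr_ge0 ?exprn_ge0 ?invr_ge0 ?(ltW r0) ?(ltW rho0).
apply: (@nrm_I_box _ w0).
- by rewrite mulr_ge0// ltW.
- by apply: cint_meas; exact: cint_k.
- move=> z _; have [az|az] := pselect (A z); last by rewrite !cutF// nrm0.
  rewrite cutT// /k; have [h1 /ltW h2] := ann_lt r0 az.
  rewrite !nrmM nrmX nrmV !ler_pM ?mulr_ge0 ?nrm_ge0 ?exprn_ge0 ?invr_ge0 ?nrm_ge0//; first exact: gB.
  have h3 : r - nrm (w - w0) <= nrm (z - w) by have := nrm_triangle z w w0; lra.
  rewrite lerXn2r ?nnegrE ?invr_ge0 ?nrm_ge0 ?(ltW rho0)// lef_pV2 ?posrE//.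
  exact: lt_le_trans h3.
- by move=> z nb; have az : ~ A z by [move=> /(ann_box r0)]; rewrite !cutF.
Qed.

Let est1 w h (B : R) : nrm (w - w0) < r -> nrm h <= (r - nrm (w - w0)) / 2 ->
  (forall z, A z -> nrm (g z) <= B) -> 0 <= B ->
  nrm (ctrans 1 (w + h) - ctrans 1 w - h * ctrans 2 w) <=
    64 * r ^+ 3 * B * (2 / (r - nrm (w - w0)) ^+ 3) * nrm h ^+ 2.
Proof.
move=> wr hh gB B0; have rho0 : 0 < r - nrm (w - w0) by rewrite subr_gt0.
rewrite -[ctrans 2 w]mul1r; apply: ctrans_est => //; last by rewrite divr_ge0 ?exprn_ge0 ?(ltW rho0).
move=> u hu; have nu0 : 0 < nrm u := lt_le_trans rho0 hu.
rewrite mul1r !expr1; apply: (le_trans (kernel1 _ _)).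
- by rewrite -nrm_gt0.
- by apply: (le_trans hh); rewrite ler_pM2r ?invr_gt0.
rewrite mulrAC ler_wpM2r ?exprn_ge0 ?nrm_ge0// ler_wpM2l// lef_pV2 ?posrE ?exprn_gt0//.
by rewrite lerXn2r ?nnegrE ?nrm_ge0 ?(ltW rho0).
Qed.

Let est2 w h (B : R) : nrm (w - w0) < r -> nrm h <= (r - nrm (w - w0)) / 2 ->
  (forall z, A z -> nrm (g z) <= B) -> 0 <= B ->
  nrm (ctrans 2 (w + h) - ctrans 2 w - h * (2 * ctrans 3 w)) <=
    64 * r ^+ 3 * B * (16 / (r - nrm (w - w0)) ^+ 4) * nrm h ^+ 2.
Proof.
move=> wr hh gB B0; have rho0 : 0 < r - nrm (w - w0) by rewrite subr_gt0.
apply: ctrans_est => //; last by rewrite divr_ge0 ?exprn_ge0 ?(ltW rho0).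
move=> u hu; have nu0 : 0 < nrm u := lt_le_trans rho0 hu.
apply: (le_trans (kernel2 _ _)).
- by rewrite -nrm_gt0.
- by apply: (le_trans hh); rewrite ler_pM2r ?invr_gt0.
rewrite mulrAC ler_wpM2r ?exprn_ge0 ?nrm_ge0// ler_wpM2l// lef_pV2 ?posrE ?exprn_gt0//.
by rewrite lerXn2r ?nnegrE ?nrm_ge0 ?(ltW rho0).
Qed.

Let gbd : exists2 B : R, 0 <= B & forall z, A z -> nrm (g z) <= B.
Proof.
have [Mg hMg] := bounded_disc (fun z hz => hg (dU hz)).
exists Mg; last by move=> z /(ann_lt r0)[_ /ltW]; exact: hMg.
by apply: le_trans (hMg w0 _); [exact: nrm_ge0|rewrite subrr nrm0 mulr_ge0// ltW].
Qed.

Lemma taylor_ctrans w h (B : R) : nrm (w - w0) < r -> nrm h <= (r - nrm (w - w0)) / 2 ->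
  (forall z, A z -> nrm (g z) <= B) -> 0 <= B ->
  nrm (g (w + h) - g w - h * (c0^-1%:C * ctrans 2 w)) <=
    c0^-1 * (64 * r ^+ 3 * B * (2 / (r - nrm (w - w0)) ^+ 3)) * nrm h ^+ 2.
Proof.
move=> wr hh gB B0; have := est1 wr hh gB B0.
have whr : nrm (w + h - w0) < r.
  have := nrm_triangle (w + h) w w0; rewrite (_ : w + h - w = h); last by rewrite addrAC subrr add0r.
  by move: wr hh; lra.
rewrite !ctrans1// => le.
have cc : c0^-1%:C * c0%:C = 1 :> C by rewrite -rmorphM /= mulVf ?lt0r_neq0.
rewrite (_ : _ - _ = c0^-1%:C * (c0%:C * g (w + h) - c0%:C * g w - h * ctrans 2 w)).
  by rewrite nrmM nrm_real ger0_norm ?invr_ge0 ?(ltW c0_gt0)// -mulrA ler_wpM2l ?invr_ge0 ?(ltW c0_gt0).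
rewrite !mulrBr !mulrA cc !mul1r; congr (_ - _ * _); exact: mulrC.
Qed.

Lemma cdiff_ctrans w : nrm (w - w0) < r -> cdiff g w (c0^-1%:C * ctrans 2 w).
Proof.
move=> wr; have [B B0 gB] := gbd.
have p0 : 0 < (r - nrm (w - w0)) / 2 by rewrite divr_gt0// subr_gt0.
by apply: (cdiff_quadratic p0) => h /ltW hh; exact: (taylor_ctrans wr hh gB B0).
Qed.

(** The derivative is [c0^-1 * ctrans 2] on the whole disc, so [est2] differentiates it once more at
    the centre; any point of an open set can be made the centre. *)
Lemma hol_derive1_center : hol_at (derive1 g) w0.
Proof.
have [B B0 gB] := gbd.
exists (c0^-1%:C * (2 * ctrans 3 w0)).
apply: (@cdiff_local _ (fun w => c0^-1%:C * ctrans 2 w) _ _ r) => //.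
  by move=> y /cdiff_ctrans/cdiff_derivable[_ ->].
have w0r : nrm (w0 - w0) < r by rewrite subrr nrm0.
have p0 : 0 < (r - nrm (w0 - w0)) / 2 by rewrite divr_gt0// subr_gt0.
apply: cdiffZ; apply: (cdiff_quadratic p0) => h /ltW hh; exact: (est2 w0r hh gB B0).
Qed.

End CauchyTransform.

Lemma open_disc_sub U z : open U -> U z ->
  exists2 r : R, 0 < r & forall y, nrm (y - z) <= 2 * r -> U y.
Proof.
move=> /openC/(_ z) h /h[e e0 he]; exists (e / 3); first by rewrite divr_gt0.
by move=> y hy; apply: he; apply: le_lt_trans hy _; lra.
Qed.

Lemma hol_derive1 U g : open U -> (forall z, U z -> hol_at g z) ->
  forall z, U z -> hol_at (derive1 g) z.
Proof.
move=> oU hg z Uz; have [r r0 hr] := open_disc_sub oU Uz.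
exact: hol_derive1_center oU hg r0 hr.
Qed.

Lemma hol_derive1n U g n : open U -> (forall z, U z -> hol_at g z) ->
  forall z, U z -> hol_at (derive1n n g) z.
Proof. by move=> oU hg; elim: n => [//|n IH]; exact: hol_derive1. Qed.

(** [K] depends on [r] alone; this uniformity is what gives bounds valid for a whole Bergman space
    at once. *)
Lemma cauchy_est (r : R) : 0 < r -> exists2 K : R, 0 <= K &
  forall U g w (B : R), open U -> (forall z, U z -> hol_at g z) ->
    (forall z, nrm (z - w) <= 2 * r -> U z) ->
    (forall z, nrm (z - w) <= 2 * r -> nrm (g z) <= B) ->
    nrm (derive1 g w) <= K * B /\
    forall h, nrm h <= r / 2 ->
      nrm (g (w + h) - g w - h * derive1 g w) <= K * B * nrm h ^+ 2.
Proof.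
move=> r0; pose c0 : R := r ^+ 2 * ann_area R.
have c00 : 0 < c0 by rewrite mulr_gt0 ?exprn_gt0 ?ann_area_gt0.
pose K := c0^-1 * (64 * r ^+ 3 * (2 / r ^+ 3)) + c0^-1 * (64 * r ^+ 3 * r^-1 ^+ 2).
have K1 : 0 <= c0^-1 * (64 * r ^+ 3 * (2 / r ^+ 3)).
  by rewrite !mulr_ge0 ?invr_ge0 ?exprn_ge0 ?(ltW c00) ?(ltW r0).
have K2 : 0 <= c0^-1 * (64 * r ^+ 3 * r^-1 ^+ 2).
  by rewrite !mulr_ge0 ?exprn_ge0 ?invr_ge0 ?(ltW c00) ?(ltW r0).
exists K; first exact: addr_ge0.
move=> U g w B oU hg dU gB.
have B0 : 0 <= B by apply: le_trans (gB w _); [exact: nrm_ge0|rewrite subrr nrm0 mulr_ge0// ltW].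
have gB' z : ann w r z -> nrm (g z) <= B by move=> /(ann_lt r0)[_ /ltW]; exact: gB.
have wr : nrm (w - w) < r by rewrite subrr nrm0.
have := cdiff_ctrans oU hg r0 dU wr => /cdiff_derivable[_ ->]; split.
  rewrite nrmM nrm_real ger0_norm ?invr_ge0 ?(ltW c00)//.
  have := nrm_ctrans hg r0 dU 2 wr gB' B0; rewrite subrr nrm0 subr0 => le.
  apply: (@le_trans _ _ (c0^-1 * (64 * r ^+ 3 * B * r^-1 ^+ 2))).
    by rewrite ler_wpM2l// invr_ge0 ltW.
  rewrite (_ : _ * _ = c0^-1 * (64 * r ^+ 3 * r^-1 ^+ 2) * B).
    by rewrite ler_wpM2r// /K lerDr.
  by move: (r^-1 ^+ 2) => x; ring.
move=> h hh.
have := @taylor_ctrans U g w r oU hg r0 dU w h B wr; rewrite subrr nrm0 subr0 => /(_ hh gB' B0).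
move=> /le_trans; apply; rewrite ler_wpM2r ?exprn_ge0 ?nrm_ge0//.
rewrite (_ : _ * _ = c0^-1 * (64 * r ^+ 3 * (2 / r ^+ 3)) * B).
  by rewrite ler_wpM2r// /K lerDl.
by move: (2 / _) => x; ring.
Qed.

(** Cauchy's formula at the centre makes [g w] an average over the annulus, and Cauchy-Schwarz
    bounds that average in L2. *)
Lemma mean_value_sq (r : R) : 0 < r -> exists2 K : R, 0 <= K &
  forall U g w, open U -> (forall z, U z -> hol_at g z) ->
    (forall z, nrm (z - w) <= 2 * r -> U z) ->
    rint (cut U (fun z => nrm (g z) ^+ 2)) ->
    nrm (g w) ^+ 2 <= K * J (cut U (fun z => nrm (g z) ^+ 2)).
Proof.
move=> r0; pose c0 : R := r ^+ 2 * ann_area R.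
have c00 : 0 < c0 by rewrite mulr_gt0 ?exprn_gt0 ?ann_area_gt0.
exists (4 / c0); first by rewrite divr_ge0// ltW.
move=> U g w oU hg dU iU.
have wr : nrm (w - w) < r by rewrite subrr nrm0.
set A := ann w r.
have AU : A `<=` U by move=> z /(ann_lt r0)[_ /ltW]; exact: dU.
have [] := cauchy_formula oU hg r0 dU wr.
have -> : cut (ann w r) (fun z => (z - w) / (z - w) * g z) = cut A g.
  apply/funext => z; have [az|az] := pselect (A z); last by rewrite !cutF.
  rewrite !cutT// divff ?mul1r// -nrm_gt0; have [h _] := ann_lt r0 az.
  exact: lt_trans h.
move=> ig Ig; have ip := cint_nrm ig.
have iA := rint_ind_ann w r0; have JA := J_ann w r0; rewrite -/A -/c0 in iA JA.
have iq : rint (cut A (fun z => nrm (g z) ^+ 2)).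
  apply: (rint_le _ iU).
    rewrite -(cut_cut _ AU); apply: rmeas_cut; [exact: mset_ann|exact: rint_meas].
  move=> z; have [az|az] := pselect (A z); last by rewrite cutF// normr0.
  by rewrite !cutT//; exact: AU.
have qU : J (cut A (fun z => nrm (g z) ^+ 2)) <= J (cut U (fun z => nrm (g z) ^+ 2)).
  apply: J_le => // z; have [az|az] := pselect (A z).
    by rewrite !cutT//; exact: AU.
  rewrite cutF//; have [uz|uz] := pselect (U z); last by rewrite cutF.
  by rewrite cutT// exprn_ge0// nrm_ge0.
set x := J (fun z => nrm (cut A g z)) in ip *.
set q := J (cut A _) in qU *.
(* Cauchy-Schwarz, from integrating [(nrm (g z) - t) ^+ 2] over [A] with the minimizing [t]. *)
have key : x ^+ 2 <= c0 * q.
  pose t := x / c0.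
  have i2 := rintZ (2 * t) ip; have i3 := rintZ (t ^+ 2) iA.
  have i4 := rintB iq i2; have i5 := rintD i4 i3.
  have : 0 <= J (fun z => cut A (fun z => nrm (g z) ^+ 2) z - 2 * t * nrm (cut A g z) + t ^+ 2 * ind A z).
    apply: J_ge0 => z; have [az|az] := pselect (A z).
      rewrite !cutT// indT// (_ : _ + _ = (nrm (g z) - t) ^+ 2) ?sqr_ge0//; ring.
    by rewrite !cutF// indF// nrm0 !mulr0 subr0 addr0.
  rewrite (JD i4 i3) (JB iq i2) (JZ _ ip) (JZ _ iA) JA -/x -/q.
  rewrite (_ : _ + _ = q - x ^+ 2 / c0); last by rewrite /t; field; rewrite lt0r_neq0.
  by rewrite subr_ge0 ler_pdivrMr// mulrC.
have le : nrm (c0%:C * g w) <= 2 * x by rewrite -Ig; exact: nrm_I.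
rewrite nrmM nrm_real (gtr0_norm c00) in le.
rewrite mulrAC ler_pdivlMr//.
have {}le : (c0 * nrm (g w)) ^+ 2 <= (2 * x) ^+ 2.
  have x0 : 0 <= x by apply: J_ge0 => z; exact: nrm_ge0.
  by rewrite lerXn2r// nnegrE mulr_ge0// ?nrm_ge0// ltW.
rewrite -(ler_pM2l c00); apply: (@le_trans _ _ (4 * x ^+ 2)).
  rewrite (_ : c0 * _ = (c0 * nrm (g w)) ^+ 2); last by ring.
  by rewrite (_ : 4 * _ = (2 * x) ^+ 2)//; ring.
rewrite [leRHS]mulrCA ler_wpM2l// (le_trans key)// ler_wpM2l// ltW//.
Qed.
End Derivatives.

(** * The Bergman space and its kernel *)

Section SquareIntegrable.
Variable R : realType.
Local Notation C := (R[i]^o).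
Implicit Types (f g : C -> C) (p q : C -> R).
Variable Om : set C.
Hypothesis oOm : open Om.

Lemma J_cauchy_schwarz p q : rint (fun z => p z ^+ 2) -> rint (fun z => q z ^+ 2) ->
  rint (fun z => p z * q z) ->
  J (fun z => p z * q z) ^+ 2 <= J (fun z => p z ^+ 2) * J (fun z => q z ^+ 2).
Proof.
move=> ip iq ipq; set a := J (fun z => p z ^+ 2); set b := J (fun z => q z ^+ 2).
set x := J _.
have key t : 0 <= a - 2 * t * x + t ^+ 2 * b.
  have i2 := rintZ (2 * t) ipq; have i3 := rintZ (t ^+ 2) iq.
  have i4 := rintB ip i2.
  rewrite -(JZ (t ^+ 2) iq) -(JZ (2 * t) ipq) -(JB ip i2) -(JD i4 i3).
  by apply: J_ge0 => z; rewrite (_ : _ + _ = (p z - t * q z) ^+ 2) ?sqr_ge0//; ring.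
have b0 : 0 <= b by apply: J_ge0 => z; exact: sqr_ge0.
have [b1|b1] := eqVneq b 0.
  rewrite b1 mulr0; have [->|x0] := eqVneq x 0; first by rewrite expr0n.
  (* With [b = 0] the polynomial in [t] is affine, and this [t] would give it the value -1. *)
  have := key ((a + 1) / (2 * x)); rewrite b1 (_ : _ + _ = -1) ?ler0N1//; by field.
have {}b0 : 0 < b by rewrite lt_def b1.
have := key (x / b); rewrite (_ : _ + _ = a - x ^+ 2 / b); last by field.
by rewrite subr_ge0 ler_pdivrMr.
Qed.

Definition sqint g : Prop := cmeas (cut Om g) /\ rint (cut Om (fun z => nrm (g z) ^+ 2)).
Definition sqnorm g : R := J (cut Om (fun z => nrm (g z) ^+ 2)).
Definition dot f g : C := I (cut Om (fun z => f z * (g z)^*)).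

Lemma cut_ext (V : nmodType) (f g : C -> V) : (forall z, Om z -> f z = g z) ->
  cut Om f = cut Om g.
Proof.
move=> fg; apply/funext => z; have [h|h] := pselect (Om z); last by rewrite !cutF.
by rewrite !cutT// fg.
Qed.

Lemma sqint_ext f g : (forall z, Om z -> f z = g z) -> sqint f -> sqint g.
Proof.
move=> fg; rewrite /sqint (cut_ext fg).
by rewrite (@cut_ext _ (fun z => nrm (f z) ^+ 2) (fun z => nrm (g z) ^+ 2))// => z /fg ->.
Qed.

Lemma dot_ext f f' g g' : (forall z, Om z -> f z = f' z) -> (forall z, Om z -> g z = g' z) ->
  dot f g = dot f' g'.
Proof.
by move=> fg fg'; rewrite /dot; congr I; apply: cut_ext => z zO; rewrite fg// fg'.
Qed.

Lemma sqnorm_ge0 g : 0 <= sqnorm g.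
Proof.
by apply: J_ge0 => z; rewrite /cut; case: ifP => // _; rewrite exprn_ge0// nrm_ge0.
Qed.

Let cutD f g : cut Om (fun z => f z + g z) = fun z => cut Om f z + cut Om g z.
Proof.
apply/funext => z; have [h|h] := pselect (Om z); first by rewrite !cutT.
by rewrite !cutF// addr0.
Qed.

Let cutM f g : cut Om (fun z => f z * g z) = fun z => cut Om f z * cut Om g z.
Proof.
apply/funext => z; have [h|h] := pselect (Om z); first by rewrite !cutT.
by rewrite !cutF// mulr0.
Qed.

Let cut_conj f : cut Om (fun z => (f z)^*) = fun z => (cut Om f z)^*.
Proof.
apply/funext => z; have [h|h] := pselect (Om z); first by rewrite !cutT.
by rewrite !cutF// conjc0.
Qed.

Lemma cut_nrm2 f : cut Om (fun z => nrm (f z) ^+ 2) = fun z => nrm (cut Om f z) ^+ 2.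
Proof.
apply/funext => z; have [h|h] := pselect (Om z); first by rewrite !cutT.
by rewrite !cutF// nrm0 expr0n.
Qed.

Lemma sqintD f g : sqint f -> sqint g -> sqint (fun z => f z + g z).
Proof.
rewrite /sqint !cut_nrm2 cutD => -[mf jf] [mg jg]; split; first exact: cmeasD.
apply: (rint_le _ (rintZ 2 (rintD jf jg))); first exact: cmeas_nrm2 (cmeasD mf mg).
move=> z; rewrite !ger0_norm ?mulr_ge0 ?addr_ge0 ?exprn_ge0 ?nrm_ge0//.
have := nrmD (cut Om f z) (cut Om g z).
have := nrm_ge0 (cut Om f z + cut Om g z); have := nrm_ge0 (cut Om f z); have := nrm_ge0 (cut Om g z).
move: (nrm _) (nrm _) (nrm _) => a b c c0 b0 a0 h; have := sqr_ge0 (b - c).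
have : a ^+ 2 <= (b + c) ^+ 2 by rewrite lerXn2r ?nnegrE ?addr_ge0.
by lra.
Qed.

Lemma sqintZ (a : C) g : sqint g -> sqint (fun z => a * g z).
Proof.
rewrite /sqint !cut_nrm2 => -[mg jg].
have -> : cut Om (fun z => a * g z) = fun z => a * cut Om g z.
  apply/funext => z; have [h|h] := pselect (Om z); first by rewrite !cutT.
  by rewrite !cutF// mulr0.
split; first by apply: cmeasM => //; exact: cmeas_cst.
by under eq_fun do rewrite nrmM exprMn; exact: rintZ.
Qed.

Lemma sqintB f g : sqint f -> sqint g -> sqint (fun z => f z - g z).
Proof.
move=> sf /(sqintZ (-1)) sg; apply: sqint_ext (sqintD sf sg) => z _.
by rewrite mulN1r.
Qed.

Lemma sqint_sum (T : Type) (s : seq T) (F : T -> C -> C) :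
  (forall k, sqint (F k)) -> sqint (fun z => \sum_(k <- s) F k z).
Proof.
move=> h; elim: s => [|k s IH].
  split; last first.
    rewrite (_ : cut _ _ = fun=> 0); first exact: rint0.
    by apply/funext => z; rewrite /cut; case: ifP => // _; rewrite big_nil nrm0 expr0n.
  rewrite (_ : cut _ _ = fun=> 0); first exact: cmeas_cst.
  by apply/funext => z; rewrite /cut; case: ifP => // _; rewrite big_nil.
by apply: sqint_ext (sqintD (h k) IH) => z _; rewrite big_cons.
Qed.

Lemma cint_dot f g : sqint f -> sqint g -> cint (cut Om (fun z => f z * (g z)^*)).
Proof.
rewrite /sqint !cut_nrm2 cutM cut_conj => -[mf jf] [mg jg].
apply: (@cint_le _ _ (fun z => nrm (cut Om f z) ^+ 2 + nrm (cut Om g z) ^+ 2)).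
- by apply: cmeasM => //; exact: cmeas_conj.
- exact: rintD.
- move=> z; rewrite nrmM nrm_conj ger0_norm ?addr_ge0 ?exprn_ge0 ?nrm_ge0//.
  have := nrm_ge0 (cut Om f z); have := nrm_ge0 (cut Om g z).
  by move: (nrm _) (nrm _) => a b a0 b0; have := sqr_ge0 (a - b); nra.
Qed.

Lemma dotBr f g1 g2 : sqint f -> sqint g1 -> sqint g2 ->
  dot f (fun z => g1 z - g2 z) = dot f g1 - dot f g2.
Proof.
move=> sf s1 s2; have i1 := cint_dot sf s1; have i2 := cint_dot sf s2.
rewrite /dot -(IB i1 i2); congr I; apply/funext => z.
have [h|h] := pselect (Om z); last by rewrite !cutF// subr0.
by rewrite !cutT// rmorphB /= mulrBr.
Qed.

Lemma dotDr f g1 g2 : sqint f -> sqint g1 -> sqint g2 ->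
  dot f (fun z => g1 z + g2 z) = dot f g1 + dot f g2.
Proof.
move=> sf s1 s2; have i1 := cint_dot sf s1; have i2 := cint_dot sf s2.
rewrite /dot -(ID i1 i2); congr I; apply/funext => z.
have [h|h] := pselect (Om z); last by rewrite !cutF// addr0.
by rewrite !cutT// rmorphD /= mulrDr.
Qed.

Lemma dotZr f g (a : C) : sqint f -> sqint g ->
  dot f (fun z => a * g z) = a^* * dot f g.
Proof.
move=> sf s1; have i1 := cint_dot sf s1.
rewrite /dot -(IZ _ i1); congr I; apply/funext => z.
have [h|h] := pselect (Om z); last by rewrite !cutF// mulr0.
by rewrite !cutT// rmorphM /= mulrCA.
Qed.

Lemma dot_sumr (T : Type) (s : seq T) (F : T -> C -> C) f : sqint f ->
  (forall k, sqint (F k)) -> dot f (fun z => \sum_(k <- s) F k z) = \sum_(k <- s) dot f (F k).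
Proof.
move=> sf h; elim: s => [|k s IH].
  rewrite big_nil /dot (_ : cut _ _ = fun=> 0) ?I0//.
  by apply/funext => z; rewrite /cut; case: ifP => // _; rewrite big_nil [X in _ * X]rmorph0 mulr0.
rewrite big_cons -IH -dotDr//; last exact: sqint_sum.
by apply: dot_ext => // z _; rewrite big_cons.
Qed.

Lemma dot_conj f g : sqint f -> sqint g -> dot g f = (dot f g)^*.
Proof.
move=> sf sg; rewrite /dot -(I_conj (cint_dot sf sg)); congr I; apply/funext => z.
have [h|h] := pselect (Om z); last by rewrite (cutF _ h) (cutF _ h) rmorph0.
by rewrite !cutT// rmorphM /= conj_conj mulrC.
Qed.

Lemma dot_self g : sqint g -> dot g g = (sqnorm g)%:C.
Proof.
move=> sg; apply: complex_ext => /=.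
  congr J; apply/funext => z; have [h|h] := pselect (Om z); last by rewrite !cutF.
  by rewrite !cutT// mul_conj.
rewrite (_ : (fun z => _) = fun=> 0) ?J_cst0//.
apply/funext => z; have [h|h] := pselect (Om z); last by rewrite !cutF.
by rewrite !cutT// mul_conj.
Qed.

(** The 4 is the square of the factor 2 in [nrm_I]. *)
Lemma nrm_dot f g : sqint f -> sqint g -> nrm (dot f g) ^+ 2 <= 4 * (sqnorm f * sqnorm g).
Proof.
move=> sf sg; have ig := cint_dot sf sg; have := nrm_I ig; have in_ := cint_nrm ig.
have E : (fun z => nrm (cut Om (fun z => f z * (g z)^*) z)) =
    fun z => nrm (cut Om f z) * nrm (cut Om g z).
  by apply/funext => z; rewrite cutM cut_conj nrmM nrm_conj.
move: sf sg; rewrite /sqint /sqnorm !cut_nrm2 => -[mf jf] [mg jg].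
rewrite E in in_ *; have := J_cauchy_schwarz jf jg in_.
rewrite -/(dot f g); have := nrm_ge0 (dot f g).
have : 0 <= J (fun z => nrm (cut Om f z) * nrm (cut Om g z)).
  by apply: J_ge0 => z; rewrite mulr_ge0 ?nrm_ge0.
move: (J _) (J _ * J _) (nrm _) => a b c a0 c0 ab ca.
have : c ^+ 2 <= (2 * a) ^+ 2 by rewrite lerXn2r ?nnegrE ?mulr_ge0.
by rewrite exprMn; lra.
Qed.

End SquareIntegrable.

(** * The Bergman space: derivatives at a point are bounded functionals *)

Section BergmanSpace.
Variable R : realType.
Local Notation C := (R[i]^o).
Implicit Types (f g : C -> C).
Variable Om : set C.
Hypothesis oOm : open Om.

Definition a2 g : Prop :=
  (forall z, Om z -> hol_at g z) /\ rint (cut Om (fun z => nrm (g z) ^+ 2)).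

Lemma a2_sqint g : a2 g -> sqint Om g.
Proof. by move=> [hg ig]; split => //; exact: hol_cmeas. Qed.

Lemma a2P g : bergman_space Om g <-> a2 g.
Proof.
split=> -[h i]; split.
- by move=> z /h; rewrite hol_atP.
- exact: (rint_cutP (fun z => nrm (g z) ^+ 2) (open_mset oOm)).2 i.
- by move=> z /h; rewrite hol_atP.
- exact: (rint_cutP (fun z => nrm (g z) ^+ 2) (open_mset oOm)).1 i.
Qed.

Lemma hol_at_ext f g z : (forall y, Om y -> f y = g y) -> Om z -> hol_at f z -> hol_at g z.
Proof.
move=> fg Oz [l fl]; have [d d0 hd] := (openC Om).1 oOm z Oz.
by exists l; apply: cdiff_local d0 _ fl => y /hd Oy; rewrite fg.
Qed.

Lemma a2_ext f g : (forall z, Om z -> f z = g z) -> a2 f -> a2 g.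
Proof.
move=> fg [hf i]; split; first by move=> z Oz; apply: hol_at_ext (hf z Oz).
by rewrite (@cut_ext _ _ _ _ (fun z => nrm (f z) ^+ 2))// => z /fg ->.
Qed.

Lemma a2B f g : a2 f -> a2 g -> a2 (fun z => f z - g z).
Proof.
move=> af ag; have [_ i] := sqintB (a2_sqint af) (a2_sqint ag); split => // z Oz.
by apply: hol_atB; [exact: af.1|exact: ag.1].
Qed.

Lemma a2Z (a : C) g : a2 g -> a2 (fun z => a * g z).
Proof.
move=> ag; have [_ i] := sqintZ a (a2_sqint ag); split => // z Oz.
by apply: hol_atM; [exact: hol_at_cst|exact: ag.1].
Qed.

Lemma cdiffD f g z l l' : cdiff f z l -> cdiff g z l' -> cdiff (fun x => f x + g x) z (l + l').
Proof.
move=> fl gl e e0; have e2 : 0 < e / 2 by rewrite divr_gt0.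
have [d1 d10 h1] := fl _ e2; have [d2 d20 h2] := gl _ e2.
exists (Num.min d1 d2); first by rewrite lt_min d10.
move=> h; rewrite lt_min => /andP[/h1 k1 /h2 k2].
rewrite (_ : _ - _ = (f (z + h) - f z - l * h) + (g (z + h) - g z - l' * h)); last by ring.
by rewrite (le_trans (nrmD _ _))//; move: k1 k2; lra.
Qed.

Lemma derive1n_lin n f g (a b : C) : (forall z, Om z -> hol_at f z) -> (forall z, Om z -> hol_at g z) ->
  forall z, Om z -> derive1n n (fun x => a * f x + b * g x) z = a * derive1n n f z + b * derive1n n g z.
Proof.
move=> hf hg; elim: n => [//|n IH] z Oz.
have [d d0 hd] := (openC Om).1 oOm z Oz.
have [l fl] := hol_derive1n n oOm hf Oz; have [l' gl] := hol_derive1n n oOm hg Oz.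
have cl : cdiff (derive1n n (fun x => a * f x + b * g x)) z (a * l + b * l').
  by apply: (cdiff_local d0 _ (cdiffD (cdiffZ a fl) (cdiffZ b gl))) => y /hd; exact: IH.
by rewrite /= (cdiff_derivable cl).2 (cdiff_derivable fl).2 (cdiff_derivable gl).2.
Qed.

Lemma derive1nB n f g : (forall z, Om z -> hol_at f z) -> (forall z, Om z -> hol_at g z) ->
  forall z, Om z -> derive1n n (fun x => f x - g x) z = derive1n n f z - derive1n n g z.
Proof.
move=> hf hg z Oz; have := @derive1n_lin n f g 1 (-1) hf hg z Oz.
by under eq_fun do rewrite mul1r mulN1r; rewrite mul1r mulN1r.
Qed.

Definition l2 g : R := Num.sqrt (sqnorm Om g).

Lemma l2_sqr g : l2 g ^+ 2 = sqnorm Om g.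
Proof. by rewrite sqr_sqrtr// sqnorm_ge0. Qed.

Lemma l2_ge0 g : 0 <= l2 g. Proof. exact: sqrtr_ge0. Qed.

(** Induction on [n]: the mean value inequality for [n = 0], then Cauchy's estimate on a smaller
    disc. One [K] serves all [g] and all points near [w]. *)
Lemma derive1n_bound n w : Om w -> exists r K : R, [/\ 0 < r, 0 <= K,
  forall z, nrm (z - w) <= r -> Om z &
  forall g, a2 g -> forall z, nrm (z - w) <= r -> nrm (derive1n n g z) <= K * l2 g].
Proof.
move=> Ow; elim: n => [|n [r [K [r0 K0 hr hK]]]].
  have [r r0 hr] := open_disc_sub oOm Ow.
  have r20 : 0 < r / 2 by rewrite divr_gt0.
  have [K K0 hK] := @mean_value_sq R _ r20.
  exists r, (Num.sqrt K); split; [by []|exact: sqrtr_ge0| |].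
    by move=> z h; apply: hr; move: r0 h; lra.
  move=> g ag z zr /=; rewrite /l2 -sqrtrM//.
  rewrite -[leLHS]ger0_norm ?nrm_ge0// -sqrtr_sqr ler_wsqrtr//.
  apply: (hK Om) => //; [exact: ag.1|move=> y hy|exact: ag.2].
  by apply: hr; have := nrm_triangle y z w; move: zr hy r0; lra.
have r4 : 0 < r / 4 by rewrite divr_gt0.
have [K' K'0 hK'] := cauchy_est r4.
exists (r / 4), (K' * K); split; [by []|exact: mulr_ge0| |].
  by move=> z h; apply: hr; move: r0 h; lra.
move=> g ag z zr /=; rewrite -mulrA.
have sub y : nrm (y - z) <= 2 * (r / 4) -> nrm (y - w) <= r.
  by move=> hy; have := nrm_triangle y z w; move: zr hy r0; lra.
apply: (hK' Om (derive1n n g) z (K * l2 g) oOm _ _ _).1.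
- by apply: hol_derive1n => //; exact: ag.1.
- by move=> y /sub; exact: hr.
- by move=> y /sub; exact: hK.
Qed.

Lemma derive1n_taylor n w : Om w -> exists r K : R, [/\ 0 < r, 0 <= K,
  forall z, nrm (z - w) <= r -> Om z &
  forall g, a2 g -> forall h, nrm h <= r ->
    nrm (derive1n n g (w + h) - derive1n n g w - h * derive1n n.+1 g w) <= K * l2 g * nrm h ^+ 2].
Proof.
move=> Ow; have [r [K [r0 K0 hr hK]]] := derive1n_bound n Ow.
have r2 : 0 < r / 2 by rewrite divr_gt0.
have [K' K'0 hK'] := cauchy_est r2.
exists (r / 4), (K' * K); split; first by rewrite divr_gt0.
- exact: mulr_ge0.
- by move=> z h; apply: hr; move: r0 h; lra.
move=> g ag h hh; rewrite -[K' * _ * _]mulrA.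
have sub y : nrm (y - w) <= 2 * (r / 2) -> nrm (y - w) <= r by rewrite mulrC divfK.
apply: (hK' Om (derive1n n g) w (K * l2 g) oOm _ _ _).2.
- by apply: hol_derive1n => //; exact: ag.1.
- by move=> y /sub; exact: hr.
- by move=> y /sub; exact: hK.
- by move: hh; lra.
Qed.

End BergmanSpace.

(** * Representing functions of the derivatives *)

Section BergmanKernel.
Variable R : realType.
Local Notation C := (R[i]^o).
Implicit Types (f g : C -> C).

Lemma ccauchy_cvg (u : nat -> C) :
  (forall e : R, 0 < e -> exists N, forall n k, (N <= n)%N -> (N <= k)%N -> nrm (u n - u k) < e) ->
  exists l, ccvg u l.
Proof.
move=> h.
have cv (v : nat -> R) : (forall n k, `|v n - v k| <= nrm (u n - u k)) -> cvgn v.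
  move=> vu; apply/cauchy_cvgP/cauchy_ballP => e e0; have [N hN] := h e e0.
  exists (v @` [set n | (N <= n)%N], v @` [set n | (N <= n)%N]).
    by split; exists N => // n Nn; exists n.
  by move=> [_ _] [/= [n Nn <-] [k Nk <-]]; rewrite /ball /=; apply: le_lt_trans (vu _ _) _; exact: hN.
have c1 : cvgn (fun n => complex.Re (u n)).
  by apply: cv => n k; rewrite -ReN -ReD; exact: abs_Re_le.
have c2 : cvgn (fun n => complex.Im (u n)).
  by apply: cv => n k; rewrite -ImN -ImD; exact: abs_Im_le.
exists (lim (complex.Re (u n) @[n --> \oo]) +i* lim (complex.Im (u n) @[n --> \oo])).
by apply/ccvgP; split.
Qed.

Lemma conjVM (x y : C) : ((x^*)^-1)^* * y = x^-1 * y.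
Proof. by rewrite fmorphV /=; congr (_^-1 * _); exact: conjcK. Qed.

Lemma conj_quotient (x a b c : C) :
  nrm ((x^*)^-1 * (a^* - b^*) - c^*) = nrm (x^-1 * (a - b) - c).
Proof.
rewrite -[RHS]nrm_conj; congr nrm.
by rewrite rmorphB rmorphM rmorphB /=; congr (_ * _ - _); apply/esym; exact: fmorphV.
Qed.

Lemma ccvgB (u v : nat -> C) x y : ccvg u x -> ccvg v y -> ccvg (fun n => u n - v n) (x - y).
Proof.
move=> ux vy e e0; have e2 : 0 < e / 2 by rewrite divr_gt0.
have [N1 h1] := ux _ e2; have [N2 h2] := vy _ e2; exists (maxn N1 N2) => n.
rewrite geq_max => /andP[/h1 k1 /h2 k2].
rewrite (_ : _ - _ = (u n - x) - (v n - y)); last by ring.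
by rewrite (le_lt_trans (nrmB _ _))// (splitr e) ltrD.
Qed.

Lemma ccvg_nrm_le (u : nat -> C) x (b : R) : ccvg u x -> (forall n, nrm (u n) <= b) -> nrm x <= b.
Proof.
move=> ux ub; apply/ler_addgt0Pr => e e0; have [N hN] := ux e e0.
rewrite -[x](subrK (u N)) (le_trans (nrmD _ _))// addrC lerD// nrm_distC.
by rewrite ltW// hN.
Qed.

Lemma ccvg_sqr_nrm (u : nat -> C) x : ccvg u x -> nrm (u n) ^+ 2 @[n --> \oo] --> nrm x ^+ 2.
Proof.
move=> /ccvgP[h1 h2]; rewrite nrm_sqr; under eq_fun do rewrite nrm_sqr.
by apply: cvgD; rewrite expr2; under eq_fun do rewrite expr2; exact: cvgM.
Qed.

Variables (Om : set C) (B : C -> C -> C).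
Hypothesis oOm : open Om.
Hypothesis hB : is_bergman_kernel Om B.

Lemma kernel_a2 w : Om w -> a2 Om (fun z => B z w).
Proof. by move=> /hB[/(a2P oOm)]. Qed.

Lemma kernel_repr g w : Om w -> a2 Om g -> dot Om g (fun z => B z w) = g w.
Proof.
by move=> /hB[_ h] /(a2P oOm)/h ->; rewrite area_integralE.
Qed.

Lemma kernel_sym z w : Om z -> Om w -> B z w = (B w z)^*.
Proof.
move=> Oz Ow; rewrite -(kernel_repr Oz (kernel_a2 Ow)) -(kernel_repr Ow (kernel_a2 Oz)).
by apply: dot_conj; apply: (a2_sqint oOm); exact: kernel_a2.
Qed.

(** By Hermitian symmetry [B z w] is the conjugate of a function holomorphic in [w], so its iterated
    d-bar derivatives in [w] are conjugates of ordinary derivatives. *)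
Definition kernel_deriv n w z : C := (derive1n n (fun x => B x z) w)^*.

Let dn (n : nat) : R := n.+1%:R^-1.

(* Induction on [n]: difference quotients of the representing functions are Cauchy in L2 by
   Taylor's estimate, and Fatou identifies their L2 limit with the pointwise one. *)
Theorem kernel_derivP n w : Om w -> a2 Om (kernel_deriv n w) /\
  forall g, a2 Om g -> dot Om g (kernel_deriv n w) = derive1n n g w.
Proof.
elim: n w => [|n IH] w Ow.
  have E z : Om z -> B z w = kernel_deriv 0 w z by move=> Oz; exact: kernel_sym.
  split; first exact: a2_ext E (kernel_a2 Ow).
  move=> g ag; transitivity (g w) => //; rewrite -(kernel_repr Ow ag).
  by apply: dot_ext => // z Oz; rewrite E.
have [r [K [r0 K0 hr hK]]] := derive1n_taylor oOm n Ow.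
(* [dot] is conjugate-linear in its second argument, hence the conjugate of [h]. *)
pose Q (h : C) z := (h^*)^-1 * (kernel_deriv n (w + h) z - kernel_deriv n w z).
pose L := kernel_deriv n.+1 w.
have Owh h : nrm h <= r -> Om (w + h) by move=> hh; apply: hr; rewrite addrAC subrr add0r.
have aQ h : nrm h <= r -> a2 Om (Q h).
  by move=> hh; apply: a2Z => //; apply: a2B => //; [exact: (IH _ (Owh _ hh)).1|exact: (IH _ Ow).1].
have dotQ g h : a2 Om g -> nrm h <= r ->
    dot Om g (Q h) = h^-1 * (derive1n n g (w + h) - derive1n n g w).
  move=> ag hh; have [a1 d1] := IH _ (Owh _ hh); have [a2' d2] := IH _ Ow.
  have sg := a2_sqint oOm ag; have s1 := a2_sqint oOm a1; have s2 := a2_sqint oOm a2'.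
  rewrite /Q dotZr//; last exact: sqintB.
  by rewrite dotBr// d1// d2//; exact: conjVM.
have est g h : a2 Om g -> h != 0 -> nrm h <= r ->
    nrm (h^-1 * (derive1n n g (w + h) - derive1n n g w) - derive1n n.+1 g w) <= K * l2 Om g * nrm h.
  move=> ag h0 hh; have := hK g ag h hh; have h0' : 0 < nrm h by rewrite nrm_gt0.
  rewrite (_ : _ - _ - _ = h * (h^-1 * (derive1n n g (w + h) - derive1n n g w) - derive1n n.+1 g w)); last first.
    by rewrite mulrBr mulrA divff// mul1r.
  by rewrite nrmM mulrC expr2 mulrA ler_pM2r.
(* Pairing the difference [d] with itself bounds [l2 d ^+ 2] by [l2 d] times [K * (nrm h + nrm k)];
   one factor cancels. *)
have diff h k : h != 0 -> nrm h <= r -> k != 0 -> nrm k <= r ->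
    l2 Om (fun z => Q h z - Q k z) <= K * (nrm h + nrm k).
  move=> h0 hh k0 kk; set d := fun z => _.
  have ad : a2 Om d by apply: a2B => //; exact: aQ.
  have sd := a2_sqint oOm ad; have sh := a2_sqint oOm (aQ _ hh); have sk := a2_sqint oOm (aQ _ kk).
  have : nrm (dot Om d d) <= K * l2 Om d * (nrm h + nrm k).
    rewrite {2}/d dotBr// !dotQ//.
    have e1 := est d h ad h0 hh; have e2 := est d k ad k0 kk.
    rewrite [leRHS]mulrDr; apply: le_trans (lerD e1 e2); apply: le_trans (nrmB _ _).
    rewrite le_eqVlt; apply/orP; left; apply/eqP; congr nrm; ring.
  rewrite dot_self// nrm_real ger0_norm ?sqnorm_ge0// -l2_sqr.
  have := l2_ge0 Om d; have : 0 <= K * (nrm h + nrm k) by rewrite mulr_ge0// addr_ge0// nrm_ge0.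
  rewrite mulrAC; move: (l2 _ _) (K * _) => x y y0 x0 xy.
  have [->//|x1] := eqVneq x 0.
  have xp : 0 < x by rewrite lt_def x1.
  by move: xy; rewrite expr2 ler_pM2r.
have pt z h : Om z -> h != 0 -> nrm h <= r ->
    nrm (Q h z - L z) <= K * l2 Om (fun x => B x z) * nrm h.
  move=> Oz h0 hh; have := est _ h (kernel_a2 Oz) h0 hh.
  by rewrite -conj_quotient.
have [N0 hN0] := small_dn r0.
pose hs k : C := (dn (N0 + k))%:C.
have nhs k : nrm (hs k) = dn (N0 + k) by rewrite nrm_real ger0_norm// invr_ge0.
have hs0 k : hs k != 0 by rewrite -nrm_gt0 nhs invr_gt0.
have hsr k : nrm (hs k) <= r by rewrite nhs ltW// hN0// leq_addr.
have hsc (e : R) : 0 < e -> exists N, forall k, (N <= k)%N -> nrm (hs k) < e.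
  move=> e0; have [N hN] := small_dn e0; exists N => k Nk.
  by rewrite nhs hN// (leq_trans Nk)// leq_addl.
have hsm k j : nrm (hs (k + j)) <= nrm (hs k).
  by rewrite !nhs lef_pV2 ?posrE// ler_nat ltnS leq_add2l leq_addr.
have lin0 (b : R) : 0 <= b -> forall u x, (forall k, nrm (u k - x) <= b * nrm (hs k)) -> ccvg u x.
  move=> b0 u x ux e e0; have b1 : 0 < b + 1 by rewrite ltr_wpDl.
  have [N hN] := hsc (e / (b + 1)) (divr_gt0 e0 b1); exists N => k /hN.
  rewrite ltr_pdivlMr// => h; apply: le_lt_trans (ux k) _; apply: le_lt_trans h.
  by rewrite mulrC ler_wpM2l ?nrm_ge0// lerDl.
have cQ z : Om z -> ccvg (fun k => Q (hs k) z) (L z).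
  move=> Oz; apply: (lin0 (K * l2 Om (fun x => B x z))); first by rewrite mulr_ge0// l2_ge0.
  by move=> k; exact: pt.
(* The same self-pairing bounds the quotients themselves in L2; [M] enters the Taylor constant in
   [holL]. *)
have [M hM] : exists M, forall k, l2 Om (Q (hs k)) <= M.
  have [r' [K' [r'0 K'0 _ hK']]] := derive1n_bound oOm n.+1 Ow.
  exists (K' + K * r) => k; set d := Q _; have ad : a2 Om d by exact: aQ.
  have sd := a2_sqint oOm ad.
  have e1 := est d (hs k) ad (hs0 k) (hsr k).
  have e2 : nrm (derive1n n.+1 d w) <= K' * l2 Om d.
    by apply: hK' => //; rewrite subrr nrm0 ltW.
  have : nrm (dot Om d d) <= (K' + K * r) * l2 Om d.
    rewrite {2}/d dotQ// -[X in nrm X](subrK (derive1n n.+1 d w)) (le_trans (nrmD _ _))//.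
    rewrite mulrDl addrC lerD// (le_trans e1)// mulrAC ler_wpM2r ?l2_ge0//.
    by rewrite ler_wpM2l.
  rewrite dot_self// nrm_real ger0_norm ?sqnorm_ge0// -l2_sqr.
  have := l2_ge0 Om d; have : 0 <= K' + K * r by rewrite addr_ge0// mulr_ge0// ltW.
  move: (l2 _ _) (K' + _) => x y y0 x0 xy; have [->//|x1] := eqVneq x 0.
  have xp : 0 < x by rewrite lt_def x1.
  by move: xy; rewrite expr2 ler_pM2r.
(* The derivatives of the quotients at [z] are Cauchy, and Taylor's estimate, with the common
   constant [Kz * M], passes to the pointwise limit. *)
have holL z : Om z -> hol_at L z.
  move=> Oz; have [rz [Kz [rz0 Kz0 hrz hKz]]] := derive1n_taylor oOm 0 Oz.
  have [rb [Kb [rb0 Kb0 _ hKb]]] := derive1n_bound oOm 1 Oz.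
  have [l ul] : exists l, ccvg (fun k => derive1 (Q (hs k)) z) l.
    apply: ccauchy_cvg => e e0.
    have c0 : 0 < 2 * (Kb * K) + 1 by rewrite ltr_wpDl// !mulr_ge0.
    have [N hN] := hsc (e / (2 * (Kb * K) + 1)) (divr_gt0 e0 c0).
    exists N => i j /hN hi /hN hj.
    have := @derive1nB _ _ oOm 1 (Q (hs i)) (Q (hs j)) (aQ _ (hsr i)).1 (aQ _ (hsr j)).1 z Oz.
    move=> /= <-.
    have ad : a2 Om (fun z => Q (hs i) z - Q (hs j) z) by apply: a2B => //; exact: aQ.
    have := hKb _ ad z; rewrite subrr nrm0 => /(_ (ltW rb0)) /=.
    move=> /le_lt_trans; apply.
    have d1 := diff _ _ (hs0 i) (hsr i) (hs0 j) (hsr j).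
    apply: (le_lt_trans (ler_wpM2l Kb0 d1)); rewrite mulrA.
    move: hi hj; rewrite !ltr_pdivlMr//.
    have := nrm_ge0 (hs i); have := nrm_ge0 (hs j); have : 0 <= Kb * K by rewrite mulr_ge0.
    by move: (Kb * K) (nrm _) (nrm _) => a b c a0 b0 c0' h1 h2; nra.
  exists l; apply: (@cdiff_quadratic _ _ _ _ rz (Kz * M)) => // k /ltW kr.
  have Ozk : Om (z + k) by apply: hrz; rewrite addrAC subrr add0r.
  have cc : ccvg (fun i => Q (hs i) (z + k) - Q (hs i) z - k * derive1 (Q (hs i)) z) (L (z + k) - L z - k * l).
    apply: ccvgB; first by apply: ccvgB; exact: cQ.
    by under eq_fun do rewrite mulrC; rewrite mulrC; exact: ccvgMr.
  apply: (ccvg_nrm_le cc) => i; apply: (le_trans (hKz _ (aQ _ (hsr i)) k kr)).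
  by rewrite ler_wpM2r ?exprn_ge0 ?nrm_ge0// ler_wpM2l.
have D k : a2 Om (fun z => Q (hs k) z - L z) /\
    sqnorm Om (fun z => Q (hs k) z - L z) <= (2 * K * nrm (hs k)) ^+ 2.
  have hD z : Om z -> hol_at (fun z => Q (hs k) z - L z) z.
    by move=> Oz; apply: hol_atB; [exact: (aQ _ (hsr k)).1|exact: holL].
  have ad j : a2 Om (fun z => Q (hs k) z - Q (hs (k + j)) z) by apply: a2B => //; exact: aQ.
  have [||||i J1] := @J_fatou R (fun j => cut Om (fun z => nrm (Q (hs k) z - Q (hs (k + j)) z) ^+ 2))
     (cut Om (fun z => nrm (Q (hs k) z - L z) ^+ 2)) ((2 * K * nrm (hs k)) ^+ 2) (fun j => (ad j).2).
  - by rewrite cut_nrm2; apply: cmeas_nrm2; exact: hol_cmeas.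
  - by move=> j z; rewrite /cut; case: ifP => // _; rewrite exprn_ge0// nrm_ge0.
  - move=> j; rewrite -/(sqnorm Om (fun z => Q (hs k) z - Q (hs (k + j)) z)) -l2_sqr.
    rewrite lerXn2r ?nnegrE ?l2_ge0 ?mulr_ge0 ?nrm_ge0//.
    rewrite (le_trans (diff _ _ _ _ _ _))// -mulrA mulrCA ler_wpM2l// mulrDl mul1r lerD2l.
    exact: hsm.
  - move=> z; have [Oz|Oz] := pselect (Om z); last by rewrite cutF//; under eq_fun do rewrite cutF//; exact: cvg_cst.
    rewrite cutT//; under eq_fun do rewrite cutT//.
    apply: ccvg_sqr_nrm; apply: ccvgB; first exact: ccvg_cst.
    move=> e e0; have [N hN] := cQ z Oz e e0; exists N => j Nj.
    by apply: hN; exact: leq_trans Nj (leq_addl _ _).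
  by split.
have aL : a2 Om L.
  apply: (a2_ext oOm _ (a2B oOm (aQ _ (hsr 0%N)) (D 0%N).1)) => z _; by rewrite opprB addrC subrK.
split => // g ag; have sg := a2_sqint oOm ag; have sL := a2_sqint oOm aL.
have c1 : ccvg (fun k => dot Om g (Q (hs k))) (derive1n n.+1 g w).
  apply: (lin0 (K * l2 Om g)); first by rewrite mulr_ge0// l2_ge0.
  by move=> k; rewrite dotQ//; exact: est.
have c2 : ccvg (fun k => dot Om g (Q (hs k))) (dot Om g L).
  apply: (lin0 (4 * K * l2 Om g)); first by rewrite !mulr_ge0// l2_ge0.
  move=> k; have sk := a2_sqint oOm (aQ _ (hsr k)); rewrite -dotBr//.
  rewrite -(@ler_pXn2r _ 2) ?nnegrE ?mulr_ge0 ?nrm_ge0 ?l2_ge0//.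
  have := nrm_dot sg (a2_sqint oOm (D k).1); move=> /le_trans; apply.
  rewrite -(l2_sqr Om g).
  rewrite (_ : (_ * nrm _) ^+ 2 = 4 * (l2 Om g ^+ 2 * (2 * K * nrm (hs k)) ^+ 2)); last by ring.
  rewrite ler_wpM2l// ler_wpM2l ?exprn_ge0 ?l2_ge0//; exact: (D k).2.
exact: ccvg_unique c2 c1.
Qed.
End BergmanKernel.

(** * The Wirtinger operator on conjugates of holomorphic functions *)

Section RealDerivative.
Variable R : realType.
Local Notation C := (R[i]^o).

Lemma derive1_eps (f : R -> R) x l :
  (forall e : R, 0 < e -> exists2 d : R, 0 < d & forall h, `|h| < d ->
     `|f (x + h) - f x - l * h| <= e * `|h|) -> derive1 f x = l.
Proof.
move=> fl; rewrite derive1E; apply/cvg_lim => //; apply/cvgrPdist_le => e e0.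
have [d d0 hd] := fl e e0.
near=> h.
have h0 : h != 0 by near: h; exact: nbhs_dnbhs_neq.
have hh : `|h| < d by near: h; exact: dnbhs0_lt.
rewrite distrC [_ - l](_ : _ = h^-1 * (f (x + h) - f x - l * h)).
  by rewrite normrM normfV ler_pdivrMl ?normr_gt0// [leRHS]mulrC hd.
rewrite /GRing.scale /= mulr1 [h + x]addrC [RHS]mulrBr; congr (_ - _).
by rewrite mulrCA mulVf ?mulr1.
Unshelve. all: by end_near. Qed.

Lemma curve_deriv_conj (gam : R -> C) (G : C -> C) (w v l : C) (d : R) : 0 < d ->
  (forall t : R, `|t| < d -> gam t = (G (w + t%:C * v))^*) -> cdiff G w l -> nrm v <= 1 ->
  curve_deriv gam 0 = (l * v)^*.
Proof.
move=> d0 gE gl v1.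
have key (e : R) : 0 < e -> exists2 d' : R, 0 < d' & forall h : R, `|h| < d' ->
    [/\ gam (0 + h) = (G (w + h%:C * v))^*, gam 0 = (G w)^* &
        nrm (G (w + h%:C * v) - G w - l * (h%:C * v)) <= e * `|h|].
  move=> e0; have [d1 d10 h1] := gl e e0; exists (Num.min d d1); first by rewrite lt_min d0.
  move=> h; rewrite lt_min => /andP[hd hd1].
  have nh : nrm (h%:C * v) <= `|h| by rewrite nrmM nrm_real ler_piMr.
  split; [by rewrite add0r gE|by rewrite gE ?normr0// mul0r addr0|].
  by apply: (le_trans (h1 _ (le_lt_trans nh hd1))); rewrite ler_wpM2l// ltW.
have Er (h : R) : complex.Re (l * (h%:C * v)) = complex.Re (l * v) * h.
  by case: (l) => a b; case: (v) => x y /=; ring.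
have Ei (h : R) : complex.Im (l * (h%:C * v)) = complex.Im (l * v) * h.
  by case: (l) => a b; case: (v) => x y /=; ring.
apply: complex_ext => /=; apply: derive1_eps => e e0; have [d' d'0 hd'] := key e e0;
  exists d' => // h /hd'[-> -> le]; apply: le_trans le.
  by rewrite !Re_conj -Er -!ReN -!ReD; exact: abs_Re_le.
rewrite !Im_conj mulNr opprK -Ei.
rewrite (_ : _ + _ = - complex.Im (G (w + h%:C * v) - G w - l * (h%:C * v))).
  by rewrite normrN abs_Im_le.
rewrite !ImD !ImN; move: (complex.Im _) (complex.Im _) (complex.Im _) => x y z; ring.
Qed.

(** Along the two axes the conjugate of [G] has derivatives [l^*] and [(l * i)^*]; with the factor
    [i] on the second they add up to [2 * l^*]. *)
Lemma dbar_conj (F G : C -> C) w l (d : R) : 0 < d ->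
  (forall y, nrm (y - w) < d -> F y = (G y)^*) -> cdiff G w l -> dbar F w = l^*.
Proof.
move=> d0 FG gl; rewrite /dbar.
rewrite (@curve_deriv_conj (fun t => F (w + t%:C)) G w 1 l d) ?nrm1//; last first.
  by move=> t td; rewrite mulr1 FG// addrAC subrr add0r nrm_real.
rewrite (@curve_deriv_conj (fun t => F (w + (0 +i* t))) G w (0 +i* 1) l d) ?nrm_i//; last first.
  move=> t td; rewrite FG; last by rewrite addrAC subrr add0r nrm_imag.
  suff -> : t%:C * (0 +i* 1) = 0 +i* t :> C by [].
  by apply: complex_ext => /=; ring.
have two : (2 : C) != 0 by rewrite pnatr_eq0.
apply: (mulIf two); rewrite divfK//.
by case: l {gl} => x y; apply: complex_ext => /=; ring.
Qed.

End RealDerivative.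

(** * The Bergman span and polynomial functions *)

Section BergmanSpan.
Variable R : realType.
Local Notation C := (R[i]^o).
Implicit Types (f g : C -> C).
Variables (Om : set C) (B : C -> C -> C).
Hypothesis oOm : open Om.
Hypothesis hB : is_bergman_kernel Om B.

Lemma iter_dbar_kernel n z w : Om z -> Om w -> iter n (@dbar R) (B z) w = kernel_deriv B n w z.
Proof.
move=> Oz; elim: n w => [|n IH] w Ow; first by exact: (kernel_sym oOm hB).
have [d d0 hd] := (openC Om).1 oOm w Ow.
have [l gl] := hol_derive1n n oOm (kernel_a2 oOm hB Oz).1 Ow.
rewrite iterS (dbar_conj d0 _ gl); last by move=> y /hd; exact: IH.
by rewrite /kernel_deriv /= (cdiff_derivable gl).2.
Qed.

Lemma spanP kap : bergman_span Om B kap -> exists n (c a : 'I_n -> C) (m : 'I_n -> nat),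
  (forall j, Om (a j)) /\
  forall z, Om z -> kap z = \sum_(j < n) c j * kernel_deriv B (m j) (a j) z.
Proof.
move=> [n [c [a [m [Oa h]]]]]; exists n, c, a, m; split => // z Oz; rewrite h//.
by apply: eq_bigr => j _; rewrite iter_dbar_kernel.
Qed.

Lemma a2_sum (n : nat) (F : 'I_n -> C -> C) : (forall j, a2 Om (F j)) ->
  a2 Om (fun z => \sum_(j < n) F j z).
Proof.
move=> h; split; last by exact: (sqint_sum _ (fun j => a2_sqint oOm (h j))).2.
move=> z Oz; elim: (index_enum _) => [|k s IH].
  by under eq_fun do rewrite big_nil; exact: hol_at_cst.
by under eq_fun do rewrite big_cons; apply: hol_atD => //; exact: (h k).1.
Qed.

Lemma span_a2 kap : bergman_span Om B kap -> a2 Om kap.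
Proof.
move=> /spanP[n [c [a [m [Oa h]]]]].
apply: (a2_ext oOm (fun z Oz => esym (h z Oz))); apply: a2_sum => j.
by apply: a2Z => //; exact: (kernel_derivP oOm hB _ (Oa j)).1.
Qed.

Lemma span_sub kap kap' : bergman_span Om B kap -> bergman_span Om B kap' ->
  bergman_span Om B (fun z => kap z - kap' z).
Proof.
move=> [n [c [a [m [Oa h]]]]] [n' [c' [a' [m' [Oa' h']]]]].
pose cat (V : Type) (x : 'I_n -> V) (y : 'I_n' -> V) (j : 'I_(n + n')) :=
  match fintype.split j with inl i => x i | inr i => y i end.
exists (n + n')%N, (cat _ c (fun i => - c' i)), (cat _ a a'), (cat _ m m'); split.
  by move=> j; rewrite /cat; case: (fintype.split j).
move=> z Oz; rewrite h// h'// big_split_ord /= -sumrN; congr (_ + _); apply: eq_bigr => j _.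
  by rewrite /cat; case: fintype.splitP => k /= hk; [rewrite (val_inj hk)|have := ltn_ord j; rewrite hk ltnNge leq_addr].
rewrite /cat; case: fintype.splitP => k /= hk; last by rewrite (val_inj (addnI hk)) mulNr.
by have := ltn_ord k; rewrite -hk ltnNge leq_addr.
Qed.

Lemma cdiff_cst (c z : C) : cdiff (fun=> c) z 0.
Proof.
move=> e e0; exists 1 => // h _; rewrite subrr mul0r subrr nrm0.
by rewrite mulr_ge0 ?nrm_ge0// ltW.
Qed.

Lemma cdiff_mulX g (z l : C) : cdiff g z l -> cdiff (fun x => g x * x) z (g z + l * z).
Proof.
move=> gl e e0; have k0 : 0 < nrm z + nrm l + 2 by rewrite ltr_wpDl// addr_ge0 ?nrm_ge0.
have [d d0 hd] := gl (e / (nrm z + nrm l + 2)) (divr_gt0 e0 k0).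
exists (Num.min d (Num.min 1 (e / (nrm z + nrm l + 2)))).
  by rewrite !lt_min d0 ltr01 divr_gt0.
move=> h; rewrite !lt_min => /andP[/hd hk /andP[h1 he]].
rewrite (_ : _ - _ = (g (z + h) - g z - l * h) * (z + h) + l * h * h); last by ring.
have hz : nrm (z + h) <= nrm z + 1 by apply: (le_trans (nrmD _ _)); rewrite lerD2l ltW.
apply: (le_trans (nrmD _ _)); rewrite !nrmM.
apply: (@le_trans _ _ (e / (nrm z + nrm l + 2) * nrm h * (nrm z + 1) +
    nrm l * nrm h * (e / (nrm z + nrm l + 2)))).
  apply: lerD; first by apply: ler_pM; rewrite ?nrm_ge0.
  by rewrite ler_wpM2l ?mulr_ge0 ?nrm_ge0// ltW.
rewrite (_ : _ + _ = e * nrm h * ((nrm z + nrm l + 1) / (nrm z + nrm l + 2))); last by ring.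
by rewrite ler_piMr ?mulr_ge0 ?nrm_ge0 ?ltW// ltr_pdivrMr// mul1r ltrD2l ltr1n.
Qed.

Definition pev (p : {poly R[i]}) : C -> C := fun x => p.[x].

Lemma cdiff_pev (p : {poly R[i]}) (z : C) : cdiff (pev p) z (pev p^`() z).
Proof.
elim/poly_ind: p => [|p c IH].
  have -> : pev 0 = fun=> 0 by apply/funext => x; rewrite /pev horner0.
  rewrite /pev deriv0 horner0; exact: cdiff_cst.
have -> : pev (p * 'X + c%:P) = (fun x : C => pev p x * x + c).
  by apply/funext => x; rewrite /pev !hornerE.
rewrite /pev derivD derivC addr0 derivM derivX mulr1 hornerD hornerM hornerX addrC.
have := cdiffD (cdiff_mulX IH) (@cdiff_cst c z); rewrite addr0; exact.
Qed.

Lemma derive1n_pev n (p : {poly R[i]}) : derive1n n (pev p) = pev p^`(n).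
Proof.
elim: n => [//|n IH].
have -> : derive1n n.+1 (pev p) = derive1 (derive1n n (pev p)) by [].
by apply/funext => z; rewrite IH (cdiff_derivable (cdiff_pev _ _)).2 derivnS.
Qed.

End BergmanSpan.

(** * Hermite interpolation *)

Section Hermite.
Variable F : numFieldType.
Implicit Types (p q : {poly F}) (a b : F).

Lemma derivn_shift p a m : p^`(m).[a] = (p \Po ('X + a%:P))`_m *+ m`!.
Proof.
have E : (p \Po ('X + a%:P))^`(m) = p^`(m) \Po ('X + a%:P).
  elim: m p => [//|m IH] p.
  by rewrite !derivSn deriv_comp derivD derivX derivC addr0 mulr1 IH.
have : (p \Po ('X + a%:P))^`(m)`_0 = p^`(m).[a].
  by rewrite E -horner_coef0 horner_comp hornerD hornerX hornerC add0r.
by move=> <-; rewrite coef_derivn addn0 ffactnn.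
Qed.

(** After shifting [a] to 0 the polynomial is ['X ^+ k] times the shift of [q]: its coefficients
    below [k] vanish, and the one of index [k] is [q.[a]]. *)
Lemma derivn_XsubC_exp q a k m : (m <= k)%N ->
  (('X - a%:P) ^+ k * q)^`(m).[a] = (q.[a] *+ k`!) *+ (m == k).
Proof.
move=> mk; rewrite derivn_shift comp_polyM rmorphXn /= comp_polyB comp_polyX comp_polyC addrK coefXnM.
move: mk; rewrite leq_eqVlt => /orP[/eqP ->|mk]; last by rewrite mk mul0rn (ltn_eqF mk).
rewrite ltnn subnn eqxx mulr1n -horner_coef0 horner_comp.
by rewrite hornerD hornerX hornerC add0r.
Qed.

(** Induction on the nodes: a multiple of [P], which vanishes to order [M] at the old nodes, leaves
    the data there unchanged, and at the new node the derivatives are corrected one order at a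
    time. *)
Lemma hermite (s : seq F) M (f : F -> nat -> F) : uniq s ->
  exists p, forall a m, a \in s -> (m < M)%N -> p^`(m).[a] = f a m.
Proof.
elim: s => [_|b s IH /= /andP[bs us]]; first by exists 0.
have [p hp] := IH us; pose P := \prod_(a <- s) ('X - a%:P) ^+ M.
have Pb : P.[b] != 0.
  rewrite horner_prod prodf_seq_neq0; apply/allP => a as_ /=.
  rewrite horner_exp hornerXsubC expf_neq0// subr_eq0.
  by apply: contraNneq bs => ->.
have Pa q a m : a \in s -> (m < M)%N -> (P * q)^`(m).[a] = 0.
  move=> as_ mM; rewrite /P (big_rem a)//= -mulrA derivn_XsubC_exp ?(ltnW mM)//.
  by rewrite (ltn_eqF mM).
suff [q hq] : exists q, forall m, (m < M)%N -> (p + P * q)^`(m).[b] = f b m.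
  exists (p + P * q) => a m; rewrite inE => /orP[/eqP ->|as_] mM; first exact: hq.
  by rewrite derivnD hornerD Pa// addr0 hp.
have {IH hp} : (M <= M)%N by []; elim: {-2}M => [_|k IH kM]; first by exists 0.
have [q hq] := IH (ltnW kM).
(* The correction vanishes to order [k] at [b], and its k-th derivative there is [c * P.[b] *+
   k!]. *)
pose c := (f b k - (p + P * q)^`(k).[b]) / (P.[b] *+ k`!).
exists (q + c%:P * ('X - b%:P) ^+ k) => m; rewrite ltnS => mk.
have -> : p + P * (q + c%:P * ('X - b%:P) ^+ k) = (p + P * q) + ('X - b%:P) ^+ k * (c%:P * P).
  by ring.
rewrite derivnD hornerD derivn_XsubC_exp// hornerM hornerC.
move: mk; rewrite leq_eqVlt => /orP[/eqP ->|mk].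
  rewrite eqxx /c -mulrnAr divfK ?subrKC//.
  by rewrite mulrn_eq0 negb_or Pb -lt0n fact_gt0.
by rewrite (ltn_eqF mk) addr0 hq.
Qed.
End Hermite.

Lemma poly_antideriv (F : numFieldType) (q : {poly F}) : exists p : {poly F}, p^`() = q.
Proof.
(* At [i = 0] the division by zero makes the constant term 0. *)
exists (\poly_(i < (size q).+1) (q`_i.-1 / i%:R)).
apply/polyP => i; rewrite coef_deriv coef_poly ltnS.
case: ltnP => h; last by rewrite mul0rn nth_default.
by rewrite /= -[LHS]mulr_natr divfK ?pnatr_eq0.
Qed.

(** * Testing the Bergman span against polynomials *)

Section PolynomialsDense.
Variable R : realType.
Local Notation C := (R[i]^o).
Variables (Om : set C) (B : C -> C -> C) (S : R).
Hypothesis oOm : open Om.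
Hypothesis S0 : 0 < S.
Hypothesis OmS : Om `<=` box 0 S.
Hypothesis hB : is_bergman_kernel Om B.

Lemma bounded_a2 (g : C -> C) (M : R) : (forall z, Om z -> hol_at g z) ->
  (forall z, Om z -> nrm (g z) <= M) -> a2 Om g.
Proof.
move=> hg gM; split => //.
have mg := hol_cmeas oOm hg.
apply: (@rint_le _ _ (fun z => (M ^+ 2) * ind (box 0 S) z)).
- by rewrite cut_nrm2; exact: cmeas_nrm2.
- by apply: rintZ; apply: rint_ind_box; exact: ltW.
move=> z; have [Oz|Oz] := pselect (Om z); last first.
  by rewrite cutF// normr0 normr_ge0.
rewrite cutT// indT ?mulr1; last exact: OmS.
have g0 := le_trans (nrm_ge0 _) (gM _ Oz).
rewrite !ger0_norm ?exprn_ge0 ?nrm_ge0// lerXn2r ?nnegrE ?nrm_ge0//; exact: gM.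
Qed.

Lemma pev_bounded (p : {poly R[i]}) : exists2 M : R, 0 <= M & forall z, box 0 S z -> nrm (pev p z) <= M.
Proof.
elim/poly_ind: p => [|p c [M M0 hM]].
  by exists 0 => // z _; rewrite /pev horner0 nrm0.
exists (M * (2 * S) + nrm c) => [|z bz].
  by rewrite addr_ge0 ?nrm_ge0// !mulr_ge0// ltW.
rewrite /pev hornerD hornerC hornerM hornerX; apply: (le_trans (nrmD _ _)).
rewrite lerD2r nrmM ler_pM ?nrm_ge0//; first exact: hM.
by have := box_nrm bz; rewrite subr0.
Qed.

Lemma pev_a2 p : a2 Om (pev p).
Proof.
have [M _ hM] := pev_bounded p; apply: (@bounded_a2 _ M) => [z _|z /OmS]; last exact: hM.
by exists (pev p^`() z); exact: cdiff_pev.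
Qed.

Lemma span_dot kap : bergman_span Om B kap -> exists n (c a : 'I_n -> C) (m : 'I_n -> nat),
  (forall j, Om (a j)) /\ forall g, a2 Om g ->
  dot Om g kap = \sum_(j < n) (c j)^* * derive1n (m j) g (a j).
Proof.
move=> /(spanP oOm hB)[n [c [a [m [Oa h]]]]]; exists n, c, a, m; split => // g ag.
rewrite (dot_ext (fun z _ => erefl (g z)) h).
have sg := a2_sqint oOm ag.
have sk j : sqint Om (kernel_deriv B (m j) (a j)).
  exact: (a2_sqint oOm (kernel_derivP oOm hB (m j) (Oa j)).1).
rewrite dot_sumr//; last by move=> j; exact: sqintZ.
apply: eq_bigr => j _; rewrite dotZr//; congr (_ * _).
exact: (kernel_derivP oOm hB (m j) (Oa j)).2.
Qed.

(* The functional [dot _ kap] only sees finitely many derivatives, so Hermite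
   interpolation allows testing against polynomials instead of kernels. *)
Lemma span_ortho_poly kap : bergman_span Om B kap ->
  (forall q, dot Om (pev q) kap = 0) -> forall z, Om z -> kap z = 0.
Proof.
move=> sk ortho z Oz; have [n [c [a [m [Oa h]]]]] := span_dot sk.
have az := kernel_a2 oOm hB Oz; have ak := span_a2 oOm hB sk.
pose M := (\max_(j < n) m j).+1.
(* The points [a j] may repeat with different orders [m j], hence [undup] and a common bound [M] on
   the orders. *)
have [q hq] := @hermite R[i] (undup [seq a j | j <- index_enum 'I_n]) M
  (fun x k => derive1n k (fun x => B x z) x) (undup_uniq _).
rewrite -(kernel_repr oOm hB Oz ak).
rewrite (dot_conj (a2_sqint oOm az) (a2_sqint oOm ak)).
suff -> : dot Om (fun x => B x z) kap = 0 by rewrite conjc0.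
rewrite -(ortho q) (h _ az) (h _ (pev_a2 q)); apply: eq_bigr => j _; congr (_ * _).
rewrite derive1n_pev /pev hq//; last by rewrite ltnS (leq_bigmax (F:=m)).
by rewrite mem_undup; apply: map_f; rewrite mem_index_enum.
Qed.

End PolynomialsDense.

(** * The boundary layer *)

Section Cutoff.
Variable R : realType.
Local Notation C := (R[i]^o).
Local Notation im := (0 +i* 1 : C).
Implicit Types (F G : C -> C) (b z w h : C).

Lemma ccvg_perturb (u v : nat -> C) l (K : R) (N0 : nat) : ccvg u l ->
  (forall n, (N0 <= n)%N -> nrm (v n - u n) <= K * n.+1%:R^-1) -> ccvg v l.
Proof.
move=> ul vu e e0; have e2 : 0 < e / 2 by rewrite divr_gt0.
have K0 : 0 < `|K| + 1 by rewrite ltr_wpDl.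
have [N1 h1] := ul _ e2; have [N2 h2] := small_dn (divr_gt0 e2 K0).
exists (maxn N0 (maxn N1 N2)) => n; rewrite !geq_max => /and3P[/vu k0 /h1 k1 /h2].
rewrite ltr_pdivlMr// => k2; apply: (le_lt_trans (nrm_triangle _ (u n) _)).
have n0 : (0 : R) <= n.+1%:R^-1 by rewrite invr_ge0.
have := ler_wpM2r n0 (ler_norm K); move: (_^-1) n0 k0 k2 k1 => x x0; lra.
Qed.

(** The quotient of a product differs from Leibniz's expression by products of two increments over
    [t], which are O(t) for Lipschitz factors. *)
Lemma ccvg_dbq_mul F G z lF lG (LF LG d : R) : 0 < d ->
  (forall h, nrm h < d -> nrm (F (z + h) - F z) <= LF * nrm h) ->
  (forall h, nrm h < d -> nrm (G (z + h) - G z) <= LG * nrm h) ->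
  ccvg (fun n => dbq n.+1%:R^-1 F z) lF -> ccvg (fun n => dbq n.+1%:R^-1 G z) lG ->
  ccvg (fun n => dbq n.+1%:R^-1 (fun y => F y * G y) z) (lF * G z + F z * lG).
Proof.
move=> d0 hF hG cF cG.
have c : ccvg (fun n => dbq n.+1%:R^-1 F z * G z - dbq n.+1%:R^-1 G z * (- F z)) (lF * G z + F z * lG).
  by rewrite (_ : _ + _ = lF * G z - lG * (- F z)); [apply: ccvgB; exact: ccvgMr|ring].
have [N hN] := small_dn d0.
apply: (@ccvg_perturb _ _ _ (2 * (LF * LG)) N c) => n /hN.
have : (0 : R) < n.+1%:R^-1 by rewrite invr_gt0.
move: (n.+1%:R^-1) => t t0 td.
have r1 : nrm t%:C = t by rewrite nrm_real gtr0_norm.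
have r2 : nrm (0 +i* t) = t by rewrite nrm_imag gtr0_norm.
have f1 : nrm (F (z + t%:C) - F z) <= LF * t by rewrite -{2}r1; apply: hF; rewrite r1.
have g1 : nrm (G (z + t%:C) - G z) <= LG * t by rewrite -{2}r1; apply: hG; rewrite r1.
have f2 : nrm (F (z + (0 +i* t)) - F z) <= LF * t by rewrite -{2}r2; apply: hF; rewrite r2.
have g2 : nrm (G (z + (0 +i* t)) - G z) <= LG * t by rewrite -{2}r2; apply: hG; rewrite r2.
rewrite /dbq.
move: (F (z + t%:C)) (F (z + (0 +i* t))) (F z) (G (z + t%:C)) (G (z + (0 +i* t))) (G z) f1 f2 g1 g2.
move=> a1 a2 a b1 b2 b f1 f2 g1 g2.
rewrite (_ : _ - _ = (t^-1)%:C * ((a1 - a) * (b1 - b) + im * ((a2 - a) * (b2 - b)))); last by ring.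
rewrite nrmM nrm_real ger0_norm ?invr_ge0 ?(ltW t0)// ler_pdivrMl//.
apply: (le_trans (nrmD _ _)); rewrite !nrmM nrm_i mul1r.
have := ler_pM (nrm_ge0 _) (nrm_ge0 _) f1 g1; have := ler_pM (nrm_ge0 _) (nrm_ge0 _) f2 g2.
lra.
Qed.

(** The Cauchy-Riemann equations: the linear part contributes a multiple of [1 + im * im = 0]. *)
Lemma ccvg_dbq_hol G z l : cdiff G z l -> ccvg (fun n => dbq n.+1%:R^-1 G z) 0.
Proof.
move=> gl e e0; have e4 : 0 < e / 4 by rewrite divr_gt0.
have [d d0 hd] := gl _ e4; have [N hN] := small_dn d0; exists N => n /hN.
have : (0 : R) < n.+1%:R^-1 by rewrite invr_gt0.
move: (n.+1%:R^-1) => t t0 td.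
have r1 : nrm t%:C = t by rewrite nrm_real gtr0_norm.
have r2 : nrm (0 +i* t) = t by rewrite nrm_imag gtr0_norm.
have := hd t%:C; have := hd (0 +i* t); rewrite r1 r2 => /(_ td) k1 /(_ td) k2.
rewrite subr0 /dbq.
rewrite (_ : _ * _ = (t^-1)%:C * ((G (z + t%:C) - G z - l * t%:C) +
    im * (G (z + (0 +i* t)) - G z - l * (0 +i* t)))); last first.
  move: (G (z + t%:C)) (G (z + (0 +i* t))) (G z) => [a1 a2] [b1 b2] [c1 c2]; case: l {k1 k2 gl hd} => l1 l2.
  by apply: complex_ext => /=; ring.
rewrite nrmM nrm_real ger0_norm ?invr_ge0 ?(ltW t0)// ltr_pdivrMl//.
apply: (le_lt_trans (nrmD _ _)); rewrite nrmM nrm_i mul1r; nra.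
Qed.

Lemma ccvg_dbq_conj G z l : cdiff G z l -> ccvg (fun n => dbq n.+1%:R^-1 (fun y => (G y)^*) z) (2 * l^*).
Proof.
move=> gl e e0; have e4 : 0 < e / 4 by rewrite divr_gt0.
have [d d0 hd] := gl _ e4; have [N hN] := small_dn d0; exists N => n /hN.
have : (0 : R) < n.+1%:R^-1 by rewrite invr_gt0.
move: (n.+1%:R^-1) => t t0 td.
have r1 : nrm t%:C = t by rewrite nrm_real gtr0_norm.
have r2 : nrm (0 +i* t) = t by rewrite nrm_imag gtr0_norm.
have := hd t%:C; have := hd (0 +i* t); rewrite r1 r2 => /(_ td) k1 /(_ td) k2.
rewrite /dbq.
rewrite (_ : _ - _ = (t^-1)%:C * ((G (z + t%:C) - G z - l * t%:C)^* +
    im * (G (z + (0 +i* t)) - G z - l * (0 +i* t))^*)); last first.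
  move: (G (z + t%:C)) (G (z + (0 +i* t))) (G z) => [a1 a2] [b1 b2] [c1 c2]; case: l {k1 k2 gl hd} => l1 l2.
  by apply: complex_ext => /=; field; exact: lt0r_neq0.
rewrite nrmM nrm_real ger0_norm ?invr_ge0 ?(ltW t0)// ltr_pdivrMl//.
apply: (le_lt_trans (nrmD _ _)); rewrite nrmM nrm_i mul1r !nrm_conj; nra.
Qed.

Lemma clamp_le (x y : R) : x <= y -> clamp x <= clamp y.
Proof.
move=> xy; rewrite /clamp ge_max le_max lexx /= le_max le_min !ge_min lexx /=.
by rewrite xy orbT /= orbT.
Qed.

Lemma theta_mono b b' (r : R) z : 0 < r -> nrm (z - b) <= nrm (z - b') ->
  theta b' r z <= theta b r z.
Proof.
move=> r0 h; apply: clamp_le; rewrite lerD2l lerN2 ler_pM2r ?invr_gt0 ?exprn_gt0//.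
by rewrite lerXn2r ?nnegrE ?nrm_ge0.
Qed.

Variables (net : seq C) (r : R).
Hypothesis net_uniq : uniq net.
Hypothesis r0 : 0 < r.

(** A minimum rather than a product: it is attained at the nearest net point ([chi_eq]), so locally
    [chi] is one radial cutoff, whatever the size of the net. *)
Definition chi z : R := \big[Num.min/1]_(b <- net) (1 - theta b r z).

Lemma chi_ge0 z : 0 <= chi z.
Proof.
by rewrite /chi; elim/big_ind : _ => // [x y|b _]; [rewrite le_min => -> ->|rewrite subr_ge0 clamp_le1].
Qed.

Lemma chi_le b z : b \in net -> chi z <= 1 - theta b r z.
Proof.
rewrite /chi; elim: net => // a s IH; rewrite inE big_cons => /orP[/eqP ->|/IH h].
  by rewrite ge_min lexx.
by rewrite ge_min h orbT.
Qed.

Lemma chi_le1 z : chi z <= 1.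
Proof. by rewrite /chi; elim: net => [|a s IH]; rewrite ?big_nil// big_cons ge_min IH orbT. Qed.

Lemma chi_eq b z : b \in net -> (forall b', b' \in net -> nrm (z - b) <= nrm (z - b')) ->
  chi z = 1 - theta b r z.
Proof.
move=> bn hb; apply/eqP; rewrite eq_le chi_le//=.
rewrite /chi big_seq; elim/big_ind : _ => [|x y|b' b'n].
- by rewrite gerBl clamp_ge0.
- by rewrite le_min => -> ->.
- by rewrite lerD2l lerN2; apply: theta_mono => //; exact: hb.
Qed.

Lemma chi_neq0 b z : b \in net -> chi z != 0 -> r < nrm (z - b).
Proof.
move=> bn; rewrite ltNge; apply: contra => h; rewrite eq_le chi_ge0 andbT.
by apply: (le_trans (chi_le z bn)); rewrite theta_eq1// subrr.
Qed.

Lemma chi_eq1 z : (forall b, b \in net -> 2 * r <= nrm (z - b)) -> chi z = 1.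
Proof.
move=> h; apply/eqP; rewrite eq_le chi_le1 /= /chi big_seq; elim/big_ind : _ => // [x y|b /h hb].
  by rewrite le_min => -> ->.
by rewrite theta_eq0_far ?subr0//; move: hb r0; lra.
Qed.

Lemma chi_lip : lip (4 / r) (fun z => (chi z)%:C).
Proof.
move=> z w; rewrite -raddfB nrm_real.
suff h z' w' : chi z' - 4 / r * nrm (z' - w') <= chi w'.
  have := h z w; have := h w z; rewrite (nrm_distC w z) => h1 h2.
  by rewrite ler_norml; apply/andP; split; lra.
rewrite {2}/chi big_seq; elim/big_ind : _ => [|x y|b bn].
- rewrite lerBlDr (le_trans (chi_le1 _))// lerDl mulr_ge0 ?nrm_ge0// divr_ge0// ltW//.
- by rewrite le_min => -> ->.
have := chi_le z' bn; have := theta_lip b z' w' r0; rewrite ler_norml => /andP[h1 h2]; lra.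
Qed.

(** The closed Voronoi cell of [b]. *)
Definition nearest b : set C := [set z | forall b', b' \in net -> nrm (z - b) <= nrm (z - b')].

(** The d-bar derivative cell by cell, with the factor 2 of [dbq]. Cells of distinct points overlap
    only on bisectors, where the sum has no meaning as a derivative; these belong to [crease]. *)
Definition dchi z : C := - \sum_(b <- net) cut (nearest b) (dtheta b r) z.

Lemma mset_nearest b : mset (nearest b).
Proof.
suff : forall s : seq C, mset [set z | forall b', b' \in s -> nrm (z - b) <= nrm (z - b')] by exact.
elim=> [|a s IH].
  rewrite (_ : [set z | _] = setT); first by apply: open_mset; exact: openT.
  by apply/seteqP; split.
rewrite (_ : [set z | _] = ~` [set z | 0 < nrm (z - b) - nrm (z - a)] `&`
   [set z | forall b', b' \in s -> nrm (z - b) <= nrm (z - b')]).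
  apply: msetI => //; apply: msetC; apply: mset_gt; apply: rmeasB; apply: cmeas_nrm;
    by apply: cmeas_cont => z _ e e0; exists e => // y; rewrite opprB addrA subrK.
apply/seteqP; split => z /= h.
  split; first by apply/negP; rewrite -leNgt subr_le0 h// mem_head.
  by move=> b' b's; apply: h; rewrite inE b's orbT.
by move=> b'; rewrite inE => /orP[/eqP ->|/h.2//]; have [/negP] := h; rewrite -leNgt subr_le0.
Qed.

Lemma cmeas_dchi : cmeas dchi.
Proof.
apply: cmeasN; elim: net => [|b s IH].
  by under eq_fun do rewrite big_nil; exact: cmeas_cst.
under eq_fun do rewrite big_cons; apply: cmeasD => //.
apply: cmeas_cut; first exact: mset_nearest.
apply: cmeas_cut; first exact: mset_ann.
apply: cmeasM; first exact: cmeas_cst.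
by apply: cmeas_cont => z _ e e0; exists e => // y; rewrite opprB addrA subrK.
Qed.

(* The set off which [chi] is differentiable. *)
Definition crease : set C :=
  \big[setU/set0]_(b <- net) ([set z | nrm (z - b) ^+ 2 = r ^+ 2] `|`
    [set z | nrm (z - b) ^+ 2 = 2 * r ^+ 2]) `|`
  \big[setU/set0]_(b <- net) \big[setU/set0]_(b' <- net)
    (if b == b' then set0 else [set z | nrm (z - b) = nrm (z - b')]).

Lemma null_crease : null crease.
Proof.
apply: nullU; apply: null_bigU => b; first by apply: nullU; exact: null_circle.
by apply: null_bigU => b'; case: ifPn => [_|]; [exact: null0|exact: null_bisector].
Qed.

Lemma dchi_eq b z : b \in net -> (forall b', b' \in net -> b' != b -> nrm (z - b) < nrm (z - b')) ->
  dchi z = - dtheta b r z.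
Proof.
move=> bn hb; rewrite /dchi (big_rem b)//= cutT; last first.
  by move=> b' b'n; have [->//|/hb/ltW] := eqVneq b' b; apply.
rewrite big_seq big1 ?addr0// => b' ; rewrite mem_rem_uniq// inE => /andP[b'b b'n].
by rewrite cutF// => /(_ b bn); rewrite leNgt hb.
Qed.

Lemma dchi_neq0 z : dchi z != 0 -> exists b, [/\ b \in net, nearest b z & ann b r z].
Proof.
move=> h; apply: contrapT => nb; move: h; apply/negP; rewrite negbK /dchi oppr_eq0 big_seq big1// => b bn.
have [hb|hb] := pselect (nearest b z); last by rewrite cutF.
have [ha|ha] := pselect (ann b r z); first by case: nb; exists b.
by rewrite cutT// /dtheta cutF.
Qed.

Lemma exists_nearest z b0 : b0 \in net -> exists2 b, b \in net & nearest b z.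
Proof.
suff h : forall s : seq C, b0 \in s ->
    exists2 b, b \in s & forall b', b' \in s -> nrm (z - b) <= nrm (z - b') by exact: h.
move=> s; elim: s b0 => // a [|c s] IH b0 _.
  by exists a; rewrite ?mem_head// => b'; rewrite inE => /eqP ->.
have [b bs hb] := IH c (mem_head _ _).
have [h|/ltW h] := leP (nrm (z - b)) (nrm (z - a)).
  exists b; first by rewrite inE bs orbT.
  by move=> b'; rewrite inE => /orP[/eqP ->|/hb].
exists a; first exact: mem_head.
move=> b'; rewrite inE => /orP[/eqP ->//|/hb]; exact: le_trans.
Qed.

(** Moving [z] by less than [d] changes each of the two distances by less than [d], so [b] stays
    nearest and [chi] is a single cutoff around [z]. *)
Lemma nearest_gap z b : (forall b', b' \in net -> b' != b -> nrm (z - b) < nrm (z - b')) ->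
  exists2 d : R, 0 < d & forall b', b' \in net -> b' != b -> nrm (z - b) + 2 * d <= nrm (z - b').
Proof.
elim: net => [|a s IH] h; first by exists 1.
have [|d d0 hd] := IH; first by move=> b' b's; apply: h; rewrite inE b's orbT.
have [ab|ab] := eqVneq a b.
  by exists d => // b'; rewrite inE => /orP[/eqP ->|]; [rewrite ab eqxx|exact: hd].
have ha := h a (mem_head _ _) ab.
exists (Num.min d ((nrm (z - a) - nrm (z - b)) / 2)); first by rewrite lt_min d0 divr_gt0// subr_gt0.
have m1 : Num.min d ((nrm (z - a) - nrm (z - b)) / 2) <= d by rewrite ge_min lexx.
have m2 : Num.min d ((nrm (z - a) - nrm (z - b)) / 2) <= (nrm (z - a) - nrm (z - b)) / 2.
  by rewrite ge_min lexx orbT.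
move=> b'; rewrite inE => /orP[/eqP ->|b's] b'b; first by move: m2; lra.
by have := hd b' b's b'b; move: m1; lra.
Qed.

Lemma ccvg_dchi z : ~ crease z -> ccvg (fun n => dbq n.+1%:R^-1 (fun y => (chi y)%:C) z) (dchi z).
Proof.
move=> ncr.
have [net0|[b0 b0n]] : net = [::] \/ exists b0, b0 \in net.
- by case: (net) => [|a s]; [left|right; exists a; exact: mem_head].
- rewrite /dchi net0 big_nil oppr0 (_ : (fun y => (chi y)%:C : C) = fun=> 1); first exact: ccvg_dbq_const.
  by apply/funext => y; rewrite /chi net0 big_nil.
have [b bn hb] := exists_nearest z b0n.
have hb' b' : b' \in net -> b' != b -> nrm (z - b) < nrm (z - b').
  move=> b'n b'b; rewrite lt_neqAle hb// andbT; apply/eqP => e; apply: ncr; right.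
  apply: (mem_bigU bn); apply: (mem_bigU b'n); by rewrite eq_sym (negbTE b'b).
have n1 : nrm (z - b) ^+ 2 != r ^+ 2.
  by apply/eqP => e; apply: ncr; left; apply: (mem_bigU bn); left.
have n2 : nrm (z - b) ^+ 2 != 2 * r ^+ 2.
  by apply/eqP => e; apply: ncr; left; apply: (mem_bigU bn); right.
rewrite (dchi_eq bn hb').
have [d d0 hd] := nearest_gap hb'.
apply: (@ccvg_dbq_local _ _ (fun y => 1 - (theta b r y)%:C)).
  exists d => // h hh; rewrite (@chi_eq b)// ?raddfB// => b' b'n.
  have [->//|/(hd _ b'n)] := eqVneq b' b.
  have := nrm_triangle (z + h) z b; have := nrm_triangle z (z + h) b'.
  by rewrite [z + h - z]addrAC subrr add0r (nrm_distC z (z + h)) [z + h - z]addrAC subrr add0r; move: hh; lra.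
have c : ccvg (fun n => 0 - dbq n.+1%:R^-1 (fun y => (theta b r y)%:C) z) (0 - dtheta b r z).
  by apply: ccvgB; [exact: ccvg_cst|exact: ccvg_dtheta].
move: c; rewrite sub0r; congr ccvg; apply/funext => n; rewrite /dbq; ring.
Qed.

End Cutoff.

(** * Pairing the cutoff with holomorphic functions *)

Section CutoffDbar.
Variable R : realType.
Local Notation C := (R[i]^o).
Variables (Om : set C) (S : R) (net : seq C) (r : R).
Hypothesis oOm : open Om.
Hypothesis S0 : 0 < S.
Hypothesis OmS : Om `<=` box 0 S.
Hypothesis net_uniq : uniq net.
Hypothesis r0 : 0 < r.
(** Points of [Om] within [r / 2] of the complement are so close to the net that [chi] vanishes
    there; this is the support margin asked by [weak_cauchy]. *)
Hypothesis net_fine : forall z y, Om z -> ~ Om y -> nrm (y - z) < r / 2 ->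
  exists2 b, b \in net & nrm (z - b) <= r.

(** This is [weak_cauchy_dbar] for the extension by zero of [chi * P], with the Leibniz rule for its
    d-bar derivative. *)
Lemma cutoff_dbar (f P dP : C -> C) (M A0 LP : R) :
  (forall z, Om z -> hol_at f z) -> (forall z, Om z -> nrm (f z) <= M) ->
  0 <= A0 -> (forall z, box 0 S z -> nrm (P z) <= A0) ->
  0 <= LP -> (forall z w, box 0 S z -> box 0 S w -> nrm (P z - P w) <= LP * nrm (z - w)) ->
  cmeas P -> cmeas dP -> (forall z, ccvg (fun n => dbq n.+1%:R^-1 P z) (dP z)) ->
  I (cut Om (fun z => (dchi net r z * P z + (chi net r z)%:C * dP z) * f z)) = 0.
Proof.
move=> hf fM A00 PA LP0 lP mP mdP cP.
set Phi := cut Om (fun z => (chi net r z)%:C * P z).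
have PhiT z : Om z -> Phi z = (chi net r z)%:C * P z by move=> Oz; rewrite /Phi cutT.
have PhiF z : ~ Om z -> Phi z = 0 by move=> Oz; rewrite /Phi cutF.
have c1 z : nrm (chi net r z)%:C <= 1 by rewrite nrm_real ger0_norm ?chi_ge0 ?chi_le1.
have marg z y : Phi z != 0 -> nrm (y - z) < r / 2 -> Om y.
  move=> Pz yz; have [Oz|/PhiF Pz0] := pselect (Om z); last by rewrite Pz0 eqxx in Pz.
  apply: contrapT => Oy; have [b bn] := net_fine Oz Oy yz.
  rewrite leNgt (chi_neq0 r0 bn)//; apply: contraNneq Pz => c0.
  by rewrite PhiT// c0 mul0r.
have PhiA z : nrm (Phi z) <= A0.
  have [Oz|/PhiF ->] := pselect (Om z); last by rewrite nrm0.
  by rewrite PhiT// nrmM -[leRHS]mul1r ler_pM ?nrm_ge0//; apply: PA; exact: OmS.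
(* From a nonzero value of [Phi] to a point off [Om] the distance is at least [r / 2], hence this
   slope across the boundary. *)
have cross z w : Om z -> ~ Om w -> nrm (Phi z - Phi w) <= 2 * A0 / r * nrm (z - w).
  move=> Oz Ow; rewrite (PhiF w Ow) subr0.
  have [->|Pz] := eqVneq (Phi z) 0; first by rewrite nrm0 !mulr_ge0 ?nrm_ge0// invr_ge0 ltW.
  have : r / 2 <= nrm (z - w).
    by rewrite leNgt nrm_distC; apply/negP => /(marg _ _ Pz).
  move=> h; apply: (le_trans (PhiA z)); apply: (@le_trans _ _ (2 * A0 / r * (r / 2))).
    by rewrite (_ : _ * _ = A0)//; field; exact: lt0r_neq0.
  by rewrite ler_wpM2l// !mulr_ge0// invr_ge0 ltW.
pose L := 4 / r * A0 + LP + 2 * A0 / r.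
have q1 : 0 <= 4 / r * A0 by rewrite !mulr_ge0// invr_ge0 ltW.
have q2 : 0 <= 2 * A0 / r by rewrite !mulr_ge0// invr_ge0 ltW.
have lPhi : lip L Phi.
  move=> z w; have [Oz|Oz] := pselect (Om z); have [Ow|Ow] := pselect (Om w).
  - rewrite !PhiT//.
    rewrite (_ : _ - _ = ((chi net r z)%:C - (chi net r w)%:C) * P z + (chi net r w)%:C * (P z - P w)); last by ring.
    apply: (le_trans (nrmD _ _)); rewrite !nrmM.
    have h1 : nrm ((chi net r z)%:C - (chi net r w)%:C) * nrm (P z) <= 4 / r * nrm (z - w) * A0.
      by apply: ler_pM; rewrite ?nrm_ge0//; [exact: chi_lip|exact: PA (OmS Oz)].
    have h2 : nrm (chi net r w)%:C * nrm (P z - P w) <= 1 * (LP * nrm (z - w)).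
      by apply: ler_pM; rewrite ?nrm_ge0//; exact: lP (OmS Oz) (OmS Ow).
    have := mulr_ge0 q2 (nrm_ge0 (z - w)); rewrite /L !mulrDl; move: h1 h2; rewrite mul1r.
    by rewrite (mulrAC (4 / r)); lra.
  - apply: (le_trans (cross _ _ Oz Ow)); rewrite ler_wpM2r ?nrm_ge0// /L; lra.
  - rewrite nrm_distC (nrm_distC z); apply: (le_trans (cross _ _ Ow Oz)).
    rewrite ler_wpM2r ?nrm_ge0// /L; lra.
  - by rewrite !PhiF// subrr nrm0 mulr_ge0 ?nrm_ge0// /L; lra.
pose D := cut Om (fun z => dchi net r z * P z + (chi net r z)%:C * dP z).
have mD : cmeas D.
  apply: cmeas_cut; first exact: open_mset.
  apply: cmeasD; apply: cmeasM => //; [exact: cmeas_dchi|exact: (lip_cmeas (chi_lip net r0))].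
have r2 : 0 < r / 2 by rewrite divr_gt0.
have PhiS z : Phi z != 0 -> box 0 S z.
  by move=> Pz; apply: OmS; apply: (marg z z Pz); rewrite subrr nrm0.
have cD z : ~ crease net r z -> ccvg (fun n => dbq n.+1%:R^-1 Phi z) (D z).
  move=> ncr; have [Oz|Oz] := pselect (Om z); last first.
    rewrite /D cutF//; apply: (@ccvg_dbq_local _ _ (fun=> 0)); last exact: ccvg_dbq_const.
    exists (r / 2) => // h hr; apply/eqP; apply: contrapT => /negP Pz; apply: Oz.
    by apply: (marg _ _ Pz); rewrite opprD addrA subrr sub0r nrmN.
  have [d d0 hd] := (openC Om).1 oOm z Oz.
  rewrite /D cutT//; apply: (@ccvg_dbq_local _ _ (fun y => (chi net r y)%:C * P y)).
    by exists d => // h hr; rewrite PhiT//; apply: hd; rewrite addrAC subrr add0r.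
  apply: (@ccvg_dbq_mul _ _ _ _ _ _ (4 / r) LP d) => //; last exact: ccvg_dchi.
    by move=> h _; have := chi_lip net r0 (z + h) z; rewrite [z + h - z]addrAC subrr add0r.
  move=> h hr; have Oh : Om (z + h) by apply: hd; rewrite addrAC subrr add0r.
  by have := lP _ _ (OmS Oh) (OmS Oz); rewrite [z + h - z]addrAC subrr add0r.
rewrite -(weak_cauchy_dbar oOm hf fM lPhi PhiA S0 PhiS r2 marg (null_crease net r) mD cD).
congr I; apply/funext => z; have [Oz|Oz] := pselect (Om z); last by rewrite !cutF// mulr0.
by rewrite /D !cutT.
Qed.

Lemma pev_lip (p : {poly R[i]}) : exists2 L : R, 0 <= L & forall z w, box 0 S z -> box 0 S w ->
  nrm (pev p z - pev p w) <= L * nrm (z - w).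
Proof.
elim/poly_ind: p => [|p c [L L0 hL]].
  by exists 0 => // z w _ _; rewrite /pev !horner0 subrr nrm0 mul0r.
have [M M0 hM] := pev_bounded S0 p.
exists (L * (2 * S) + M) => [|z w bz bw]; first by rewrite addr_ge0// !mulr_ge0// ltW.
rewrite /pev !hornerD !hornerC !hornerM !hornerX -/(pev p z) -/(pev p w).
rewrite (_ : _ - _ = (pev p z - pev p w) * z + pev p w * (z - w)); last by ring.
rewrite (le_trans (nrmD _ _))// !nrmM mulrDl lerD//; last by rewrite ler_wpM2r ?nrm_ge0// hM.
rewrite mulrAC ler_pM ?nrm_ge0//; first exact: hL.
by have := box_nrm bz; rewrite subr0.
Qed.

Lemma pev_cmeas (p : {poly R[i]}) : cmeas (pev p).
Proof.
apply: cmeas_cont; apply: hol_ccont => z _; exists (pev p^`() z); exact: cdiff_pev.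
Qed.

Lemma nrm_dtheta (b z : C) : nrm (dtheta b r z) <= 4 / r.
Proof.
have r4 : 0 <= 4 / r by rewrite divr_ge0// ltW.
have [h|h] := pselect (ann b r z); last by rewrite /dtheta cutF// nrm0.
rewrite /dtheta cutT// nrmM nrmN nrm_real ger0_norm ?divr_ge0 ?exprn_ge0 ?(ltW r0)//.
have [_ /ltW h2] := ann_lt r0 h.
rewrite (_ : 4 / r = 2 / r ^+ 2 * (2 * r)); last by field; exact: lt0r_neq0.
by rewrite ler_wpM2l// divr_ge0 ?exprn_ge0 ?(ltW r0).
Qed.

Lemma nrm_dchi z : nrm (dchi net r z) <= (size net)%:R * (4 / r).
Proof.
rewrite /dchi nrmN; apply: (le_trans (nrm_sum _ _ _)).
rewrite (_ : _ * _ = \sum_(b <- net) 4 / r); last first.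
  by rewrite big_const_seq count_predT iter_addr_0 mulr_natl.
apply: ler_sum => b _; have [h|h] := pselect (nearest net b z); first by rewrite cutT// nrm_dtheta.
by rewrite cutF// nrm0 divr_ge0// ltW.
Qed.

Lemma cint_cutM (g f : C -> C) (K M : R) : cmeas g -> (forall z, box 0 S z -> nrm (g z) <= K) ->
  (forall z, Om z -> hol_at f z) -> (forall z, Om z -> nrm (f z) <= M) ->
  cint (fun z => g z * cut Om f z).
Proof.
move=> mg gK hf fM; have mf : cmeas (cut Om f) by exact: hol_cmeas.
apply: (@cint_box _ 0 S (K * `|M|) _ (ltW S0) (cmeasM mg mf)) => z hz; last first.
  by rewrite cutF ?mulr0// => /OmS.
rewrite nrmM ler_pM ?nrm_ge0//; first exact: gK.
have [Oz|Oz] := pselect (Om z); last by rewrite cutF// nrm0.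
by rewrite cutT// (le_trans (fM _ Oz))// ler_norm.
Qed.

(* Pairing the d-bar identities of [chi p] with [f2] and of [chi conj(p)] with [f1]
   leaves only terms supported in the boundary layer. *)
Lemma cutoff_layer (f1 f2 : C -> C) (p : {poly R[i]}) (M : R) :
  (forall z, Om z -> hol_at f1 z) -> (forall z, Om z -> hol_at f2 z) ->
  (forall z, Om z -> nrm (f1 z) <= M) -> (forall z, Om z -> nrm (f2 z) <= M) ->
  2 * I (cut Om (fun z => (chi net r z)%:C * (pev p^`() z * (f1 z)^*))) =
  I (cut Om (fun z => pev p z * (dchi net r z * f2 z - (dchi net r z * f1 z)^*))).
Proof.
move=> h1 h2 b1 b2.
have [A0 A00 PA] := pev_bounded S0 p; have [A1 A10 PA1] := pev_bounded S0 p^`().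
have [LP LP0 lP] := pev_lip p.
have E2 := cutoff_dbar h2 b2 A00 PA LP0 lP (pev_cmeas p) (cmeas_cst 0)
  (fun z => ccvg_dbq_hol (cdiff_pev p z)).
have E1 := @cutoff_dbar f1 (fun z => (pev p z)^*) (fun z => 2 * (pev p^`() z)^*) M A0 LP h1 b1 A00.
have {}E1 : I (cut Om (fun z => (dchi net r z * (pev p z)^* +
    (chi net r z)%:C * (2 * (pev p^`() z)^*)) * f1 z)) = 0.
  apply: E1 => //.
  - by move=> z /PA; rewrite nrm_conj.
  - by move=> z w bz bw; rewrite -rmorphB nrm_conj; exact: lP.
  - by apply: cmeas_conj; exact: pev_cmeas.
  - by apply: cmeasM; [exact: cmeas_cst|apply: cmeas_conj; exact: pev_cmeas].
  - by move=> z; apply: ccvg_dbq_conj; exact: cdiff_pev.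
have mO := open_mset oOm.
have m1 : cmeas (cut Om f1) by exact: hol_cmeas.
have m2 : cmeas (cut Om f2) by exact: hol_cmeas.
have md := cmeas_dchi net r.
have mc := lip_cmeas (chi_lip net r0).
have mp := pev_cmeas p; have mp' := pev_cmeas p^`().
have c1 z : nrm (chi net r z)%:C <= 1 by rewrite nrm_real ger0_norm ?chi_ge0 ?chi_le1.
pose K := (size net)%:R * (4 / r).
have dK z : nrm (dchi net r z) <= K by exact: nrm_dchi.
have i2 : cint (fun z => dchi net r z * pev p z * cut Om f2 z).
  apply: (@cint_cutM _ _ (K * A0) M) => //; first exact: cmeasM.
  by move=> z bz; rewrite nrmM ler_pM ?nrm_ge0// PA.
have i1 : cint (fun z => dchi net r z * (pev p z)^* * cut Om f1 z).
  apply: (@cint_cutM _ _ (K * A0) M) => //; first by apply: cmeasM => //; exact: cmeas_conj.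
  by move=> z bz; rewrite nrmM nrm_conj ler_pM ?nrm_ge0// PA.
have i3 : cint (fun z => (chi net r z)%:C * (pev p^`() z)^* * cut Om f1 z).
  apply: (@cint_cutM _ _ (1 * A1) M) => //; first by apply: cmeasM => //; exact: cmeas_conj.
  by move=> z bz; rewrite nrmM nrm_conj ler_pM ?nrm_ge0// PA1.
have F2 : I (fun z => dchi net r z * pev p z * cut Om f2 z) = 0.
  rewrite -E2; congr I; apply/funext => z; have [Oz|Oz] := pselect (Om z).
    by rewrite !cutT// mulr0 addr0.
  by rewrite !cutF// mulr0.
have F1 : I (fun z => dchi net r z * (pev p z)^* * cut Om f1 z) +
    2 * I (fun z => (chi net r z)%:C * (pev p^`() z)^* * cut Om f1 z) = 0.
  rewrite -E1 -IZ// -ID//; last exact: cintZ.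
  congr I; apply/funext => z; have [Oz|Oz] := pselect (Om z).
    by rewrite !cutT//; ring.
  by rewrite !cutF// !mulr0 addr0.
rewrite (_ : cut Om (fun z => pev p z * _) = fun z => dchi net r z * pev p z * cut Om f2 z -
    (dchi net r z * (pev p z)^* * cut Om f1 z)^*); last first.
  apply/funext => z; have [Oz|Oz] := pselect (Om z); last by rewrite !cutF// !mulr0 rmorph0 subr0.
  rewrite !cutT//; move: (dchi _ _ _) (pev _ _) (f1 z) (f2 z) => d q u v.
  by case: d q u v => [d1 d2] [q1 q2] [u1 u2] [v1 v2]; apply: complex_ext => /=; ring.
rewrite IB//; last exact: cint_conj.
rewrite F2 I_conj// sub0r.
rewrite (_ : cut Om _ = fun z => ((chi net r z)%:C * (pev p^`() z)^* * cut Om f1 z)^*); last first.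
  apply/funext => z; have [Oz|Oz] := pselect (Om z); last by rewrite !cutF// !mulr0 rmorph0.
  rewrite !cutT//; move: (chi _ _ _) (pev _ _) (f1 z) => d q u.
  by case: q u => [q1 q2] [u1 u2]; apply: complex_ext => /=; ring.
rewrite I_conj//; move/eqP: F1; rewrite addr_eq0 => /eqP ->.
by move: (I _) => [a b]; apply: complex_ext => /=; ring.
Qed.

End CutoffDbar.

(** * Size of the boundary layer integrals *)

Section BoundaryLayer.
Variable R : realType.
Local Notation C := (R[i]^o).

(** The formula for [dchi] by the nearest point holds off [crease] only, so the pointwise bound is
    asked outside a null set. *)
Lemma nrm_I_ae (g : C -> C) (f : C -> R) (N : set C) : null N -> cint g -> rint f ->
  (forall z, 0 <= f z) -> (forall z, ~ N z -> nrm (g z) <= f z) -> nrm (I g) <= 2 * J f.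
Proof.
move=> [mN N0] ig fi f0 gf; have mg := cint_meas ig.
have mg' : cmeas (cut (~` N) g) by apply: cmeas_cut => //; exact: msetC.
have ig' : cint (cut (~` N) g).
  apply: (cint_le mg' (cint_nrm ig)) => z; rewrite ger0_norm ?nrm_ge0//.
  by have [h|h] := pselect ((~` N) z); [rewrite cutT|rewrite cutF// nrm0 nrm_ge0].
have -> : I g = I (cut (~` N) g).
  (* Dominated convergence for a constant sequence: changing [g] on a null set does not change its
     integral. *)
  apply: (ccvg_unique (u := fun=> I (cut (~` N) g))); last exact: ccvg_cst.
  apply: (@I_dct _ _ _ (fun z => nrm (g z)) N) => //; first exact: cint_nrm.
    move=> _ z; have [h|h] := pselect ((~` N) z); first by rewrite cutT.
    by rewrite cutF// nrm0 nrm_ge0.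
  by move=> z Nz; rewrite cutT//; exact: ccvg_cst.
apply: (le_trans (nrm_I ig')); rewrite ler_wpM2l//; apply: J_le => //; first exact: cint_nrm.
move=> z; have [h|h] := pselect ((~` N) z); first by rewrite cutT// gf.
by rewrite cutF// nrm0.
Qed.

Lemma rint_ind_boxes (cs : seq C) (s : R) : 0 <= s ->
  rint (fun z => \sum_(c <- cs) ind (box c s) z) /\
  J (fun z => \sum_(c <- cs) ind (box c s) z) = (size cs)%:R * (2 * s) ^+ 2.
Proof.
move=> s0; elim: cs => [|c cs [IH1 IH2]].
  rewrite (_ : (fun z => _) = fun=> 0); last by apply/funext => z; rewrite big_nil.
  by rewrite mul0r; split; [exact: rint0|exact: J_cst0].
rewrite (_ : (fun z => _) = fun z => ind (box c s) z + \sum_(c <- cs) ind (box c s) z); last first.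
  by apply/funext => z; rewrite big_cons.
have i1 := rint_ind_box c s0; split; first exact: rintD.
by rewrite JD// IH2 J_ind_box//= -[(size cs).+1%:R]natr1; ring.
Qed.

Variables (Om : set C) (S : R) (net cs : seq C) (r : R).
Hypothesis oOm : open Om.
Hypothesis S0 : 0 < S.
Hypothesis OmS : Om `<=` box 0 S.
Hypothesis net_uniq : uniq net.
Hypothesis r0 : 0 < r.
Hypothesis net_fine : forall z y, Om z -> ~ Om y -> nrm (y - z) < r / 2 ->
  exists2 b, b \in net & nrm (z - b) <= r.
(** The size of the coarse net [cs] enters the final bound; that of [net] does not. *)
Hypothesis coarse : forall b, b \in net -> exists2 c, c \in cs & nrm (b - c) <= r.

Let cint_cutMC (g f : C -> C) (K M : R) : cmeas g -> (forall z, box 0 S z -> nrm (g z) <= K) ->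
  (forall z, Om z -> hol_at f z) -> (forall z, Om z -> nrm (f z) <= M) ->
  cint (cut Om (fun z => g z * (f z)^*)).
Proof.
move=> mg gK hf fM.
rewrite (_ : cut Om _ = fun z => ((g z)^* * cut Om f z)^*).
  apply: cint_conj; apply: (cint_cutM oOm S0 OmS (cmeas_conj mg) _ hf fM (K := K)) => z bz.
  by rewrite nrm_conj gK.
apply/funext => z; have [Oz|Oz] := pselect (Om z); last by rewrite !cutF// mulr0 rmorph0.
by rewrite !cutT//; move: (g z) (f z) => [x1 x2] [y1 y2]; apply: complex_ext => /=; ring.
Qed.

(** Points within [2 * r] of the net are within [3 * r] of [cs]: [cover] is at least 1 on the layer,
    and its integral bounds the area. *)
Let cover (z : C) : R := \sum_(c <- cs) ind (box c (3 * r)) z.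

Let cover_ge0 z : 0 <= cover z.
Proof. by apply: sumr_ge0 => c _; exact: ind_ge0. Qed.

Let cover_ge1 b z : b \in net -> nrm (z - b) <= 2 * r -> 1 <= cover z.
Proof.
move=> /coarse[c cc bc] zb; rewrite /cover (big_rem c)//= indT.
  by rewrite lerDl; apply: sumr_ge0 => a _; exact: ind_ge0.
apply: disc_box => /=; apply: (le_trans (nrm_triangle z b c)); lra.
Qed.

(** Split 1 as [chi + (1 - chi)]. The first part is half the layer integral of [cutoff_layer], where
    [E] bounds the integrand up to [A0 * (2 / r ^+ 2)]; the second lives on the layer. Each box
    contributes the area [36 * r ^+ 2], and 72 is twice 36. *)
Lemma layer_estimate (f1 f2 : C -> C) (p : {poly R[i]}) (M E A0 A1 : R) :
  (forall z, Om z -> hol_at f1 z) -> (forall z, Om z -> hol_at f2 z) ->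
  (forall z, Om z -> nrm (f1 z) <= M) -> (forall z, Om z -> nrm (f2 z) <= M) ->
  0 <= M -> 0 <= A0 -> 0 <= A1 ->
  (forall z, box 0 S z -> nrm (pev p z) <= A0) ->
  (forall z, box 0 S z -> nrm (pev p^`() z) <= A1) -> 0 <= E ->
  (forall z b, Om z -> b \in net -> nearest net b z -> ann b r z ->
     nrm ((z - b) * f2 z - ((z - b) * f1 z)^*) <= E) ->
  nrm (I (cut Om (fun z => pev p^`() z * (f1 z)^*))) <=
    72 * (size cs)%:R * (A0 * E + A1 * M * r ^+ 2).
Proof.
move=> h1 h2 b1 b2 M0 A00 A10 PA PA1 E0 hE.
have r30 : 0 <= 3 * r by rewrite mulr_ge0// ltW.
have [ci cJ] := rint_ind_boxes cs r30.
have {}ci : rint cover by exact: ci.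
have {}cJ : J cover = (size cs)%:R * (2 * (3 * r)) ^+ 2 by exact: cJ.
have lay := cutoff_layer oOm S0 OmS net_uniq r0 net_fine p h1 h2 b1 b2.
have mp := pev_cmeas p; have mp' := pev_cmeas p^`().
have mc := lip_cmeas (chi_lip net r0).
have c1 z : nrm (chi net r z)%:C <= 1 by rewrite nrm_real ger0_norm ?chi_ge0 ?chi_le1.
have c1' z : nrm (1 - (chi net r z)%:C) <= 1.
  rewrite (_ : 1 - _ = (1 - chi net r z)%:C); last by apply: complex_ext => /=; ring.
  rewrite nrm_real ger0_norm ?subr_ge0 ?chi_le1//.
  by rewrite gerBl chi_ge0.
have k1 z : box 0 S z -> nrm ((chi net r z)%:C * pev p^`() z) <= 1 * A1.
  by move=> bz; rewrite nrmM ler_pM ?nrm_ge0// PA1.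
have k2 z : box 0 S z -> nrm ((1 - (chi net r z)%:C) * pev p^`() z) <= 1 * A1.
  by move=> bz; rewrite nrmM ler_pM ?nrm_ge0// PA1.
have i3 : cint (cut Om (fun z => (chi net r z)%:C * (pev p^`() z * (f1 z)^*))).
  by under eq_fun do rewrite mulrA; apply: cint_cutMC k1 h1 b1; exact: cmeasM.
have i4 : cint (cut Om (fun z => (1 - (chi net r z)%:C) * (pev p^`() z * (f1 z)^*))).
  under eq_fun do rewrite mulrA; apply: cint_cutMC k2 h1 b1; apply: cmeasM => //.
  by apply: cmeasB => //; exact: cmeas_cst.
have i5 : cint (cut Om (fun z => pev p z * (dchi net r z * f2 z - (dchi net r z * f1 z)^*))).
  have md := cmeas_dchi net r; have dK := nrm_dchi net r0.
  have k3 z : box 0 S z -> nrm (pev p z * dchi net r z) <= A0 * ((size net)%:R * (4 / r)).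
    by move=> bz; rewrite nrmM ler_pM ?nrm_ge0// PA.
  have k4 z : box 0 S z -> nrm (pev p z * (dchi net r z)^*) <= A0 * ((size net)%:R * (4 / r)).
    by move=> bz; rewrite nrmM nrm_conj ler_pM ?nrm_ge0// PA.
  rewrite (_ : cut Om _ = fun z => pev p z * dchi net r z * cut Om f2 z -
      cut Om (fun z => pev p z * (dchi net r z)^* * (f1 z)^*) z).
    apply: cintB; first by apply: (cint_cutM oOm S0 OmS (cmeasM mp md) k3 h2 b2).
    by apply: cint_cutMC k4 h1 b1; apply: cmeasM => //; exact: cmeas_conj.
  apply/funext => z; have [Oz|Oz] := pselect (Om z); last by rewrite !cutF// mulr0 subr0.
  rewrite !cutT//; move: (dchi _ _ _) (pev _ _) (f1 z) (f2 z) => [d1 d2] [q1 q2] [u1 u2] [v1 v2].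
  by apply: complex_ext => /=; ring.
have -> : I (cut Om (fun z => pev p^`() z * (f1 z)^*)) =
    I (cut Om (fun z => (chi net r z)%:C * (pev p^`() z * (f1 z)^*))) +
    I (cut Om (fun z => (1 - (chi net r z)%:C) * (pev p^`() z * (f1 z)^*))).
  rewrite -ID//; congr I; apply/funext => z; have [Oz|Oz] := pselect (Om z).
    by rewrite !cutT//; ring.
  by rewrite !cutF// addr0.
have B1 : nrm (I (cut Om (fun z => (1 - (chi net r z)%:C) * (pev p^`() z * (f1 z)^*)))) <=
    2 * (A1 * M * J cover).
  rewrite -JZ//; apply: (nrm_I_ae (null0 R) i4); first exact: rintZ.
    by move=> z; rewrite !mulr_ge0.
  move=> z _; have [Oz|Oz] := pselect (Om z); last by rewrite cutF// nrm0 !mulr_ge0.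
  rewrite cutT//; have [c|c] := eqVneq (chi net r z) 1; first by rewrite c subrr mul0r nrm0 !mulr_ge0.
  have [b bn zb] : exists2 b, b \in net & nrm (z - b) < 2 * r.
    apply: contrapT => h; move/eqP: c; apply; apply: chi_eq1 => // b bn.
    by rewrite leNgt; apply/negP => zb; apply: h; exists b.
  have cov := cover_ge1 bn (ltW zb).
  rewrite nrmM nrmM nrm_conj mulrC ler_pM ?mulr_ge0 ?nrm_ge0//; last exact: le_trans (c1' z) cov.
  by rewrite ler_pM ?nrm_ge0 ?b1// PA1//; exact: OmS.
have B2 : nrm (I (cut Om (fun z => pev p z * (dchi net r z * f2 z - (dchi net r z * f1 z)^*)))) <=
    2 * (A0 * (2 / r ^+ 2 * E) * J cover).
  have K0 : 0 <= A0 * (2 / r ^+ 2 * E) by rewrite !mulr_ge0// invr_ge0 exprn_ge0// ltW.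
  rewrite -JZ//; apply: (nrm_I_ae (null_crease net r) i5); first exact: rintZ.
    by move=> z; rewrite mulr_ge0.
  move=> z ncr; have [Oz|Oz] := pselect (Om z); last by rewrite cutF// nrm0 mulr_ge0.
  rewrite cutT//; have [c|c] := eqVneq (dchi net r z) 0.
    by rewrite c !mul0r rmorph0 subr0 mulr0 nrm0 mulr_ge0.
  have [b [bn nb ab]] := dchi_neq0 c.
  have [_ /ltW zb] := ann_lt r0 ab; have cov := cover_ge1 bn zb.
  have db : dchi net r z = (2 / r ^+ 2)%:C * (z - b).
    rewrite (dchi_eq _ net_uniq bn); last first.
      move=> b' b'n b'b; rewrite lt_neqAle nb// andbT; apply/eqP => e; apply: ncr; right.
      by apply: (mem_bigU bn); apply: (mem_bigU b'n); rewrite eq_sym (negbTE b'b).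
    by rewrite /dtheta cutT// mulNr opprK.
  rewrite nrmM -[leLHS]mulr1 ler_pM ?mulr_ge0 ?nrm_ge0// ler_pM ?nrm_ge0//; first exact: PA (OmS Oz).
  rewrite db (_ : _ - _ = (2 / r ^+ 2)%:C * ((z - b) * f2 z - ((z - b) * f1 z)^*)); last first.
    by move: (2 / _) (z - b) (f1 z) (f2 z) => k [d1 d2] [u1 u2] [v1 v2]; apply: complex_ext => /=; ring.
  rewrite nrmM nrm_real ger0_norm ?divr_ge0 ?exprn_ge0 ?(ltW r0)// ler_wpM2l//; last exact: hE.
  by rewrite divr_ge0 ?exprn_ge0 ?(ltW r0).
rewrite -lay nrmM in B2.
clear k1 k2 i3 i4 i5 lay.
have two : nrm (2 : C) = 2.
  by rewrite (_ : (2 : C) = (2 : R)%:C) ?nrm_real ?ger0_norm// rmorphMn rmorph1.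
rewrite two in B2; apply: (le_trans (nrmD _ _)).
have r2 : 0 < r ^+ 2 by rewrite exprn_gt0.
have Ec : A0 * (2 / r ^+ 2 * E) * J cover = 72 * (size cs)%:R * (A0 * E).
  by rewrite cJ; field; exact: lt0r_neq0.
rewrite Ec in B2.
have Ed : A1 * M * J cover = 36 * (size cs)%:R * (A1 * M * r ^+ 2) by rewrite cJ; ring.
rewrite Ed in B1.
lra.
Qed.

End BoundaryLayer.

(** * Analytic boundary curves *)

Section StrictDerivative.
Variable R : realType.
Local Notation C := (R[i]^o).

Lemma exprB_bound (x y r : R) k : `|x| <= r -> `|y| <= r ->
  `|x ^+ k.+1 - y ^+ k.+1| <= k.+1%:R * r ^+ k * `|x - y|.
Proof.
move=> xr yr; have r0 : 0 <= r by exact: le_trans xr.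
elim: k => [|k IH]; first by rewrite !expr1 expr0 !mul1r.
rewrite exprS [y ^+ k.+2]exprS.
rewrite (_ : _ - _ = x * (x ^+ k.+1 - y ^+ k.+1) + (x - y) * y ^+ k.+1); last by ring.
apply: (le_trans (ler_normD _ _)); rewrite !normrM normrX.
have h1 : `|x| * `|x ^+ k.+1 - y ^+ k.+1| <= r * (k.+1%:R * r ^+ k * `|x - y|).
  by apply: ler_pM.
have h2 : `|x - y| * `|y| ^+ k.+1 <= `|x - y| * r ^+ k.+1 by rewrite ler_wpM2l// lerXn2r ?nnegrE.
apply: (le_trans (lerD h1 h2)); rewrite -[k.+2%:R]natr1 exprS.
by move: (r ^+ k) (k.+1%:R) (`|x - y|) => a b c; rewrite le_eqVlt; apply/orP; left; apply/eqP; ring.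
Qed.

(** Since [2 * r <= rho], the increment of the term of degree [k + 2] is at most the common factor
    times [(k + 2) / 2 ^+ k]; the last factor is the sum of these over [k < n], and it stays below
    6. *)
Lemma poly_strict (a : nat -> R) (M rho r x y : R) : 0 < rho -> 0 <= M ->
  (forall k, `|a k| * rho ^+ k <= M) -> 2 * r <= rho -> `|x| <= r -> `|y| <= r -> forall n,
  `|\sum_(0 <= i < n.+2) a i * x ^+ i - \sum_(0 <= i < n.+2) a i * y ^+ i - a 1%N * (x - y)| <=
   M * r / rho ^+ 2 * `|x - y| * (6 - (2 * n%:R + 6) / 2 ^+ n).
Proof.
move=> p0 M0 aM rp xr yr; have r0 : 0 <= r by exact: le_trans xr.
elim=> [|n IH].
  rewrite !big_nat_recr//= !big_geq// !add0r !expr0 !expr1.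
  rewrite (_ : _ - _ - _ = 0); last by ring.
  by rewrite normr0 mulr0 add0r divr1 subrr mulr0.
rewrite big_nat_recr//= [X in _ - X - _]big_nat_recr//=.
rewrite (_ : _ - _ - _ = (\sum_(0 <= i < n.+2) a i * x ^+ i - \sum_(0 <= i < n.+2) a i * y ^+ i - a 1%N * (x - y)) + a n.+2 * (x ^+ n.+2 - y ^+ n.+2)); last first.
  by move: (\sum_(_ <= _ < _) _) (\sum_(_ <= _ < _) _) (x ^+ _) (y ^+ _) => A B u v; ring.
apply: (le_trans (ler_normD _ _)).
have step : `|a n.+2 * (x ^+ n.+2 - y ^+ n.+2)| <= M * r / rho ^+ 2 * `|x - y| * (n.+2%:R / 2 ^+ n).
  rewrite normrM; apply: (le_trans (ler_wpM2l (normr_ge0 _) (exprB_bound n.+1 xr yr))).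
  have rn : r ^+ n * 2 ^+ n <= rho ^+ n by rewrite -exprMn lerXn2r ?nnegrE ?mulr_ge0 ?(ltW p0)// mulrC.
  have rp0 : 0 < rho ^+ n by rewrite exprn_gt0.
  have tp0 : (0 : R) < 2 ^+ n by rewrite exprn_gt0.
  have := aM n.+2; rewrite !exprS; move: rn rp0 tp0; have := normr_ge0 (a n.+2); have := normr_ge0 (x - y).
  move: (`|a _|) (`|x - y|) (rho ^+ n) (r ^+ n) (2 ^+ n) n.+2%:R (ler0n R n.+2) => A X pn rn tn N N0 X0 A0 h pn0 tn0 hA.
  rewrite expr0 mulr1.
  rewrite [leRHS](_ : _ = (M * r * X * N) / (rho * rho * tn)); last by field; rewrite !gt_eqF.
  rewrite ler_pdivlMr ?mulr_gt0//.
  rewrite [leLHS](_ : _ = (A * (rho * rho) * (rn * tn)) * (r * X * N)); last by ring.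
  rewrite (_ : M * r * X * N = M * (r * X * N)); last by ring.
  rewrite ler_wpM2r ?mulr_ge0//; apply: le_trans hA.
  rewrite [leRHS](_ : _ = A * (rho * rho) * pn); last by ring.
  by rewrite ler_wpM2l// !mulr_ge0// ltW.
apply: (le_trans (lerD IH step)); rewrite -mulrDr ler_wpM2l ?mulr_ge0 ?invr_ge0 ?exprn_ge0 ?(ltW p0)//.
have tp0 : (0 : R) < 2 ^+ n by rewrite exprn_gt0.
have e1 : n.+1%:R = n%:R + 1 :> R by rewrite natr1.
have e2 : n.+2%:R = n%:R + 2 :> R by rewrite -addn2 natrD.
rewrite exprS e1 e2; move: (2 ^+ n) tp0 n%:R => t t0 N.
by rewrite le_eqVlt; apply/orP; left; apply/eqP; field; rewrite gt_eqF.
Qed.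

(** Strict differentiability: both points vary. It yields continuity of the derivative and
    first-order approximation uniform in the base point. *)
Definition strict (f : R -> R) (t l : R) : Prop := forall e : R, 0 < e ->
  exists2 d : R, 0 < d & forall x y, `|x - t| < d -> `|y - t| < d ->
    `|f x - f y - l * (x - y)| <= e * `|x - y|.

(** Convergence at [d / 2] bounds the terms [a k * (d / 2) ^+ k], so [poly_strict] controls all
    partial sums at once by O(r) times the increment, and the bound passes to the limit. *)
Lemma analytic_strict f t : real_analytic f -> strict f t (derive1 f t).
Proof.
move=> fa; have [a ha] := fa t.
have [d d0 hd] : exists2 d : R, 0 < d & forall x, `|x| < d -> pseries a x @ \oo --> f (t + x).
  move: ha => /nbhs_ballP[d /= d0 hd]; exists d => // x xd.
  have := hd (t + x); rewrite /ball /= opprD addrA subrr sub0r normrN => /(_ xd).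
  by rewrite addrAC subrr add0r.
have p0 : 0 < d / 2 by rewrite divr_gt0.
have [M M0 hM] : exists2 M, 0 <= M & forall k, `|a k| * (d / 2) ^+ k <= M.
  have : cvgn (pseries a (d / 2)).
    by apply/cvg_ex; exists (f (t + d / 2)); apply: hd; rewrite gtr0_norm//; lra.
  move=> /cvg_series_bounded[M [_ hM]]; exists (`|M| + 1) => [|k]; first by rewrite addr_ge0.
  have := hM (`|M| + 1); rewrite (le_lt_trans (ler_norm M)) ?ltrDl// => /(_ isT k Logic.I).
  by rewrite /= normrM normrX (gtr0_norm p0).
suff S : strict f t (a 1%N).
  suff -> : derive1 f t = a 1%N by [].
  apply: derive1_eps => e /S[d1 d10 hd1]; exists d1 => // h hh.
  have := hd1 (t + h) t; rewrite subrr normr0 addrAC subrr add0r; exact.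
move=> e e0.
have M1 : 0 < 6 * (M + 1) by rewrite mulr_gt0// ltr_wpDl.
pose r := Num.min (d / 4) (e * (d / 2) ^+ 2 / (6 * (M + 1))).
have r0 : 0 < r by rewrite lt_min divr_gt0//= divr_gt0// mulr_gt0// exprn_gt0.
have rd : 2 * r <= d / 2.
  have : r <= d / 4 by rewrite ge_min lexx.
  lra.
have re : M * r / (d / 2) ^+ 2 * 6 <= e.
  have : r <= e * (d / 2) ^+ 2 / (6 * (M + 1)) by rewrite ge_min lexx orbT.
  rewrite ler_pdivlMr// => h; rewrite mulrAC ler_pdivrMr ?exprn_gt0//; apply: le_trans h.
  by rewrite mulrAC mulrC ler_wpM2l ?(ltW r0)//; lra.
exists r => // x y /ltW xr /ltW yr.
have xd : `|x - t| < d by lra.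
have yd : `|y - t| < d by lra.
have := hd _ xd; have := hd _ yd; rewrite ![t + _]addrC !subrK => cy cx.
have c : (fun n => `|pseries a (x - t) n - pseries a (y - t) n - a 1%N * (x - y)|) @ \oo -->
    `|f x - f y - a 1%N * (x - y)|.
  by apply: cvg_norm; apply: cvgB; [exact: cvgB|exact: cvg_cst].
rewrite -(cvg_lim _ c)//; apply: limr_le; first by apply/cvg_ex; eexists; exact: c.
exists 2%N => // -[|[|n]]// _ /=.
have := poly_strict p0 M0 hM rd xr yr n.
rewrite (_ : x - t - (y - t) = x - y); last by ring.
move=> /le_trans; apply.
have k0 : 0 <= M * r / (d / 2) ^+ 2 * `|x - y|.
  by rewrite !mulr_ge0 ?invr_ge0 ?exprn_ge0 ?(ltW r0)// ltW.
apply: (@le_trans _ _ (M * r / (d / 2) ^+ 2 * `|x - y| * 6)).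
  by rewrite ler_wpM2l// gerBl divr_ge0 ?exprn_ge0// addr_ge0// mulr_ge0.
by rewrite mulrAC ler_wpM2r.
Qed.

End StrictDerivative.

(** * Uniform estimates along the boundary curves *)

Section CurveUniformity.
Variable R : realType.
Local Notation C := (R[i]^o).

(** Transfers [compact_ind] to [[0, 1]], seen as a segment of the complex plane. *)
Lemma segment_unif (P : R -> R -> Prop) :
  (forall t m m', 0 < m' -> m' <= m -> P t m -> P t m') ->
  (forall t0, exists d m : R, [/\ 0 < d, 0 < m & forall t, `|t - t0| < d -> P t m]) ->
  exists2 m : R, 0 < m & forall t, 0 <= t <= 1 -> P t m.
Proof.
move=> mono loc.
pose K : set C := [set z | 0 <= complex.Re z <= 1 /\ complex.Im z = 0].
pose Q (A : set C) := exists2 m : R, 0 < m & forall z, A z -> P (complex.Re z) m.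
suff [m m0 hm] : Q K by exists m => // t h; apply: (hm (t%:C)).
have cK : closed K.
  move=> p cp; have near (e : R) : 0 < e -> exists2 z, K z & nrm (z - p) < e.
    exact: closureC.
  split; first (apply/andP; split).
  - apply/ler_addgt0Pr => e /near[z [/andP[z0 _] _] zp].
    have := abs_Re_le (z - p); rewrite ReD ReN ler_norml => /andP[_ h]; lra.
  - apply/ler_addgt0Pr => e /near[z [/andP[_ z1] _] zp].
    have := abs_Re_le (z - p); rewrite ReD ReN ler_norml => /andP[h _]; lra.
  - apply/eqP; rewrite -normr_le0; apply/ler_addgt0Pr => e /near[z [_ zi] zp].
    by have := abs_Im_le (z - p); rewrite ImD ImN zi sub0r normrN; lra.
apply: (compact_ind cK (ltr01 : 0 < (1 : R))).
- by move=> z [/andP[z0 z1] zi]; split; rewrite /= subr0 ?zi ?normr0// ger0_norm.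
- by exists 1.
- by move=> A B AB [m m0 hm]; exists m => // z /AB /hm.
- move=> A B [m m0 hm] [m' m'0 hm']; exists (Num.min m m'); first by rewrite lt_min m0.
  by move=> z [/hm|/hm']; apply: mono; rewrite ?lt_min ?m0// ge_min lexx ?orbT.
- move=> z _; have [d [m [d0 m0 hm]]] := loc (complex.Re z).
  exists d => //; exists m => // y [_ yz]; apply: hm; apply: le_lt_trans yz.
  by have := abs_Re_le (y - z); rewrite ReD ReN.
Qed.

Lemma finite_unif (n : nat) (P : 'I_n -> R -> Prop) :
  (forall j m m', 0 < m' -> m' <= m -> P j m -> P j m') ->
  (forall j, exists2 m : R, 0 < m & P j m) -> exists2 m : R, 0 < m & forall j, P j m.
Proof.
move=> mono h.
have ex j : exists m : R, 0 < m /\ P j m by have [m m0 hm] := h j; exists m.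
have [m hm] := choice ex.
have p0 : 0 < \big[Num.min/1]_j m j.
  by elim/big_ind : _ => // [x y|j _]; [rewrite lt_min => -> ->|exact: (hm j).1].
exists (\big[Num.min/1]_j m j) => // j; apply: mono p0 _ (hm j).2.
exact: bigmin_le_cond.
Qed.

Definition cstrict (gam : R -> C) (t : R) (v : C) : Prop := forall e : R, 0 < e ->
  exists2 d : R, 0 < d & forall x y, `|x - t| < d -> `|y - t| < d ->
    nrm (gam x - gam y - (x - y)%:C * v) <= e * `|x - y|.

Lemma analytic_cstrict (gam : R -> C) t : real_analytic (fun s => complex.Re (gam s)) ->
  real_analytic (fun s => complex.Im (gam s)) -> cstrict gam t (curve_deriv gam t).
Proof.
move=> /(analytic_strict t) sr /(analytic_strict t) si e e0.
have e2 : 0 < e / 2 by rewrite divr_gt0.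
have [d1 d10 h1] := sr _ e2; have [d2 d20 h2] := si _ e2.
exists (Num.min d1 d2); first by rewrite lt_min d10.
move=> x y; rewrite !lt_min => /andP[x1 x2] /andP[y1 y2].
have := lerD (h1 x y x1 y1) (h2 x y x2 y2); rewrite -mulrDl -splitr; apply: le_trans.
apply: (le_trans (nrm_le_ReIm _)); rewrite /curve_deriv.
move: (derive1 _ _) (derive1 _ _) (gam x) (gam y) => v1 v2 [a1 a2] [b1 b2] /=.
by rewrite !mul0r subr0 addr0 ![_ * (x - y)]mulrC.
Qed.

Variables (gam : R -> C) (v : R -> C).
Hypothesis sg : forall t, cstrict gam t (v t).

(** The strict estimates at [t0] and at [t] are compared on the same short chord starting at [t]. *)
Lemma cstrict_deriv_cont t0 (e : R) : 0 < e -> exists2 d : R, 0 < d &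
  forall t, `|t - t0| < d -> nrm (v t - v t0) <= e.
Proof.
move=> e0; have e2 : 0 < e / 2 by rewrite divr_gt0.
have [d d0 hd] := sg t0 e2; exists (d / 2); first by rewrite divr_gt0.
move=> t td; have [d' d'0 hd'] := sg t e2.
pose s := Num.min (d / 4) (d' / 2).
have s0 : 0 < s by rewrite lt_min !divr_gt0.
have s1 : s <= d / 4 by rewrite ge_min lexx.
have s2 : s <= d' / 2 by rewrite ge_min lexx orbT.
have sn : `|s| = s by rewrite gtr0_norm.
have := hd' (t + s) t; have := hd (t + s) t.
rewrite (_ : t + s - t = s) ?sn => [k1 k2|]; last by ring.
have {}k1 : nrm (gam (t + s) - gam t - s%:C * v t0) <= e / 2 * s.
  by apply: k1; last lra; have := ler_normD (t - t0) s; rewrite sn (addrAC t (- t0)); lra.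
have {}k2 : nrm (gam (t + s) - gam t - s%:C * v t) <= e / 2 * s by apply: k2; rewrite ?subrr ?normr0//; lra.
rewrite -(ler_pM2l s0) -{1}sn -nrm_real -nrmM.
rewrite (_ : _ * _ = (gam (t + s) - gam t - s%:C * v t0) - (gam (t + s) - gam t - s%:C * v t)); last by ring.
apply: (le_trans (nrmB _ _)); lra.
Qed.

Lemma curve_approx (e : R) : 0 < e -> exists2 m : R, 0 < m & forall t, 0 <= t <= 1 ->
  forall s, `|s| <= m -> nrm (gam (t + s) - gam t - s%:C * v t) <= e * `|s|.
Proof.
move=> e0; apply: segment_unif => [t m m' _ mm h s sm|t0]; first by apply: h; exact: le_trans mm.
have e2 : 0 < e / 2 by rewrite divr_gt0.
have [d d0 hd] := sg t0 e2; have [d' d'0 hd'] := cstrict_deriv_cont t0 e2.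
exists (Num.min (d / 2) d'), (d / 4); split; [by rewrite lt_min divr_gt0|by rewrite divr_gt0|].
move=> t; rewrite lt_min => /andP[td td'] s sm.
have := hd (t + s) t; rewrite (_ : t + s - t = s) => [k1|]; last by ring.
have {}k1 : nrm (gam (t + s) - gam t - s%:C * v t0) <= e / 2 * `|s|.
  by apply: k1; last lra; have := ler_normD (t - t0) s; rewrite (addrAC t (- t0)); lra.
rewrite (_ : _ - _ = (gam (t + s) - gam t - s%:C * v t0) - s%:C * (v t - v t0)); last by ring.
apply: (le_trans (nrmB _ _)); rewrite nrmM nrm_real.
have := ler_wpM2l (normr_ge0 s) (hd' t td'); lra.
Qed.

(** [m] is at once the range of [s] and the inverse of the Lipschitz constant, so that a single
    monotone parameter is made uniform by [segment_unif]. *)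
Lemma curve_lip : exists2 m : R, 0 < m & forall t, 0 <= t <= 1 ->
  forall s, `|s| <= m -> nrm (gam (t + s) - gam t) <= `|s| / m.
Proof.
apply: (@segment_unif (fun t m => forall s, `|s| <= m -> nrm (gam (t + s) - gam t) <= `|s| / m)).
  move=> t m m' m'0 mm h s sm; apply: (le_trans (h s (le_trans sm mm))).
  by rewrite ler_wpM2l// lef_pV2 ?posrE//; exact: lt_le_trans mm.
move=> t0; have [d d0 hd] := sg t0 ltr01.
have k0 : 0 < nrm (v t0) + 1 by rewrite ltr_wpDl ?nrm_ge0.
exists (d / 2), (Num.min (d / 4) (nrm (v t0) + 1)^-1); split; first by rewrite divr_gt0.
  by rewrite lt_min divr_gt0//= invr_gt0.
move=> t td s sm.
have m1 : Num.min (d / 4) (nrm (v t0) + 1)^-1 <= d / 4 by rewrite ge_min lexx.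
have m2 : nrm (v t0) + 1 <= (Num.min (d / 4) (nrm (v t0) + 1)^-1)^-1.
  by rewrite -[leLHS]invrK lef_pV2 ?posrE ?ge_min ?lexx ?orbT// ?lt_min ?divr_gt0//= invr_gt0.
have := hd (t + s) t; rewrite (_ : t + s - t = s) => [k1|]; last by ring.
have {}k1 : nrm (gam (t + s) - gam t - s%:C * v t0) <= 1 * `|s|.
  by apply: k1; last lra; have := ler_normD (t - t0) s; rewrite (addrAC t (- t0)); lra.
rewrite -[gam (t + s) - gam t](subrK (s%:C * v t0)) (le_trans (nrmD _ _))//.
rewrite nrmM nrm_real; have := ler_wpM2l (normr_ge0 s) m2; lra.
Qed.

Lemma curve_speed : (forall t, v t != 0) -> exists2 m : R, 0 < m & forall t, 0 <= t <= 1 -> m <= nrm (v t).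
Proof.
move=> v0; apply: segment_unif => [t m m' _ mm h|t0]; first exact: le_trans h.
have p : 0 < nrm (v t0) / 2 by rewrite divr_gt0// nrm_gt0.
have [d d0 hd] := cstrict_deriv_cont t0 p.
exists d, (nrm (v t0) / 2); split => // t /hd; have := nrm_sub_ge (v t0) (v t).
rewrite nrm_distC; lra.
Qed.

End CurveUniformity.

(** * Boundary crossing and uniform convergence to boundary values *)

Section BoundaryValues.
Variable R : realType.
Local Notation C := (R[i]^o).
Variables (Om : set C) (S : R).
Hypothesis oOm : open Om.
Hypothesis S0 : 0 < S.
Hypothesis OmS : Om `<=` box 0 S.

Lemma boundaryP z : boundary Om z <-> closure Om z /\ ~ Om z.
Proof. by rewrite /boundary (interior_id _).1. Qed.

Lemma boundary_closed : closed (boundary Om).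
Proof.
rewrite /boundary setDE; apply: closedI; first exact: closed_closure.
by apply: open_closedC; exact: open_interior.
Qed.

Lemma closure_box : closure Om `<=` box 0 (S + 1).
Proof.
move=> z cz; have [w /OmS[w1 w2] wz] := closureC cz ltr01.
have := abs_Re_le (z - w); have := abs_Im_le (z - w); rewrite nrm_distC in wz.
rewrite ReD ReN ImD ImN; move: w1 w2; rewrite /box /= !subr0 => w1 w2 h1 h2.
split.
  by have := ler_normD (complex.Re z - complex.Re w) (complex.Re w); rewrite subrK; lra.
by have := ler_normD (complex.Im z - complex.Im w) (complex.Im w); rewrite subrK; lra.
Qed.

(** Follow the segment from [z] to [y] up to the supremum of the times until which it stays in
    [Om]. *)
Lemma boundary_crossing z y : Om z -> ~ Om y -> exists2 b, boundary Om b & nrm (z - b) <= nrm (z - y).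
Proof.
move=> Oz Oy; pose g (t : R) : C := z + t%:C * (y - z).
have gE s t : nrm (g s - g t) = `|s - t| * nrm (z - y).
  rewrite -nrm_real (nrm_distC z y) -nrmM /g; congr nrm.
  by move: (y - z) => [a b]; case: (z) => c d; apply: complex_ext => /=; ring.
have g0 : g 0 = z by rewrite /g mul0r addr0.
have g1 : g 1 = y by rewrite /g mul1r addrC subrK.
pose T := [set t : R | 0 <= t /\ forall s, 0 <= s -> s <= t -> Om (g s)].
have T0 : T 0.
  by split => // s s0 s1; rewrite (_ : s = 0) ?g0//; apply/eqP; rewrite eq_le s1.
have T1 t : T t -> t <= 1.
  by move=> [_ h]; rewrite leNgt; apply/negP => t1; apply: Oy; rewrite -g1; apply: h => //; exact: ltW.
have hT : has_sup T by split; [exists 0|exists 1 => t /T1].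
have u0 : 0 <= sup T by exact: (ub_le_sup hT.2).
have u1 : sup T <= 1 by apply: sup_le_ub; [exists 0|move=> t /T1].
have before s : 0 <= s -> s < sup T -> Om (g s).
  move=> s0 su; have su' : 0 < sup T - s by rewrite subr_gt0.
  have [t [t0 ht] st] := sup_adherent su' hT.
  by apply: ht => //; rewrite opprB addrC subrK in st; exact: ltW.
have n0 := nrm_ge0 (z - y).
have n1 : 0 < nrm (z - y) + 1 by rewrite ltr_wpDl.
exists (g (sup T)); last first.
  by rewrite -{1}g0 gE sub0r normrN ger0_norm// ler_piMl.
apply/boundaryP; split => [|Ou].
  move=> B /nbhsC[e e0 hB].
  have [u_eq|u_neq] := eqVneq (sup T) 0.
    by exists z; split => //; apply: hB; rewrite u_eq g0 subrr nrm0.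
  have up : 0 < sup T by rewrite lt_def u_neq.
  pose s := Num.max 0 (sup T - e / (nrm (z - y) + 1)).
  have q0 : 0 < e / (nrm (z - y) + 1) by rewrite divr_gt0.
  have s0 : 0 <= s by rewrite le_max lexx.
  have s1 : s < sup T by rewrite gt_max up/= gtrBl.
  have s2 : sup T - e / (nrm (z - y) + 1) <= s by rewrite le_max lexx orbT.
  exists (g s); split; first exact: before.
  apply: hB; rewrite gE distrC ger0_norm ?subr_ge0 ?(ltW s1)//.
  have : sup T - s <= e / (nrm (z - y) + 1) by lra.
  rewrite ler_pdivlMr// => h; apply: lt_le_trans h.
  by rewrite mulrDr mulr1 ltrDl subr_gt0.
have [e e0 he] := (openC Om).1 oOm _ Ou.
have q0 : 0 < e / (nrm (z - y) + 1) / 2 by rewrite !divr_gt0.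
suff : T (sup T + e / (nrm (z - y) + 1) / 2).
  by move=> /(ub_le_sup hT.2); rewrite gerDl leNgt q0.
split => [|s s0 s1]; first by rewrite addr_ge0// ltW.
have [su|su] := ltP s (sup T); first exact: before.
apply: he; rewrite gE ger0_norm ?subr_ge0//.
have h : (s - sup T) * 2 <= e / (nrm (z - y) + 1) by lra.
move: h; rewrite ler_pdivlMr// => h; have : 0 <= s - sup T by rewrite subr_ge0.
move: h; move: (s - sup T) => x h x0; nra.
Qed.

Variables (kap k : C -> C).
Hypothesis hkap : forall z, Om z -> hol_at kap z.
Hypothesis kk : forall z, boundary Om z -> kap x @[x --> within Om (nbhs z)] --> k z.

Let kkE z : boundary Om z -> forall e : R, 0 < e -> exists2 d : R, 0 < d &
  forall y, Om y -> nrm (y - z) < d -> nrm (kap y - k z) < e.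
Proof. by move=> /kk/cvg_withinC. Qed.

(** [compact_ind] on the closure: local bounds come from continuity at interior points and from the
    limit at boundary points. *)
Lemma boundary_values_bounded : exists2 M : R, 0 <= M &
  (forall z, Om z -> nrm (kap z) <= M) /\ (forall b, boundary Om b -> nrm (k b) <= M).
Proof.
have S1 : 0 < S + 1 by rewrite addr_gt0.
have [M hM] : exists M : R, forall z, closure Om z -> Om z -> nrm (kap z) <= M.
  apply: (@compact_ind _ (closure Om) (S + 1) (fun A => exists M : R, forall z, A z -> Om z -> nrm (kap z) <= M) (@closed_closure _ _) S1 closure_box).
  - by exists 0.
  - by move=> A B AB [M hM]; exists M => z /AB /hM.
  - move=> A B [M hM] [M' hM']; exists (Num.max M M') => z [/hM h|/hM' h] /h; rewrite le_max => -> //.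
    by rewrite orbT.
  - move=> z cz; have [Oz|Oz] := pselect (Om z).
      have [d d0 hd] := hol_ccont hkap Oz ltr01; exists d => //; exists (1 + nrm (kap z)).
      move=> y [_ /hd h] _; have := nrm_sub_ge (kap y) (kap z); lra.
    have [|d d0 hd] := @kkE z _ 1 ltr01; first exact/boundaryP.
    exists d => //; exists (1 + nrm (k z)) => y [_ yz] Oy.
    have := nrm_sub_ge (kap y) (k z); have := hd y Oy yz; lra.
have hM' z : Om z -> nrm (kap z) <= `|M|.
  by move=> Oz; rewrite (le_trans (hM _ (subset_closure Oz) Oz))// ler_norm.
exists `|M| => //; split => // b bb; apply/ler_addgt0Pr => e e0.
have [d d0 hd] := kkE bb e0; have [w Ow wb] := closureC ((boundaryP b).1 bb).1 d0.
have := hd w Ow wb; have := hM' w Ow; have := nrm_sub_ge (k b) (kap w); rewrite nrm_distC; lra.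
Qed.

Lemma boundary_values_unif (e : R) : 0 < e -> exists2 d : R, 0 < d &
  forall z b, Om z -> boundary Om b -> nrm (z - b) < d -> nrm (kap z - k b) <= e.
Proof.
move=> e0; have S1 : 0 < S + 1 by rewrite addr_gt0.
apply: (@compact_ind _ (boundary Om) (S + 1) (fun A => exists2 d : R, 0 < d & forall z b, Om z -> A b ->
  nrm (z - b) < d -> nrm (kap z - k b) <= e) boundary_closed S1 (fun z h => closure_box ((boundaryP z).1 h).1)).
- by exists 1.
- by move=> A B AB [d d0 hd]; exists d => // z b Oz /AB; exact: hd.
- move=> A B [d d0 hd] [d' d'0 hd']; exists (Num.min d d'); first by rewrite lt_min d0.
  by move=> z b Oz; rewrite lt_min => -[bA|bB] /andP[h1 h2]; [exact: hd|exact: hd'].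
move=> b0 bb0; have e3 : 0 < e / 3 by rewrite divr_gt0.
have [d d0 hd] := kkE bb0 e3; have d2 : 0 < d / 2 by rewrite divr_gt0.
exists (d / 2) => //; exists (d / 2) => // z b Oz [bb bb0d] zb.
(* [k] is given only as a pointwise limit, so [k b] is compared with [k b0] through a point [w] of
   [Om] very close to [b]. *)
have [d' d'0 hd'] := kkE bb e3.
have m0 : 0 < Num.min d' (d / 2) by rewrite lt_min d'0.
have [w Ow] := closureC ((boundaryP b).1 bb).1 m0; rewrite lt_min => /andP[w1 w2].
have h1 := hd' w Ow w1.
have h2 : nrm (kap w - k b0) < e / 3 by apply: hd => //; have := nrm_triangle w b b0; lra.
have h3 : nrm (kap z - k b0) < e / 3 by apply: hd => //; have := nrm_triangle z b b0; lra.
have := nrm_triangle (kap z) (k b0) (k b); have := nrm_triangle (k b0) (kap w) (k b).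
by rewrite (nrm_distC (k b0) (kap w)); lra.
Qed.

End BoundaryValues.

(** * Nets on the curves *)

Section CurveNets.
Variable R : realType.
Local Notation C := (R[i]^o).

Definition curve_net (n : nat) (gam : 'I_n -> R -> C) (N : nat) : seq C :=
  [seq gam j (k%:R / N%:R) | j <- enum 'I_n, k <- iota 0 N].

Lemma size_curve_net n (gam : 'I_n -> R -> C) N : size (curve_net gam N) = (n * N)%N.
Proof. by rewrite size_allpairs size_enum_ord size_iota. Qed.

Lemma curve_netP n (gam : 'I_n -> R -> C) N c :
  reflect (exists j (k : nat), (k < N)%N /\ c = gam j (k%:R / N%:R)) (c \in curve_net gam N).
Proof.
apply: (iffP allpairsP) => [[[j k] [_ + ->]]|[j [k [kN ->]]]].
  by rewrite mem_iota add0n => kN; exists j, k.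
by exists (j, k); split; rewrite ?mem_enum// mem_iota add0n.
Qed.

Lemma periodic_int (g : R -> C) (k : int) t : (forall t, g (t + 1) = g t) -> g (t + k%:~R) = g t.
Proof.
move=> per; have pn (m : nat) u : g (u + m%:R) = g u.
  by elim: m u => [|m IH] u; rewrite ?addr0// -natr1 addrA per IH.
case: k => m; first exact: pn.
by have := pn m.+1 (t - m.+1%:R); rewrite subrK NegzE mulrNz => ->.
Qed.

Variables (n : nat) (gam : 'I_n -> R -> C) (N : nat).
Hypothesis N0 : (0 < N)%N.
Hypothesis per : forall j t, gam j (t + 1) = gam j t.

Let NR : (0 : R) < N%:R. Proof. by rewrite ltr0n. Qed.

Lemma grid_seg (k : nat) : (k < N)%N -> 0 <= (k%:R / N%:R : R) <= 1.
Proof.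
by move=> kN; rewrite divr_ge0 ?ler0n//= ler_pdivrMr// mul1r ler_nat ltnW.
Qed.

Lemma curve_net_near (m : R) : N%:R^-1 <= m -> 0 < m ->
  (forall j t, 0 <= t <= 1 -> forall s, `|s| <= m -> nrm (gam j (t + s) - gam j t) <= `|s| / m) ->
  forall j t, exists2 c, c \in curve_net gam N & nrm (gam j t - c) <= N%:R^-1 / m.
Proof.
move=> Nm m0 lip j t; pose u := t - (Num.floor t)%:~R.
have gu : gam j t = gam j u.
  by rewrite -(periodic_int (Num.floor t) u (per j)) subrK.
have /andP[u0 u1] : 0 <= u < 1.
  have := floor_itv t; rewrite /u intrD => /andP[h1 h2]; apply/andP; split; lra.
have uN0 : 0 <= u * N%:R by rewrite mulr_ge0// ltW.
have /andP[k1 k2] := truncn_itv uN0.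
set k := Num.truncn _ in k1 k2.
have kN : (k < N)%N by rewrite -(ltr_nat R); apply: (le_lt_trans k1); rewrite gtr_pMl.
exists (gam j (k%:R / N%:R)); first by apply/curve_netP; exists j, k.
pose s := u - k%:R / N%:R.
have s0 : 0 <= s by rewrite subr_ge0 ler_pdivrMr.
have s1 : s <= N%:R^-1.
  by rewrite lerBlDr -[X in X + _]mul1r -mulrDl ler_pdivlMr// ltW// addrC natr1.
rewrite gu -[u](subrK (k%:R / N%:R)) -/s [s + _]addrC.
apply: (le_trans (lip j _ (grid_seg kN) s _)); rewrite ger0_norm//; first exact: le_trans Nm.
by rewrite ler_wpM2r// invr_ge0 ltW.
Qed.

Lemma curve_net_next j (k : nat) : (k < N)%N -> gam j (k%:R / N%:R + N%:R^-1) \in curve_net gam N.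
Proof.
move=> kN; have E : k%:R / N%:R + N%:R^-1 = k.+1%:R / N%:R :> R.
  by rewrite -natr1 mulrDl mul1r.
(* After the last node, periodicity leads back to node 0. *)
apply/curve_netP; exists j; rewrite E; move: kN; rewrite leq_eqVlt => /orP[/eqP kN|kN].
  exists 0%N; split => //; rewrite kN divff ?gt_eqF// mul0r; have := per j 0; by rewrite add0r.
by exists k.+1.
Qed.

Lemma curve_net_prev j (k : nat) : (k < N)%N -> gam j (k%:R / N%:R - N%:R^-1) \in curve_net gam N.
Proof.
move=> kN; apply/curve_netP; exists j; case: k kN => [|k] kN.
  exists N.-1; split; first by rewrite prednK.
  rewrite mul0r sub0r -per; congr (gam j _).
  rewrite -[in RHS](prednK N0) -[X in _ = _ / X]natr1 -[in LHS](prednK N0) -natr1.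
  have : (0 : R) < N.-1%:R + 1 by rewrite ltr_wpDl.
  by move: (N.-1%:R) => x x0; field; rewrite gt_eqF.
by exists k; split; [exact: ltnW|rewrite -natr1 mulrDl mul1r addrK].
Qed.

(* [z - b] is nearly orthogonal to the tangent at [b], since [z] is at least as close
   to [b] as to the two neighbours of [b] on its curve. *)
Lemma nearest_normal (m sig : R) (v : C) z j (k : nat) : (k < N)%N -> 0 < m -> N%:R^-1 <= m ->
  (forall s, `|s| <= m -> nrm (gam j (k%:R / N%:R + s) - gam j (k%:R / N%:R)) <= `|s| / m) ->
  (forall s, `|s| <= N%:R^-1 ->
     nrm (gam j (k%:R / N%:R + s) - gam j (k%:R / N%:R) - s%:C * v) <= sig * `|s|) ->
  (forall c, c \in curve_net gam N -> nrm (z - gam j (k%:R / N%:R)) <= nrm (z - c)) ->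
  `|complex.Re ((z - gam j (k%:R / N%:R)) * v^*)| <=
    N%:R^-1 / m ^+ 2 / 2 + sig * nrm (z - gam j (k%:R / N%:R)).
Proof.
move=> kN m0 Nm lip app near; set b := gam j _ in lip app near *.
have x0 : (0 : R) < N%:R^-1 by rewrite invr_gt0.
(* Expanding [nrm (z - b) ^+ 2 <= nrm (z - c) ^+ 2] for the neighbour [c] bounds the inner product
   of [z - b] and [c - b] by half of [nrm (c - b) ^+ 2]; then [c - b] is replaced by [s] times
   [v]. *)
have key s : `|s| = N%:R^-1 -> gam j (k%:R / N%:R + s) \in curve_net gam N ->
    s * complex.Re ((z - b) * v^*) <= N%:R^-1 * (N%:R^-1 / m ^+ 2 / 2 + sig * nrm (z - b)).
  move=> sE /near; have := lip s; have := app s; rewrite sE lexx => /(_ isT) a1 /(_ Nm) a2.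
  move: (gam j (k%:R / N%:R + s)) a1 a2 => c a1 a2 h.
  have h2 : nrm (z - b) ^+ 2 <= nrm (z - c) ^+ 2 by rewrite lerXn2r ?nnegrE ?nrm_ge0.
  have e1 : nrm (z - c) ^+ 2 = nrm (z - b) ^+ 2 + nrm (c - b) ^+ 2 - 2 * complex.Re ((z - b) * (c - b)^*).
    by rewrite !nrm_sqr; case: (z) (b) (c) => [z1 z2] [b1 b2] [c1 c2] /=; ring.
  have e2 : complex.Re ((z - b) * (c - b)^*) = s * complex.Re ((z - b) * v^*) +
      complex.Re ((z - b) * (c - b - s%:C * v)^*).
    by case: (z) (b) (c) (v) => [z1 z2] [b1 b2] [c1 c2] [v1 v2] /=; ring.
  have e3 : `|complex.Re ((z - b) * (c - b - s%:C * v)^*)| <= nrm (z - b) * (sig * N%:R^-1).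
    by apply: (le_trans (abs_Re_le _)); rewrite nrmM nrm_conj ler_wpM2l ?nrm_ge0.
  have e4 : nrm (c - b) ^+ 2 <= (N%:R^-1 / m) ^+ 2.
    by rewrite lerXn2r ?nnegrE ?nrm_ge0// divr_ge0// ltW.
  move: e4; rewrite expr_div_n expr2 => e4.
  move: e3; rewrite ler_norml => /andP[e3 _].
  have -> : N%:R^-1 * (N%:R^-1 / m ^+ 2 / 2 + sig * nrm (z - b)) =
    N%:R^-1 * N%:R^-1 / m ^+ 2 / 2 + nrm (z - b) * (sig * N%:R^-1) by ring.
  lra.
(* The two neighbours, with opposite signs of [s], bound the real part from both sides. *)
have k1 := key N%:R^-1 (gtr0_norm x0) (curve_net_next j kN).
have k2 := key (- N%:R^-1); rewrite normrN (gtr0_norm x0) in k2.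
have {}k2 := k2 erefl (curve_net_prev j kN).
rewrite ler_norml -(ler_pM2l x0) -[X in _ && X](ler_pM2l x0) k1 andbT.
by move: k2; rewrite mulNr mulrN; lra.
Qed.

End CurveNets.

(** * Orthogonality to polynomials and uniqueness *)

Section BoundaryOrthogonality.
Variable R : realType.
Local Notation C := (R[i]^o).

(** Multiply by [nrm v ^+ 2] and substitute [k2 * v = - (k1 * v)^*]: what remains is twice the real
    part of [w] times the conjugate of [v], which is 0 for [w] normal to [v], multiplied by
    [- (k1 * v)^*]. *)
Lemma tangent_relation (w v k1 k2 : C) (mu M D : R) : 0 < mu -> mu <= nrm v -> nrm k1 <= M ->
  k1 * v + (k2 * v)^* = 0 -> `|complex.Re (w * v^*)| <= D ->
  nrm (w * k2 - (w * k1)^*) <= 2 * D * M / mu.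
Proof.
move=> mu0 muv k1M rel hD.
have v0 : 0 < nrm v by exact: lt_le_trans muv.
have D0 : 0 <= D by exact: le_trans hD.
have M0 : 0 <= M by exact: le_trans (nrm_ge0 _) k1M.
have E : (nrm v ^+ 2)%:C * (w * k2 - (w * k1)^*) = - (2 * complex.Re (w * v^*))%:C * (k1 * v)^*.
  have {rel} : k2 * v = - (k1 * v)^*.
    move: rel; case: (k1) (k2) (v) => [a1 a2] [b1 b2] [c1 c2] [e1 e2].
    by apply: complex_ext => /=; lra.
  move=> e; rewrite -mul_conj.
  have key (V X : C) : v * V * (w * k2 - X) = w * V * (k2 * v) - v * V * X by ring.
  rewrite key e; case: (w) (v) (k1) => [a1 a2] [b1 b2] [c1 c2].
  by apply: complex_ext => /=; ring.
have : nrm v ^+ 2 * nrm (w * k2 - (w * k1)^*) <= 2 * D * M * nrm v.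
  have := congr1 (@nrm R) E; rewrite !nrmM nrmN !nrm_real nrm_conj nrmM.
  rewrite (ger0_norm (exprn_ge0 2 (nrm_ge0 v))) normrM (ger0_norm (ler0n R 2)) => ->.
  by rewrite mulrA ler_wpM2r ?(ltW v0)// ler_pM ?mulr_ge0 ?nrm_ge0// ler_wpM2l.
rewrite expr2 -mulrA mulrC ler_pM2r// => h; rewrite ler_pdivlMr//; apply: le_trans h.
by rewrite mulrC ler_wpM2r ?nrm_ge0.
Qed.

Variables (Om : set C) (S : R) (n : nat) (gam : 'I_n -> R -> C) (f1 f2 k1 k2 : C -> C).
Hypothesis oOm : open Om.
Hypothesis S0 : 0 < S.
Hypothesis OmS : Om `<=` box 0 S.
Hypothesis curves : analytic_boundary_curves Om gam.
Hypothesis h1 : forall z, Om z -> hol_at f1 z.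
Hypothesis h2 : forall z, Om z -> hol_at f2 z.
Hypothesis c1 : forall z, boundary Om z -> f1 x @[x --> within Om (nbhs z)] --> k1 z.
Hypothesis c2 : forall z, boundary Om z -> f2 x @[x --> within Om (nbhs z)] --> k2 z.
Hypothesis rel : forall j t,
  k1 (gam j t) * curve_deriv (gam j) t + (k2 (gam j t) * curve_deriv (gam j) t)^* = 0.

(** [layer_estimate] is applied with [E] of order [sig * r] and a coarse net of O(1/r) points; the
    result is [q * sig + q' * r], and [sig] and [r] are chosen to make each term at most [e / 2]. *)
Theorem boundary_ortho (p : {poly R[i]}) : I (cut Om (fun z => pev p^`() z * (f1 z)^*)) = 0.
Proof.
have [an v0 per _ bd] := curves.
have inbd j t : boundary Om (gam j t) by rewrite bd; exists j => //; exists t.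
have sg j t : cstrict (gam j) t (curve_deriv (gam j) t).
  by apply: analytic_cstrict; have [] := an j.
have [M1 M10 [f1M k1M]] := boundary_values_bounded oOm S0 OmS h1 c1.
have [M2 M20 [f2M k2M]] := boundary_values_bounded oOm S0 OmS h2 c2.
pose M := M1 + M2.
have M0 : 0 <= M by rewrite addr_ge0.
have f1M' z : Om z -> nrm (f1 z) <= M by move=> /f1M /le_trans; apply; rewrite lerDl.
have f2M' z : Om z -> nrm (f2 z) <= M by move=> /f2M /le_trans; apply; rewrite lerDr.
have k1M' z : boundary Om z -> nrm (k1 z) <= M by move=> /k1M /le_trans; apply; rewrite lerDl.
have [A0 A00 PA] := pev_bounded S0 p; have [A1 A10 PA1] := pev_bounded S0 p^`().
have [m m0 lip] : exists2 m : R, 0 < m & forall j t, 0 <= t <= 1 -> forall s, `|s| <= m ->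
    nrm (gam j (t + s) - gam j t) <= `|s| / m.
  apply: (finite_unif (P := fun j m => forall t, 0 <= t <= 1 -> forall s, `|s| <= m ->
    nrm (gam j (t + s) - gam j t) <= `|s| / m)).
    move=> j m m' m'0 mm h t ht s sm; apply: (le_trans (h t ht s (le_trans sm mm))).
    by rewrite ler_wpM2l// lef_pV2 ?posrE//; exact: lt_le_trans mm.
  by move=> j; exact: (curve_lip (sg j)).
have [mu mu0 speed] : exists2 mu : R, 0 < mu & forall j t, 0 <= t <= 1 -> mu <= nrm (curve_deriv (gam j) t).
  apply: (finite_unif (P := fun j m => forall t, 0 <= t <= 1 -> m <= nrm (curve_deriv (gam j) t))).
    by move=> j a a' _ aa h t /h; exact: le_trans.
  by move=> j; exact: (curve_speed (sg j) (v0 j)).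
apply: nrm_le_eps => e e0.
(* [K] bounds [r] times the size of the coarse net, for every [r <= 1]. *)
pose K := n%:R * (m^-1 + 1) : R.
have K0 : 0 <= K by rewrite mulr_ge0// addr_ge0// invr_ge0 ltW.
have w0 : 0 <= 4 + 6 * M / mu by rewrite addr_ge0// divr_ge0 ?mulr_ge0// ltW.
pose q := 72 * K * A0 * (4 + 6 * M / mu).
have q0 : 0 <= q by rewrite mulr_ge0// mulr_ge0// mulr_ge0.
pose sig := e / (2 * (q + 1)).
have q1 : 0 < 2 * (q + 1) by rewrite mulr_gt0// ltr_wpDl.
have sig0 : 0 < sig by rewrite divr_gt0.
have sigE : q * sig <= e / 2.
  by rewrite /sig mulrA ler_pdivrMr//; move: q0 e0; move: (q) => x x0 e0; nra.
have [d1 d10 u1] := boundary_values_unif oOm S0 OmS c1 sig0.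
have [d2 d20 u2] := boundary_values_unif oOm S0 OmS c2 sig0.
pose q' := 72 * K * A1 * M.
have q'0 : 0 <= q' by rewrite mulr_ge0// mulr_ge0// mulr_ge0.
have q'1 : 0 < 2 * (q' + 1) by rewrite mulr_gt0// ltr_wpDl.
pose r := Num.min (Num.min 1 (e / (2 * (q' + 1)))) (Num.min (d1 / 4) (d2 / 4)).
have r0 : 0 < r by rewrite !lt_min ltr01 !divr_gt0.
have r1 : r <= 1 by rewrite !ge_min lexx.
have re : q' * r <= e / 2.
  have : r <= e / (2 * (q' + 1)) by rewrite !ge_min lexx !orbT.
  rewrite ler_pdivlMr// => h; move: h q'0 r0; move: (q') (r) => x y; nra.
have rd1 : r <= d1 / 4 by rewrite !ge_min lexx !orbT.
have rd2 : r <= d2 / 4 by rewrite !ge_min lexx !orbT.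
have [ms ms0 app] : exists2 ms : R, 0 < ms & forall j t, 0 <= t <= 1 -> forall s, `|s| <= ms ->
    nrm (gam j (t + s) - gam j t - s%:C * curve_deriv (gam j) t) <= sig * `|s|.
  apply: (finite_unif (P := fun j m => forall t, 0 <= t <= 1 -> forall s, `|s| <= m ->
    nrm (gam j (t + s) - gam j t - s%:C * curve_deriv (gam j) t) <= sig * `|s|)).
    by move=> j a a' _ aa h t ht s sa; apply: h => //; exact: le_trans aa.
  by move=> j; exact: (curve_approx (sg j) sig0).
(* The last two conditions make the fine net [r / 2]-dense on the boundary and the discretization
   term of [nearest_normal] at most [sig * r]. *)
have [N0 hN0] : exists N0 : nat, [/\ (0 < N0)%N, N0%:R^-1 <= m, N0%:R^-1 <= ms,
    N0%:R^-1 / m <= r / 2 & N0%:R^-1 / m ^+ 2 / 2 <= sig * r].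
  have d0' : 0 < Num.min (Num.min m ms) (Num.min (r / 2 * m) (sig * r * 2 * m ^+ 2)).
    by rewrite !lt_min m0 ms0 /= mulr_gt0 ?divr_gt0//= mulr_gt0 ?exprn_gt0// mulr_gt0// mulr_gt0.
  have [N hN] := small_dn d0'; exists N.+1; have := hN N (leqnn N).
  rewrite !lt_min => /andP[/andP[/ltW a1 /ltW a2] /andP[/ltW a3 /ltW a4]]; split => //.
    by rewrite ler_pdivrMr.
  by rewrite ler_pdivrMr// ler_pdivrMr ?exprn_gt0.
have {hN0} [N00 Nm Nms Nr Nsig] := hN0.
(* The coarse net has parameter spacing just below [m * r]: it is [r]-dense on the curves, while
   [Mc * r] stays bounded. *)
pose Mc := (Num.truncn (m * r)^-1).+1.
have mr0 : 0 < m * r by rewrite mulr_gt0.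
have Mc1 : (Mc%:R)^-1 <= m * r.
  by rewrite -[leRHS]invrK lef_pV2 ?posrE ?invr_gt0 ?ltr0n// ltW// truncnS_gt.
have Mc2 : Mc%:R * r <= m^-1 + 1.
  have := truncn_le (m * r)^-1; rewrite invr_ge0 (ltW mr0) => h.
  rewrite /Mc -natr1 mulrDl mul1r lerD// (le_trans (ler_wpM2r (ltW r0) h))//.
  by rewrite invfM -mulrA mulVf ?mulr1// gt_eqF.
have x0 : (0 : R) < N0%:R^-1 by rewrite invr_gt0 ltr0n.
pose net := undup (curve_net gam N0).
pose cs := curve_net gam Mc.
have near1 := curve_net_near N00 per Nm m0 lip.
have near2 : forall j t, exists2 c, c \in cs & nrm (gam j t - c) <= r.
  have Mcm : Mc%:R^-1 <= m by rewrite (le_trans Mc1)// ler_piMr// ltW.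
  move=> j t; have [c cc h] := @curve_net_near _ _ gam Mc isT per m Mcm m0 lip j t; exists c => //.
  by apply: (le_trans h); rewrite ler_pdivrMr// mulrC.
have fine z y : Om z -> ~ Om y -> nrm (y - z) < r / 2 -> exists2 b, b \in net & nrm (z - b) <= r.
  move=> Oz Oy yz; have [b + zb] := boundary_crossing oOm Oz Oy.
  rewrite bd => -[j _ [t _ bE]]; have [c cc bc] := near1 j t.
  exists c; first by rewrite mem_undup.
  apply: (le_trans (nrm_triangle z b c)); rewrite bE in bc.
  by rewrite nrm_distC in yz; lra.
have coarse b : b \in net -> exists2 c, c \in cs & nrm (b - c) <= r.
  by rewrite mem_undup => /curve_netP[j [k [_ ->]]]; exact: near2.
(* Within [2 * r] of [b], replacing [f1] and [f2] by their boundary values costs [4 * sig * r]; the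
   rest comes from [tangent_relation] with [D = 3 * sig * r]. *)
pose E := sig * (4 + 6 * M / mu) * r.
have E0 : 0 <= E.
  by rewrite mulr_ge0 ?(ltW r0)// mulr_ge0 ?(ltW sig0).
have hE z b : Om z -> b \in net -> nearest net b z -> ann b r z ->
    nrm ((z - b) * f2 z - ((z - b) * f1 z)^*) <= E.
  move=> Oz; rewrite mem_undup => /curve_netP[j [k [kN bE]]] nb ab.
  have [_ zb] := ann_lt r0 ab.
  have kt : 0 <= (k%:R / N0%:R : R) <= 1 by exact: grid_seg.
  have bb : boundary Om b by rewrite bE.
  pose v := curve_deriv (gam j) (k%:R / N0%:R).
  have D : `|complex.Re ((z - b) * v^*)| <= N0%:R^-1 / m ^+ 2 / 2 + sig * nrm (z - b).
    rewrite bE; apply: nearest_normal => //; first exact: lip.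
      by move=> s sN; apply: app => //; exact: le_trans Nms.
    by move=> c cn; rewrite -bE; apply: nb; rewrite mem_undup.
  have D' : `|complex.Re ((z - b) * v^*)| <= 3 * sig * r.
    apply: (le_trans D); have := ler_wpM2l (ltW sig0) (ltW zb); lra.
  have rl : k1 b * v + (k2 b * v)^* = 0 by rewrite bE; exact: rel.
  have T := tangent_relation mu0 (speed j _ kt) (k1M' _ bb) rl D'.
  have g1 : nrm (f1 z - k1 b) <= sig by apply: u1 => //; lra.
  have g2 : nrm (f2 z - k2 b) <= sig by apply: u2 => //; lra.
  rewrite (_ : _ - _ = (z - b) * (f2 z - k2 b) - ((z - b) * (f1 z - k1 b))^* +
     ((z - b) * k2 b - ((z - b) * k1 b)^*)); last first.
    case: (z - b) (f1 z) (f2 z) (k1 b) (k2 b) => [a1 a2] [b1 b2] [e1 e2] [g1' g2'] [l1 l2].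
    by apply: complex_ext => /=; ring.
  apply: (le_trans (nrmD _ _)).
  have B1 : nrm ((z - b) * (f2 z - k2 b) - ((z - b) * (f1 z - k1 b))^*) <= 4 * sig * r.
    apply: (le_trans (nrmB _ _)); rewrite nrm_conj !nrmM.
    have t1 : nrm (z - b) * nrm (f2 z - k2 b) <= 2 * r * sig by rewrite ler_pM ?nrm_ge0// ltW.
    have t2 : nrm (z - b) * nrm (f1 z - k1 b) <= 2 * r * sig by rewrite ler_pM ?nrm_ge0// ltW.
    lra.
  apply: (le_trans (lerD B1 T)).
  by rewrite /E le_eqVlt; apply/orP; left; apply/eqP; ring.
have := layer_estimate oOm S0 OmS (undup_uniq _) r0 fine coarse h1 h2 f1M' f2M' M0 A00 A10 PA PA1 E0 hE.
move=> /le_trans; apply; rewrite size_curve_net natrM.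
have sK : n%:R * Mc%:R * r <= K by rewrite /K -mulrA ler_wpM2l.
rewrite (_ : _ * _ = n%:R * Mc%:R * r * (72 * (A0 * (sig * (4 + 6 * M / mu)) + A1 * M * r))); last first.
  by rewrite /E; ring.
apply: (@le_trans _ _ (K * (72 * (A0 * (sig * (4 + 6 * M / mu)) + A1 * M * r)))).
  rewrite ler_wpM2r// mulr_ge0// addr_ge0//; first by rewrite mulr_ge0// mulr_ge0 ?(ltW sig0).
  by rewrite !mulr_ge0 ?(ltW r0).
rewrite (_ : _ * _ = q * sig + q' * r); first lra.
by rewrite /q /q'; ring.
Qed.

End BoundaryOrthogonality.

Section Uniqueness.
Variable R : realType.
Local Notation C := (R[i]^o).

Lemma bounded_box (Om : set C) : bounded_set Om -> exists2 S : R, 0 < S & Om `<=` box 0 S.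
Proof.
move=> [M [Mr hM]]; have Mreal : M = (complex.Re M)%:C by rewrite RRe_real.
exists (`|complex.Re M| + 1) => [|z Oz]; first by rewrite ltr_wpDl.
apply: disc_box => /=; rewrite subr0.
have lt : M < (`|complex.Re M| + 1)%:C.
  by rewrite Mreal ltcR (le_lt_trans (ler_norm _))// ltrDl.
by have := hM _ lt z Oz; rewrite /= norm_nrm lecR.
Qed.

Variables (Om : set C) (B : C -> C -> C) (T : C -> C).
Hypothesis dom : bounded_domain Om.
Hypothesis hB : is_bergman_kernel Om B.
Hypothesis hT : is_unit_tangent Om T.

(** Every polynomial is a derivative, so [boundary_ortho] gives the orthogonality that
    [span_ortho_poly] asks for. The boundary relation is multiplied by the speed to replace [T] by
    the velocity of the curve. *)
Lemma span_vanish (kap1 kap2 k1 k2 : C -> C) : bergman_span Om B kap1 -> bergman_span Om B kap2 ->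
  (forall z, boundary Om z -> kap1 x @[x --> within Om (nbhs z)] --> k1 z) ->
  (forall z, boundary Om z -> kap2 x @[x --> within Om (nbhs z)] --> k2 z) ->
  (forall z, boundary Om z -> k1 z * T z + (k2 z * T z)^* = 0) ->
  forall z, Om z -> kap1 z = 0.
Proof.
move=> s1 s2 c1 c2 rel; have [_ oOm _ /bounded_box[S S0 OmS]] := dom.
have [n [gam [curves _ tan]]] := hT.
apply: (span_ortho_poly oOm S0 OmS hB s1) => q; have [p <-] := poly_antideriv q.
apply: (boundary_ortho oOm S0 OmS curves _ _ c1 c2).
- exact: (span_a2 oOm hB s1).1.
- exact: (span_a2 oOm hB s2).1.
move=> j t; have [_ v0 _ _ bd] := curves.
have := rel (gam j t); rewrite tan bd => /(_ (ex_intro2 _ _ j Logic.I (ex_intro2 _ _ t Logic.I erefl))).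
have := v0 j t; rewrite -nrm_eq0 norm_nrm; set v := curve_deriv _ _ => vn0.
rewrite -fmorphV; move: (nrm v) vn0 => x x0 E.
have : x%:C * (k1 (gam j t) * (v * (x^-1)%:C) + (k2 (gam j t) * (v * (x^-1)%:C))^*) = 0.
  by rewrite E mulr0.
case: (k1 _) (k2 _) (v) => [a1 a2] [b1 b2] [v1 v2] <-.
by apply: complex_ext => /=; field.
Qed.

End Uniqueness.

Theorem theorem1p7 (R : realType) (Omega : set R[i]^o) (B : R[i]^o -> R[i]^o -> R[i]^o)
  (T : R[i]^o -> R[i]^o) :
  area_quadrature_domain Omega ->
  is_bergman_kernel Omega B ->
  is_unit_tangent Omega T ->
  forall f : R[i]^o -> R[i]^o, bergman_boundary_sum Omega B T f ->
    exists kappa1 kappa2 : R[i]^o -> R[i]^o,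
      [/\ bergman_span Omega B kappa1,
          bergman_span Omega B kappa2,
          represents Omega T kappa1 kappa2 f &
          forall kappa1' kappa2' : R[i]^o -> R[i]^o,
            bergman_span Omega B kappa1' ->
            bergman_span Omega B kappa2' ->
            represents Omega T kappa1' kappa2' f ->
            forall z, Omega z -> kappa1' z = kappa1 z /\ kappa2' z = kappa2 z].
Proof.
move=> [dom _ _] hB hT f [kap1 [kap2 [s1 s2 rep]]]; exists kap1, kap2; split => //.
have [k1 [k2 [b1 b2 e]]] := rep.
move=> kap1' kap2' s1' s2' [k1' [k2' [b1' b2' e']]] z Oz.
have [_ oOm _ _] := dom.
have d1 := span_sub s1' s1; have d2 := span_sub s2' s2.
have c1 w : boundary Omega w ->
    (kap1' x - kap1 x) @[x --> within Omega (nbhs w)] --> (k1' w - k1 w : R[i]^o).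
  by move=> bw; apply: cvgB; [exact: (b1' w bw).1|exact: (b1 w bw).1].
have c2 w : boundary Omega w ->
    (kap2' x - kap2 x) @[x --> within Omega (nbhs w)] --> (k2' w - k2 w : R[i]^o).
  by move=> bw; apply: cvgB; [exact: (b2' w bw).1|exact: (b2 w bw).1].
have r12 w : boundary Omega w -> (k1' w - k1 w) * T w + ((k2' w - k2 w) * T w)^* = 0.
  move=> bw; have : k1' w * T w + (k2' w * T w)^* - (k1 w * T w + (k2 w * T w)^*) = 0.
    by rewrite -e// -e'// subrr.
  move=> <-; case: (k1 w) (k2 w) (k1' w) (k2' w) (T w) => [a1 a2] [a3 a4] [a5 a6] [a7 a8] [t1 t2].
  by apply: complex_ext => /=; ring.
(* Conjugation exchanges the roles of the two components, so [span_vanish] also applies to the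
   second one. *)
have r21 w : boundary Omega w -> (k2' w - k2 w) * T w + ((k1' w - k1 w) * T w)^* = 0.
  move=> bw; have E : ((k1' w - k1 w) * T w + ((k2' w - k2 w) * T w)^*)^* = 0.
    by rewrite r12// rmorph0.
  rewrite -[RHS]E.
  case: (k1 w) (k2 w) (k1' w) (k2' w) (T w) => [a1 a2] [a3 a4] [a5 a6] [a7 a8] [t1 t2].
  by apply: complex_ext => /=; ring.
split; apply/eqP; rewrite -subr_eq0; apply/eqP.
  exact: (span_vanish dom hB hT d1 d2 c1 c2 r12 Oz).
exact: (span_vanish dom hB hT d2 d1 c2 c1 r21 Oz).
Qed.
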